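(* Up to similarity, there are precisely two combinatorially regular (finite) polyhedra $P$ of index $2$ in $\mathbb{E}^3$ with vertices on one orbit under $G(P)$ and with edges of different lengths. They are Petrie duals of each other, are of type $\{6,6\}_6$, and have their vertices at the vertices of a regular dodecahedron. One is orientable, of genus $11$, with planar faces; the other is non-orientable, of genus $22$, with non-planar faces.
   Context: Maps: a finite map $M$ is a decomposition of a closed compact surface into simply connected regions (faces) by arcs (edges) meeting at vertices; it is identified with its partially ordered set of vertices, edges and faces. A flag is a mutually incident triple (vertex, edge, face). $M$ has type $\{p,q\}$ if each face has $p$ edges and $q$ edges meet at each vertex. $\Gamma(M)$ is the group of incidence-preserving automorphisms; $M$ is (combinatorially) regular if $\Gamma(M)$ is transitive on flags. Polyhedra: a polyhedron $P$ is a faithful realization in Euclidean $3$-space $\mathbb{E}^3$ of a map $M$: vertices, edges and faces of $M$ correspond bijectively (preserving incidence) to points, line segments, and closed simple sequences of edges (face boundaries); faces need not be planar. It is required that $p\ge 3$, $q\ge 3$, and no two edges join the same pair of vertices. Put $\Gamma(P)=\Gamma(M)$. $G(P)$ is the group of isometries of $\mathbb{E}^3$ mapping $P$ to itself, viewed as a subgroup of $\Gamma(P)$. $P$ is a regular polyhedron of index $2$ if $M$ is regular and $G(P)$ has index $2$ in $\Gamma(P)$. Edge lengths: let $S$ be the convex hull of the vertices of $P$ (known to be a Platonic solid, a cuboctahedron or an icosidodecahedron, with the same vertices as $P$). The length of an edge $\{v_1,v_2\}$ of $P$ is the length of a shortest path from $v_1$ to $v_2$ along edges of $S$, where $S$ is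 scaled to have edge length $1$. Petrie duals: a Petrie polygon is a path along edges such that every two, but no three, consecutive edges lie in a common face. The Petrie dual has the same vertices and edges and has the Petrie polygons as faces. Type $\{p,q\}_r$ means type $\{p,q\}$ with Petrie polygons of length $r$. Genus and orientability refer to the underlying surface; the genus of a non-orientable surface with Euler characteristic $\chi$ is $2-\chi$. *)

(* Defs.v *)
From HB Require Import structures.
From mathcomp Require Import all_boot all_order all_algebra all_fingroup.
From mathcomp Require Import finmap boolp classical_sets reals.

Set Implicit Arguments.
Unset Strict Implicit.
Unset Printing Implicit Defensive.

Import Order.TTheory GRing.Theory Num.Theory.

Local Open Scope ring_scope.

(* A finite map is identified with its poset of vertices, edges and faces.  It
   is presented by its three sets of cells and the incidences vertex-edge and
   edge-face; a vertex lies on a face iff it lies on an edge of that face. *)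
Record cells := Cells {
  vertex : finType;
  edge : finType;
  face : finType;
  inVE : vertex -> edge -> bool;
  inEF : edge -> face -> bool }.

Section Maps.
Variable M : cells.

Implicit Types (v : vertex M) (e : edge M) (f : face M).

(* One step (v, e) -> (v', e') of a walk v, e, v', e', ... along edges: e joins
   the two distinct vertices v and v'. *)
Definition walk_step (x y : vertex M * edge M) : bool :=
  [&& x.1 != y.1, inVE x.1 x.2 & inVE y.1 x.2].

(* The dual step around a vertex: from e across the face f to e'. *)
Definition fan_step (x y : edge M * face M) : bool :=
  [&& x.1 != y.1, inEF x.1 x.2 & inEF y.1 x.2].

Definition adjacent v v' : bool := [exists e, inVE v e && inVE v' e].

(* M is the cell poset of a connected closed surface decomposed into discs
   bounded by simple closed edge paths: every edge has two ends and two sides,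
   the boundary of every face is a single simple closed edge path, and the edges
   and faces at every vertex form a single cycle (so that a vertex has a disc
   as a neighbourhood). *)
Record is_map : Prop := IsMap {
  map_inhabited : (0 < #|vertex M|)%N;
  map_connected : forall v v', connect adjacent v v';
  edge_ends : forall e, #|[set v | inVE v e]| = 2%N;
  edge_sides : forall e, #|[set f | inEF e f]| = 2%N;
  face_boundary : forall f, exists s : seq (vertex M * edge M),
    [/\ path.cycle walk_step s, uniq (unzip1 s), uniq (unzip2 s)
      & forall e, (e \in unzip2 s) = inEF e f];
  vertex_star : forall v, exists s : seq (edge M * face M),
    [/\ path.cycle fan_step s, uniq (unzip1 s), uniq (unzip2 s),
        forall e, (e \in unzip1 s) = inVE v e
      & forall f, (f \in unzip2 s) = [exists e, inVE v e && inEF e f]] }.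

Definition face_size f : nat := #|[set e | inEF e f]|.
Definition degree v : nat := #|[set e | inVE v e]|.

Definition has_type (p q : nat) : Prop :=
  (forall f, face_size f = p) /\ (forall v, degree v = q).

Definition cell_perm : finGroupType :=
  ({perm vertex M} * {perm edge M} * {perm face M})%type.

Definition Gamma : {set cell_perm} :=
  [set g : cell_perm |
    [forall v, forall e, inVE (g.1.1 v) (g.1.2 e) == inVE v e] &&
    [forall e, forall f, inEF (g.1.2 e) (g.2 f) == inEF e f]].

Definition is_flag (x : vertex M * edge M * face M) : bool :=
  inVE x.1.1 x.1.2 && inEF x.1.2 x.2.

Definition regular : Prop :=
  forall x y, is_flag x -> is_flag y ->
  exists2 g, g \in Gamma & (g.1.1 x.1.1, g.1.2 x.1.2, g.2 x.2) = y.

(* A Petrie polygon, traversed indefinitely: w i is its i-th vertex together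
   with the edge leading to the next vertex. *)
Definition petrie_polygon (w : nat -> vertex M * edge M) : Prop :=
  forall i, [/\ walk_step (w i) (w i.+1),
    exists f, inEF (w i).2 f && inEF (w i.+1).2 f &
    ~ exists f, [&& inEF (w i).2 f, inEF (w i.+1).2 f & inEF (w i.+2).2 f]].

Definition is_period (w : nat -> vertex M * edge M) (r : nat) : Prop :=
  (0 < r)%N /\ forall i, w (i + r)%N = w i.

Definition petrie_length (w : nat -> vertex M * edge M) (r : nat) : Prop :=
  is_period w r /\ forall r', is_period w r' -> (r <= r')%N.

(* Type {p,q}_r: type {p,q} with Petrie polygons of length r. *)
Definition has_petrie_type (p q r : nat) : Prop :=
  has_type p q /\ forall w, petrie_polygon w -> petrie_length w r.

(* The faces can be oriented coherently.  An orientation of the cycle bounding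
   f is given by the tails of its edges: each edge of f starts at one of its
   ends, and distinct edges of f start at distinct vertices.  The two faces at
   an edge must induce opposite directions on it. *)
Definition orientable : Prop :=
  exists tail : face M -> edge M -> vertex M,
  [/\ forall f e, inEF e f -> inVE (tail f e) e,
      forall f e e', inEF e f -> inEF e' f -> tail f e = tail f e' -> e = e'
    & forall e f f', inEF e f -> inEF e f' -> f != f' ->
        tail f e != tail f' e].

Definition euler_char : int :=
  #|vertex M|%:Z - #|edge M|%:Z + #|face M|%:Z.

Definition orientable_of_genus (g : nat) : Prop :=
  orientable /\ euler_char = 2 - 2 * g%:Z.

Definition nonorientable_of_genus (g : nat) : Prop :=
  ~ orientable /\ g%:Z = 2 - euler_char.

End Maps.

Lemma Gamma_group_set (M : cells) : group_set (Gamma M).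
Proof.
apply/group_setP; split.
  rewrite inE; apply/andP; split; do 2![apply/forallP => ?];
  by rewrite /= !perm1.
move=> g h; rewrite !inE => /andP[/'forall_forallP g1 /'forall_forallP g2].
move=> /andP[/'forall_forallP h1 /'forall_forallP h2].
apply/andP; split; do 2![apply/forallP => ?]; rewrite /= !permM.
  by rewrite (eqP (h1 _ _)) (eqP (g1 _ _)).
by rewrite (eqP (h2 _ _)) (eqP (g2 _ _)).
Qed.

Canonical Gamma_group (M : cells) := Group (Gamma_group_set M).

Lemma imfset_compE (T U V : choiceType) (s : T -> U) (t : U -> V) (A : {fset T}) :
  [fset t y | y in [fset s x | x in A]]%fset = [fset t (s x) | x in A]%fset.
Proof.
apply/fsetP => z; apply/imfsetP/imfsetP => /= [[y /imfsetP[x xA ->] ->]|].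
  by exists x.
by case=> x xA ->; exists (s x) => //; apply/imfsetP; exists x.
Qed.

Lemma eq_idfset (T : choiceType) (s : T -> T) (A : {fset T}) :
  s =1 id -> [fset s x | x in A]%fset = A.
Proof. by move=> sE; rewrite -[RHS]imfset_id; apply: eq_imfset. Qed.

Section Euclidean.
Variable R : realType.

Local Notation E3 := 'rV[R]_3.

Definition dot (x y : E3) : R := \sum_i x 0 i * y 0 i.

(* The library norm on row vectors is the sup norm. *)
Definition edist (x y : E3) : R := Num.sqrt (dot (x - y) (x - y)).

Definition isometry (s : E3 -> E3) : Prop :=
  forall x y, edist (s x) (s y) = edist x y.

Definition similarity (s : E3 -> E3) : Prop :=
  exists2 k : R, 0 < k & forall x y, edist (s x) (s y) = k * edist x y.

Definition conv_hull (V : {fset E3}) : set E3 :=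
  [set x | exists w : V -> R, [/\ forall v, 0 <= w v, \sum_v w v = 1
                                & x = \sum_v w v *: val v]]%classic.

(* The segment [u, v] is an edge of the convex hull S of V: it is the
   intersection of S with a supporting hyperplane. *)
Definition hull_edge (V : {fset E3}) (u v : E3) : Prop :=
  u <> v /\
  exists (a : E3) (b : R),
    (forall x, conv_hull V x -> dot a x <= b) /\
    [set x | conv_hull V x /\ dot a x = b]%classic = conv_hull [fset u; v]%fset.

Inductive hull_path (V : {fset E3}) : E3 -> E3 -> nat -> Prop :=
| hull_path0 u : hull_path V u u 0
| hull_pathS u v w n :
    hull_edge V u v -> hull_path V v w n -> hull_path V u w n.+1.

Definition hull_distance (V : {fset E3}) (u v : E3) (n : nat) : Prop :=
  hull_path V u v n /\ forall m, hull_path V u v m -> (n <= m)%N.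

(* An edge is a line segment and is given by its two endpoints; a face is a
   simple closed sequence of edges and is given by the set of these edges. *)
Record figure := Figure {
  verts : {fset E3};
  edges : {fset {fset E3}};
  faces : {fset {fset {fset E3}}} }.

Definition map_of (P : figure) : cells :=
  @Cells (verts P) (edges P) (faces P)
    (fun v e => val v \in val e) (fun e f => val e \in val f).

(* Distinct edges have distinct pairs of endpoints by construction. *)
Record is_polyhedron (P : figure) : Prop := IsPolyhedron {
  edges_on_verts : forall e, e \in edges P -> {subset e <= verts P};
  faces_on_edges : forall f, f \in faces P -> {subset f <= edges P};
  polyhedron_map : is_map (map_of P);
  face_size_ge3 : forall f : face (map_of P), (3 <= face_size f)%N;
  degree_ge3 : forall v : vertex (map_of P), (3 <= degree v)%N }.

Definition image_edge (s : E3 -> E3) (e : {fset E3}) : {fset E3} :=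
  [fset s x | x in e]%fset.

Definition image_face (s : E3 -> E3) (f : {fset {fset E3}}) :
  {fset {fset E3}} := [fset image_edge s e | e in f]%fset.

Definition image_figure (s : E3 -> E3) (P : figure) : figure :=
  Figure [fset s x | x in verts P]%fset
         [fset image_edge s e | e in edges P]%fset
         [fset image_face s f | f in faces P]%fset.

Definition similar_figures (P Q : figure) : Prop :=
  exists2 s, similarity s & image_figure s P = Q.

Definition symmetry (P : figure) (s : E3 -> E3) : Prop :=
  isometry s /\ image_figure s P = P.

Definition induces (P : figure) (s : E3 -> E3) (g : cell_perm (map_of P)) :
  Prop :=
  [/\ forall v : verts P, val (g.1.1 v) = s (val v),
      forall e : edges P, val (g.1.2 e) = image_edge s (val e)
    & forall f : faces P, val (g.2 f) = image_face s (val f)].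

(* The geometric symmetry group, as a subgroup of Gamma. *)
Definition Gsym (P : figure) : {set cell_perm (map_of P)} :=
  [set g | `[< exists2 s, symmetry P s & induces s g >]].

Lemma image_edge_id : image_edge id =1 id.
Proof. by move=> e; apply: eq_idfset. Qed.

Lemma image_face_id : image_face id =1 id.
Proof. by move=> f; apply: eq_idfset; apply: image_edge_id. Qed.

Lemma image_edge_comp s t (e : {fset E3}) :
  image_edge (t \o s) e = image_edge t (image_edge s e).
Proof. by rewrite /image_edge imfset_compE. Qed.

Lemma image_face_comp s t (f : {fset {fset E3}}) :
  image_face (t \o s) f = image_face t (image_face s f).
Proof.
by rewrite /image_face imfset_compE; apply: eq_imfset => // e;
  apply: image_edge_comp.
Qed.

Lemma Gsym_group_set (P : figure) : group_set (Gsym P).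
Proof.
apply/group_setP; split.
  rewrite inE; apply/asboolP; exists id.
    split=> //; case: P => V E F; rewrite /image_figure /=; congr Figure.
    - exact: eq_idfset.
    - by apply: eq_idfset; apply: image_edge_id.
    - by apply: eq_idfset; apply: image_face_id.
  by split=> x /=; rewrite perm1 ?image_edge_id ?image_face_id.
move=> g h; rewrite !inE => -[s [si sP] [g1 g2 g3]] [t [ti tP] [h1 h2 h3]].
exists (t \o s).
  split; first by move=> x y /=; rewrite ti si.
  rewrite -[RHS]tP -[in RHS]sP /image_figure /= !imfset_compE; congr Figure.
  - by apply: eq_imfset => // e; apply: image_edge_comp.
  - by apply: eq_imfset => // f; apply: image_face_comp.
split=> x /=; rewrite permM.
- by rewrite h1 g1.
- by rewrite h2 g2 image_edge_comp.
- by rewrite h3 g3 image_face_comp.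
Qed.

Canonical Gsym_group (P : figure) := Group (Gsym_group_set P).

Lemma Gsym_sub_Gamma (P : figure) : Gsym P \subset Gamma (map_of P).
Proof.
apply/fintype.subsetP => g; rewrite !inE => -[s [si _] [g1 g2 g3]].
have sqr_dot (x : E3) i : true -> 0 <= x 0 i * x 0 i.
  by rewrite -expr2 sqr_ge0.
have dot_eq0 (x : E3) : dot x x <= 0 -> x = 0.
  move=> x0; apply/rowP => i; rewrite mxE; apply/eqP.
  have d0 : dot x x = 0.
    apply/le_anti/andP; split=> //; apply: sumr_ge0 => j _; exact: sqr_dot.
  have /(_ i isT) := psumr_eq0P (@sqr_dot x) d0.
  by move/eqP; rewrite mulf_eq0 orbb.
have s_inj : injective s.
  move=> x y sxy; apply/eqP; rewrite -subr_eq0; apply/eqP/dot_eq0.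
  rewrite -sqrtr_eq0 -/(edist x y) -si sxy /edist subrr /dot big1 ?sqrtr0 //.
  by move=> i _; rewrite mxE mul0r.
have e_inj : injective (image_edge s).
  move=> e e' ee'; apply/fsetP => x.
  have : (s x \in image_edge s e) = (s x \in image_edge s e') by rewrite ee'.
  by rewrite /image_edge !(mem_imfset imfset_key _ s_inj).
apply/andP; split; apply/forallP => x; apply/forallP => y /=.
  by rewrite g1 g2 (mem_imfset imfset_key _ s_inj).
by rewrite g2 g3 (mem_imfset imfset_key _ e_inj).
Qed.

Definition regular_index2 (P : figure) : Prop :=
  [/\ is_polyhedron P, regular (map_of P)
    & #|Gamma (map_of P) : Gsym P|%g = 2%N].

Definition one_vertex_orbit (P : figure) : Prop :=
  forall u v : verts P, exists2 g, g \in Gsym P & g.1.1 u = v.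

(* The length of an edge {u, v} is the number of edges in a shortest path from
   u to v along edges of the convex hull of the vertices. *)
Definition edges_of_different_lengths (P : figure) : Prop :=
  exists u v u' v' n n',
    [/\ [fset u; v]%fset \in edges P, [fset u'; v']%fset \in edges P,
        hull_distance (verts P) u v n, hull_distance (verts P) u' v' n'
      & n <> n'].

(* The faces of Q are the Petrie polygons of P. *)
Definition petrie_dual (P Q : figure) : Prop :=
  [/\ verts Q = verts P, edges Q = edges P
    & forall f : {fset {fset E3}}, f \in faces Q <->
        exists2 w, petrie_polygon (M := map_of P) w
          & forall e, e \in f <-> exists i, e = val (w i).2].

Definition planar_face (f : {fset {fset E3}}) : Prop :=
  exists (a : E3) (b : R), a <> 0 /\
    forall e x, e \in f -> x \in e -> dot a x = b.

(* The 20 points (+-1, +-1, +-1) and the cyclic permutations of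
   (0, +-1/phi, +-phi), where phi is the golden ratio; indices are mod 3. *)
Definition golden : R := (1 + Num.sqrt 5) / 2.

Definition std_dodecahedron : set E3 :=
  [set x : E3 | (forall i, `|x 0 i| = 1) \/
     exists i : 'I_3, [/\ x 0 i = 0, `|x 0 (i + 1)| = golden^-1
                        & `|x 0 (i + 2)| = golden]]%classic.

Definition dodecahedral_vertices (P : figure) : Prop :=
  exists2 s, similarity s & [set` verts P]%classic = (s @` std_dodecahedron)%classic.

End Euclidean.

(* Main.v *)
(* Put the origin at the centroid of the vertices.  If an automorphism fixing an
   edge did not lie in G(P), then, G(P) having index 2, some symmetry would carry
   an edge to an adjacent one and all edges would be equivalent under G(P).  So
   edges of different lengths force the stabilizer of each edge {u, w} into
   G(P), and the reflections in u - w and in u x w preserve the vertex set.  Two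
   mirrors through a vertex v and one that misses v by as little as possible
   bound a chamber of a finite reflection group, and the values possible for the
   Coxeter labels of this chamber leave eight vertex sets.  An automorphism
   exchanging two adjacent edges conjugates the symmetries of the one into the
   symmetries of the other; comparing the orders of their products leaves only
   the dodecahedron and, up to symmetry, the edges and faces of two figures.
   These are described by tables over the 20 vertices, and their combinatorial
   properties are finite computations in the tables. *)

Require Import Defs.
From HB Require Import structures.
From mathcomp Require Import all_boot all_order all_algebra all_fingroup.
From mathcomp Require Import finmap boolp classical_sets reals.
From mathcomp Require Import ring lra zify.

Set Implicit Arguments.
Unset Strict Implicit.
Unset Printing Implicit Defensive.

Import Order.TTheory GRing.Theory Num.Theory.

Local Open Scope ring_scope.

(** The chamber is found by extremal choices, not from a theory of Coxeter groups. Discreteness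
    comes from minimality alone: the products of [v] with the roots of a dihedral subsystem are
    Chebyshev multiples of the least one, which pins a label to 2 cos (pi/m) with m = 2, 3, 4, 5 or
    makes it at least sqrt 3, and a Gram determinant excludes the large ones. The eight cases are
    the linear diagrams A3, B3, H3 with [v] off the mirror of one node only: an end node gives the
    five Platonic solids, the middle node gives the octahedron again, the cuboctahedron and the
    icosidodecahedron. Each edge {u, w} has a flip, exchanging its two faces, and a turn, reversing
    it within a face. The flip is always the reflection in u x w; the turn is the reflection in u -
    w or that reflection times the flip. This single bit separates the two figures. Changing it
    multiplies the turn by the flip, which is the Petrie operation, so the two figures are Petrie
    duals. All coordinates can be taken in Z[phi], where equality is decidable; the comparison of
    orders then becomes a computation with permutations of at most 30 points. *)

Section Euclid.
Variable R : realType.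
Local Notation E3 := 'rV[R]_3.
Implicit Types (x y z r s : E3) (k l : R) (A : 'M[R]_3).

(** * Inner product of row vectors in coordinates *)

Definition vec3 (a b c : R) : E3 := \row_j [:: a; b; c]`_j.

Lemma dot3 x y : dot x y = x 0 0 * y 0 0 + x 0 1 * y 0 1 + x 0 2%:R * y 0 2%:R.
Proof.
rewrite /dot !big_ord_recl big_ord0 addr0 addrA.
by congr (_ + _ + _); congr (_ * _); congr (_ _ _); apply: val_inj.
Qed.

Lemma row3P x y : x 0 0 = y 0 0 -> x 0 1 = y 0 1 -> x 0 2%:R = y 0 2%:R -> x = y.
Proof.
move=> e0 e1 e2; apply/rowP => -[[|[|[|//]]] i].
- by rewrite (_ : Ordinal i = 0) //; apply: val_inj.
- by rewrite (_ : Ordinal i = 1) //; apply: val_inj.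
- by rewrite (_ : Ordinal i = 2%:R) //; apply: val_inj.
Qed.

Lemma vec3E a b c :
  ((vec3 a b c 0 0 = a) * (vec3 a b c 0 1 = b) * (vec3 a b c 0 2%:R = c))%type.
Proof. by rewrite !mxE. Qed.

Lemma dotC x y : dot x y = dot y x.
Proof. by rewrite !dot3; ring. Qed.

Lemma dotDl x y z : dot (x + y) z = dot x z + dot y z.
Proof. by rewrite !dot3 !mxE; ring. Qed.

Lemma dotZl k x y : dot (k *: x) y = k * dot x y.
Proof. by rewrite !dot3 !mxE; ring. Qed.

Lemma dotNl x y : dot (- x) y = - dot x y.
Proof. by rewrite !dot3 !mxE; ring. Qed.

Lemma dotDr x y z : dot x (y + z) = dot x y + dot x z.
Proof. by rewrite ![dot x _]dotC dotDl. Qed.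

Lemma dotZr k x y : dot x (k *: y) = k * dot x y.
Proof. by rewrite ![dot x _]dotC dotZl. Qed.

Lemma dotNr x y : dot x (- y) = - dot x y.
Proof. by rewrite ![dot x _]dotC dotNl. Qed.

Lemma dot0l x : dot 0 x = 0.
Proof. by rewrite !dot3 !mxE; ring. Qed.

Lemma dot0r x : dot x 0 = 0.
Proof. by rewrite dotC dot0l. Qed.

Definition dotE := (dotDl, dotDr, dotNl, dotNr, dotZl, dotZr, dot0l, dot0r).

Lemma dot_suml (I : Type) (t : seq I) (P : pred I) (F : I -> E3) x :
  dot (\sum_(i <- t | P i) F i) x = \sum_(i <- t | P i) dot (F i) x.
Proof.
apply: (big_morph (fun y => dot y x)) => [y z|]; first exact: dotDl.
exact: dot0l.
Qed.

Lemma dot_ge0 x : 0 <= dot x x.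
Proof. by rewrite dot3 -!expr2 !addr_ge0 ?sqr_ge0. Qed.

Lemma dot_eq0 x : dot x x = 0 -> x = 0.
Proof.
rewrite dot3 => x0; apply: row3P; rewrite !mxE; apply/eqP;
  rewrite -sqrf_eq0; apply/eqP;
  have := (sqr_ge0 (x 0 0), sqr_ge0 (x 0 1), sqr_ge0 (x 0 2%:R));
  move=> [[h0 h1] h2]; lra.
Qed.

Lemma dot_gt0 x : x != 0 -> 0 < dot x x.
Proof.
by move=> x0; rewrite lt_neqAle dot_ge0 eq_sym andbT; apply: contra_neq x0 => /dot_eq0.
Qed.

Lemma sqr_edist x y : edist x y ^+ 2 = dot (x - y) (x - y).
Proof. by rewrite sqr_sqrtr // dot_ge0. Qed.

(** * Reflections *)

(** Division by zero makes [refl 0] the identity, so most laws below need no condition on [r]. *)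
Definition refl r x : E3 := x - (2 * dot x r / dot r r) *: r.

Lemma reflE r x k : dot r r *: (x - refl r x) = (2 * dot x r) *: r.
Proof.
rewrite /refl opprD addNKr opprK scalerA.
have [->|/dot_gt0 r0] := eqVneq r 0; first by rewrite !scaler0.
by rewrite mulrC divfK // gt_eqF.
Qed.

Lemma refl_uniq r x y : r != 0 ->
  dot r r *: (x - y) = (2 * dot x r) *: r -> refl r x = y.
Proof.
move=> /dot_gt0 r0 e; rewrite /refl.
have -> : (2 * dot x r / dot r r) *: r = x - y.
  by rewrite mulrC -scalerA -e scalerA mulVf ?scale1r // gt_eqF.
by rewrite subKr.
Qed.

Lemma refl_opp r x : refl r x = - x -> x = (dot x r / dot r r) *: r.
Proof.
move=> e; have h i := congr1 (fun z : E3 => z 0 i) e.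
by apply: row3P; rewrite !mxE; [have := h 0|have := h 1|have := h 2%:R]; rewrite !mxE; lra.
Qed.

Lemma reflZ k r x : k != 0 -> refl (k *: r) x = refl r x.
Proof.
move=> k0; rewrite /refl !dotE scalerA.
have [->|/dot_gt0 r0] := eqVneq r 0; first by rewrite !scaler0.
congr (_ - _ *: _); field; rewrite k0 gt_eqF //.
Qed.

Lemma reflN r x : refl (- r) x = refl r x.
Proof. by rewrite -scaleN1r reflZ // oppr_eq0 oner_eq0. Qed.

Lemma refl_unit r x : dot r r = 1 -> refl r x = x - (2 * dot x r) *: r.
Proof. by move=> r1; rewrite /refl r1 divr1. Qed.

Lemma refl_linear r : linear (refl r).
Proof.
move=> k x y; rewrite /refl !dotE scalerBr addrACA -opprD; congr (_ - _).
by rewrite scalerA -scalerDl; congr (_ *: _); ring.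
Qed.

HB.instance Definition _ r := GRing.isLinear.Build R E3 E3 _ (refl r) (refl_linear r).

Lemma reflK r : involutive (refl r).
Proof.
move=> x; have [->|/dot_gt0 r0] := eqVneq r 0; first by rewrite /refl !scaler0 !subr0.
rewrite /refl !dotE -addrA -opprD -scalerDl -[RHS]subr0; congr (_ - _).
rewrite -[RHS](scale0r r); congr (_ *: _).
by field; rewrite gt_eqF.
Qed.

Lemma dot_refl r x y : dot (refl r x) (refl r y) = dot x y.
Proof.
have [->|/dot_gt0 r0] := eqVneq r 0; first by rewrite /refl !scaler0 !subr0.
by rewrite /refl !dotE (dotC r y); field; rewrite gt_eqF.
Qed.

Lemma dot_reflC r x y : dot (refl r x) y = dot x (refl r y).
Proof. by rewrite -{1}(reflK r y) dot_refl. Qed.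

Lemma refl_perp r x : dot x r = 0 -> refl r x = x.
Proof. by move=> xr; rewrite /refl xr mulr0 mul0r scale0r subr0. Qed.

Lemma refl_id r : refl r r = - r.
Proof.
have [->|/dot_gt0 r0] := eqVneq r 0; first by rewrite /refl !scaler0 !subr0 oppr0.
by rewrite /refl mulfK ?gt_eqF // scaler_nat opprD addrA subrr sub0r.
Qed.

Lemma refl_conj r s x : refl (refl s r) x = refl s (refl r (refl s x)).
Proof.
have E t z : refl t z = z - (2 * dot z t / dot t t) *: t by [].
by rewrite E (E r) [RHS]linearB [in RHS]linearZ /= reflK dot_refl dot_reflC.
Qed.

Lemma refl_swap x y : dot x x = dot y y -> refl (x - y) x = y.
Proof.
move=> exy; have [->|xy] := eqVneq x y; first by rewrite subrr /refl scaler0 subr0.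
apply: refl_uniq; first by rewrite subr_eq0.
by congr (_ *: _); rewrite !dotE (dotC y x) exy; ring.
Qed.

(** * Cross product *)

Definition cross x y : E3 :=
  vec3 (x 0 1 * y 0 2%:R - x 0 2%:R * y 0 1) (x 0 2%:R * y 0 0 - x 0 0 * y 0 2%:R)
       (x 0 0 * y 0 1 - x 0 1 * y 0 0).

Lemma dot_crossl x y : dot x (cross x y) = 0.
Proof. by rewrite dot3 !vec3E; ring. Qed.

Lemma dot_crossr x y : dot y (cross x y) = 0.
Proof. by rewrite dot3 !vec3E; ring. Qed.

Lemma crossZ_self (m : R) x : cross (m *: x) x = 0.
Proof. by apply: row3P; rewrite !vec3E !mxE; ring. Qed.

Lemma crossZr_self (m : R) x : cross x (m *: x) = 0.
Proof. by apply: row3P; rewrite !vec3E !mxE; ring. Qed.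

Lemma cross_norm x y :
  dot (cross x y) (cross x y) = dot x x * dot y y - dot x y ^+ 2.
Proof. by rewrite !dot3 !vec3E; ring. Qed.

(** The expansion of [z] in the basis dual to [x], [y], [cross x y], cleared of its denominator; as
    a polynomial identity it holds even when [x] and [y] are parallel. *)
Lemma cross_decomp x y z :
  dot (cross x y) (cross x y) *: z = dot z (cross x y) *: cross x y
    + dot z x *: cross y (cross x y) + dot z y *: cross (cross x y) x.
Proof. by apply: row3P; rewrite !mxE !dot3 !vec3E /=; ring. Qed.

Lemma perp_cross x y z : cross x y != 0 -> dot z x = 0 -> dot z y = 0 ->
  exists k, z = k *: cross x y.
Proof.
move=> /dot_gt0 n0 zx zy; have := cross_decomp x y z.
rewrite zx zy !scale0r !addr0 => e.
exists (dot z (cross x y) / dot (cross x y) (cross x y)).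
by rewrite mulrC -scalerA -e scalerA mulVf ?scale1r // gt_eqF.
Qed.

(** Equality in Cauchy-Schwarz: by Lagrange's identity [cross_norm], the component of [y] orthogonal
    to [x] has norm zero. *)
Lemma cross0 x y : x != 0 -> cross x y = 0 -> exists k, y = k *: x.
Proof.
move=> /dot_gt0 x0 c0; exists (dot x y / dot x x).
have /eqP := congr1 (fun z => dot z z) c0; rewrite cross_norm dot0l subr_eq0 => /eqP e.
apply/eqP; rewrite -subr_eq0; apply/eqP/dot_eq0; rewrite !dotE (dotC y x).
have -> : dot y y = dot x y ^+ 2 / dot x x by rewrite -e mulrC mulKf ?gt_eqF.
by field; rewrite gt_eqF.
Qed.

(** * Orthogonal matrices, isometries and similarities *)

Definition orthogonal_mx A := A *m A^T = 1%:M.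

Lemma dot_mulmx x y : dot x y = (x *m y^T) 0 0.
Proof. by rewrite mxE; apply: eq_bigr => i _; rewrite mxE. Qed.

Lemma dot_orth A x y : orthogonal_mx A -> dot (x *m A) (y *m A) = dot x y.
Proof.
by move=> hA; rewrite !dot_mulmx trmx_mul mulmxA -(mulmxA x) hA mulmx1.
Qed.

Lemma orth_tr A : orthogonal_mx A -> A^T *m A = 1%:M.
Proof. by move/mulmx1C. Qed.

Lemma orth_trmx A : orthogonal_mx A -> orthogonal_mx A^T.
Proof. by rewrite /orthogonal_mx trmxK => /orth_tr. Qed.

Lemma refl_orth A r x : orthogonal_mx A -> refl (r *m A) (x *m A) = refl r x *m A.
Proof. by move=> hA; rewrite /refl !dot_orth // mulmxBl scalemxAl. Qed.

(** After subtracting [s 0] and dividing by [k], the map preserves distances and the origin, hence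
    inner products by polarization. Its values on the unit vectors are the rows of [A], and the
    squared norm of [f x - x *m A] expands to zero. *)
Lemma similarity_affine (s : E3 -> E3) k : 0 < k ->
  (forall x y, edist (s x) (s y) = k * edist x y) ->
  exists2 A, orthogonal_mx A & forall x, s x = k *: (x *m A) + s 0.
Proof.
move=> k0 hs; pose f x := k^-1 *: (s x - s 0).
have k1 : k != 0 by rewrite gt_eqF.
have f0 : f 0 = 0 by rewrite /f subrr scaler0.
have fB x y : dot (f x - f y) (f x - f y) = dot (x - y) (x - y).
  rewrite /f -scalerBr opprB addrA subrK.
  have /(congr1 (fun t => t ^+ 2)) := hs x y.
  rewrite exprMn !sqr_edist dotZl dotZr => ->.
  by field.
have fS x : s x = k *: f x + s 0 by rewrite /f scalerA mulfV // scale1r subrK.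
clearbody f.
have fn x : dot (f x) (f x) = dot x x by have := fB x 0; rewrite f0 !subr0.
have fd x y : dot (f x) (f y) = dot x y.
  have := fB x y; rewrite !dotE !fn (dotC (f y)) (dotC y); lra.
pose A : 'M[R]_3 := \matrix_i f (delta_mx 0 i).
have rA i : row i A = f (delta_mx 0 i) by rewrite rowK.
have dd x i : dot x (delta_mx 0 i) = x 0 i.
  rewrite /dot (bigD1 i) //= big1 ?mxE ?eqxx ?mulr1 ?addr0 // => j ji.
  by rewrite mxE (negPf ji) andbF mulr0.
have hA : orthogonal_mx A.
  apply/matrixP => i j; rewrite !mxE.
  have -> : \sum_l A i l * A^T l j = dot (row i A) (row j A).
    by apply: eq_bigr => l _; rewrite !mxE.
  by rewrite !rA fd dd mxE eqxx eq_sym.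
exists A => // x; rewrite fS; congr (_ *: _ + _).
apply/eqP; rewrite -subr_eq0; apply/eqP/dot_eq0.
have fxA : dot (f x) (x *m A) = dot x x.
  rewrite {2}[x]row_sum_delta mulmx_suml dotC dot_suml [RHS]/dot.
  by apply: eq_bigr => i _; rewrite -scalemxAl -rowE rA dotZl dotC fd dd.
by rewrite !dotE (dotC (x *m A)) fxA dot_orth // fn; ring.
Qed.

Lemma affine_edist A k z x y : orthogonal_mx A -> 0 <= k ->
  edist (k *: (x *m A) + z) (k *: (y *m A) + z) = k * edist x y.
Proof.
move=> hA k0; rewrite /edist opprD addrACA subrr addr0 -scalerBr -mulmxBl dotZl dotZr.
by rewrite !dot_orth // mulrA -expr2 sqrtrM ?sqr_ge0 // sqrtr_sqr ger0_norm.
Qed.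

End Euclid.

(** * Root systems, heights in dihedral subsystems and words of reflections *)

Section Roots.
Variable R : realType.
Local Notation E3 := 'rV[R]_3.
Implicit Types (x y z r s T : E3) (S Psi Q : E3 -> Prop).

Lemma unit_eq r s : dot r r = 1 -> dot s s = 1 -> 1 <= dot r s -> r = s.
Proof.
move=> r1 s1 rs; apply/eqP; rewrite -subr_eq0; apply/eqP/dot_eq0/eqP.
by rewrite eq_le dot_ge0 andbT !dotE r1 s1 (dotC s); lra.
Qed.

(** Neither finiteness nor integrality is built in; discreteness enters through a root of least
    nonzero height. *)
Definition root_system Psi :=
  (forall r, Psi r -> dot r r = 1) /\ (forall r s, Psi r -> Psi s -> Psi (refl r s)).

Lemma root_opp Psi r : root_system Psi -> Psi r -> Psi (- r).
Proof. by move=> [_ c] pr; have := c _ _ pr pr; rewrite refl_id. Qed.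

(* The vectors [- alpha, rho, ...] with consecutive products [x / 2] are roots
   of a dihedral group; their heights over [T] are [h] times the Chebyshev
   polynomials [0, 1, x, x^2 - 1, ...]. *)
Lemma height_discrete Psi T a r (h x : R) : root_system Psi -> Psi a -> Psi r ->
  dot T a = 0 -> dot T r = h -> 0 < h ->
  (forall s, Psi s -> dot T s = 0 \/ h <= `|dot T s|) ->
  dot a r = - (x / 2) -> 0 <= x ->
  [\/ x = 0, x = 1, x ^+ 2 = 2 | x ^+ 2 = x + 1] \/ 3 <= x ^+ 2.
Proof.
move=> hP Pa Pr Ta Tr h0 hmin ar x0.
(* [- refl c b] equals [x *: c - b]: the three-term recurrence of the Chebyshev polynomials, which
   keeps consecutive products equal to [x / 2]. *)
have step b c p q : Psi b -> Psi c -> dot b c = x / 2 -> dot T b = p * h ->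
    dot T c = q * h -> exists d,
    [/\ Psi d, dot c d = x / 2 & dot T d = (x * q - p) * h].
  move=> Pb Pc bc Tb Tc; exists (- refl c b).
  have c1 : dot c c = 1 by case: hP => hu _; apply: hu.
  split; first by apply: (root_opp hP); case: hP => _ cl; apply: cl.
    by rewrite refl_unit // !dotE c1 (dotC c b) bc; lra.
  by rewrite refl_unit // !dotE bc Tb Tc; lra.
have low b p : Psi b -> dot T b = p * h -> p = 0 \/ 1 <= `|p|.
  move=> Pb Tb; have := hmin b Pb; rewrite Tb => -[/eqP|].
    by rewrite mulf_eq0 (gt_eqF h0) orbF => /eqP ->; left.
  by rewrite normrM (gtr0_norm h0) ler_pMl // => ?; right.
have Na := root_opp hP Pa.
have [r2 [P2 d2 T2]] : exists d, [/\ Psi d, dot r d = x / 2 & dot T d = (x * 1 - 0) * h].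
  by apply: (@step (- a)) => //; rewrite ?dotE ?ar ?Ta; lra.
have T1 : dot T r = 1 * h by lra.
have [r3 [P3 d3 T3]] := step _ _ _ _ Pr P2 d2 T1 T2.
have [r4 [P4 d4 T4]] := step _ _ _ _ P2 P3 d3 T2 T3.
have [r5 [P5 d5 T5]] := step _ _ _ _ P3 P4 d4 T3 T4.
(* The heights are [h] times x, x^2 - 1, x^3 - 2x and x^4 - 3x^2 + 1. The first of these to vanish
   gives the label of pi/2, pi/3, pi/4 or pi/5; if none vanishes, the last is at least 1, that is,
   x^2 is at least 3. *)
have := (low _ _ P2 T2, low _ _ P3 T3, low _ _ P4 T4, low _ _ P5 T5).
move=> [[[l2 l3] l4] l5] {step low P2 P3 P4 P5 d2 d3 d4 d5 T1 T2 T3 T4 T5 hmin}.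
case: l2; first by move=> ?; left; constructor 1; lra.
rewrite ger0_norm; last by lra.
move=> x1; case: (ltP 3 (x ^+ 2)) => x3; first by right; lra.
case: l3; first by move=> ?; left; constructor 2; nra.
rewrite ger0_norm; last by nra.
move=> x2; have {x2} x2 : 2 <= x ^+ 2 by lra.
have {}x0 : 0 < x by lra.
case: l4.
  move=> e; left; constructor 3.
  have /eqP : x * (x ^+ 2 - 2) = 0 by lra.
  by rewrite mulf_eq0 gt_eqF //= subr_eq0 => /eqP.
rewrite (_ : _ - _ = x * (x ^+ 2 - 2)); last by ring.
rewrite ger0_norm; last by apply: mulr_ge0; lra.
move=> x4; have {}x4 : 0 <= (x + 1) * (x ^+ 2 - x - 1) by nra.
rewrite pmulr_rge0 in x4; last by lra.
rewrite (_ : _ - _ = (x ^+ 2 - x - 1) * (x ^+ 2 + x - 1)) in l5; last by ring.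
case: l5 => [/eqP|].
  by rewrite mulf_eq0 => /orP[/eqP e|/eqP e]; [left; constructor 4|]; lra.
rewrite ger0_norm; last by apply: mulr_ge0; lra.
by move=> ?; right; have : 0 <= x ^+ 2 * (x ^+ 2 - 3) by [nra|lra];
  rewrite pmulr_rge0 ?subr_ge0 // exprn_gt0.
Qed.

(** * Words of reflections *)

Definition act (w : seq E3) x := foldr (@refl R) x w.

Lemma refl_act w s x : refl (act w s) x = act w (refl s (act (rev w) x)).
Proof.
elim: w x => //= r w IH x; rewrite refl_conj IH rev_cons -cats1.
by rewrite [in RHS]/act foldr_cat.
Qed.

Definition word_in S (w : seq E3) := forall s, s \in w -> S s.

Definition closed_under S Q := forall s x, S s -> Q x -> Q (refl s x).

Lemma closed_act S Q w x : closed_under S Q -> word_in S w -> Q x -> Q (act w x).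
Proof.
move=> hQ; elim: w => [|s w IH] //= hw Qx; apply: (hQ); first by apply: hw; rewrite mem_head.
by apply: IH => // t tw; apply: hw; rewrite inE tw orbT.
Qed.

Lemma closed_refl_act S Q w s x : closed_under S Q -> word_in S w -> S s ->
  Q x -> Q (refl (act w s) x).
Proof.
move=> hQ hw Ss Qx; rewrite refl_act; apply: (closed_act hQ) => //.
by apply: (hQ) => //; apply: (closed_act hQ) => // t; rewrite mem_rev; apply: hw.
Qed.

(* A root [psi] separates two consecutive points of the orbit of [T]; these
   differ by at most [2 h] times a conjugate of [r], which is then [psi]. *)
Lemma root_conjugate Psi S T r : root_system Psi -> (forall s, S s -> Psi s) ->
  S r -> 0 < dot T r ->
  (forall s, Psi s -> dot T s = 0 \/ dot T r <= `|dot T s|) ->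
  (forall s, S s -> s = r \/ dot T s = 0) ->
  (forall s, Psi s -> dot T s = 0 -> S s) ->
  (forall s, Psi s -> exists2 w, word_in S w & dot s (act w T) <= 0) ->
  forall s, Psi s -> exists w t, [/\ word_in S w, S t & s = act w t \/ s = - act w t].
Proof.
move=> hP SP Sr h0 hmin hS stab hsg s0 Ps0.
have main w s : word_in S w -> Psi s -> 0 < dot T s -> dot s (act w T) <= 0 ->
    exists w t, [/\ word_in S w, S t & s = act w t \/ s = - act w t].
  elim: w s => [|t w IH] s hw Ps Ts /=; first by rewrite dotC; lra.
  have St : S t by apply: hw; rewrite mem_head.
  have hw' : word_in S w by move=> u uw; apply: hw; rewrite inE uw orbT.
  have Ps' : Psi (refl t s) by case: hP => _ cl; apply: cl => //; exact: SP.
  rewrite -dot_reflC => le0; have := ltrgtP (dot T (refl t s)) 0; case => Ts'.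
  - case: (hS _ St) => [tr|tT]; last first.
      by move: Ts'; rewrite dotC dot_reflC refl_perp // dotC; lra.
    (* Both heights are at least [dot T r] in absolute value and have opposite signs, while the
       reflection changes the height by [2 * dot s r * dot T r]; so [dot s r] is at least 1 and
       [s = r]. *)
    subst t; exists [::], r; split => //; left => /=.
    have u1 u : Psi u -> dot u u = 1 by case: hP => hu _; apply: hu.
    apply: unit_eq; [exact: u1|by apply/u1/SP|].
    case: (hmin _ Ps); first by move: Ts => /[swap] ->; rewrite ltxx.
    case: (hmin _ Ps'); first by move: Ts' => /[swap] ->; rewrite ltxx.
    rewrite (ltr0_norm Ts') (gtr0_norm Ts) => l1 l2.
    have r1 : dot r r = 1 by apply/u1/SP.
    move: l1; rewrite refl_unit // !dotE => l1.
    have : 0 <= dot T r * (dot s r - 1) by lra.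
    by rewrite pmulr_rge0 // subr_ge0.
  - have [u [p [hu Sp e]]] := IH _ hw' Ps' Ts' le0.
    exists (t :: u), p; split=> //=.
      by move=> q; rewrite inE => /predU1P[->|/hu].
    by case: e => /(congr1 (refl t)); rewrite reflK ?linearN /=; [left|right].
  exists [:: t], (refl t s); split=> //=; last by left; rewrite reflK.
    by move=> q; rewrite inE => /eqP ->.
  exact: stab.
have := ltrgtP (dot T s0) 0; case=> Ts.
- have [w hw le0] := hsg _ (root_opp hP Ps0).
  have Ts' : 0 < dot T (- s0) by rewrite dotNr oppr_gt0.
  have [u [t [hu St e]]] := main w (- s0) hw (root_opp hP Ps0) Ts' le0.
  exists u, t; split=> //; case: e => /(congr1 -%R); rewrite ?opprK => e; by [left|right].
- by have [w hw le0] := hsg _ Ps0; apply: (main w).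
by exists [::], s0; split=> //; [apply: stab|left].
Qed.

End Roots.

(** * Inequalities between Coxeter labels *)

Section RealInequalities.
Variable R : realFieldType.
Implicit Types x y p q : R.

Lemma gram_lt1 x1 x2 y : 1 <= x1 -> x1 <= x2 -> 0 < y ->
  x1 ^+ 2 + x2 ^+ 2 + y ^+ 2 + x1 * x2 * y < 4 -> y < 1.
Proof.
move=> h1 h2 h3; have : 1 <= x1 ^+ 2 by apply: exprn_ege1.
have : 1 <= x2 ^+ 2 by apply: exprn_ege1; lra.
have : y <= x1 * x2 * y by rewrite ler_pMl // mulr_ege1 //; lra.
by move=> *; nra.
Qed.

(** [x2 + y * x1] is minus twice the product of [r] with [refl a b]; for negative [y] this root
    would beat [b] in the minimal choice of [b]. *)
Lemma second_lt0 x1 x2 y : 1 <= x1 -> x1 <= x2 -> y < 0 -> -2 < y ->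
  x2 <= `|x2 + y * x1| -> False.
Proof.
move=> h1 h2 h3 h4; have : y * x1 < 0 by rewrite nmulr_rlt0; lra.
have : - (y * x1) < 2 * x1 by rewrite -mulNr ltr_pM2r; lra.
by case: (ger0P (x2 + y * x1)) => *; lra.
Qed.

(** The same competition against [b], now entered by [refl a (refl b a)]. *)
Lemma second_gt0 x1 x2 y : 1 <= x1 -> x1 <= x2 -> 0 < y -> y < 1 ->
  x2 <= `|(y ^+ 2 - 1) * x1 + y * x2| -> False.
Proof.
move=> h1 h2 h3 h4; have : y * x2 < x2 by rewrite gtr_pMl; lra.
have : (1 - y ^+ 2) * x1 <= (1 - y ^+ 2) * x2 by rewrite ler_wpM2l //; nra.
have : 0 < (1 - y ^+ 2) * x1 by rewrite mulr_gt0 //; nra.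
have : 0 < (y + y ^+ 2) * x2 by rewrite mulr_gt0 //; nra.
by case: (ger0P ((y ^+ 2 - 1) * x1 + y * x2)) => *; lra.
Qed.

(** For orthogonal [a] and [b], the root [p *: a + q *: b] and its mirror image in [a] both compete
    with [b]. The smaller of the two products is governed by the difference of [|p * x1|] and
    [|q * x2|], so one of these is at least [x2]. *)
Lemma sign_pair x1 x2 p q : 1 <= x1 -> x1 <= x2 ->
  x2 <= `|p * x1 + q * x2| -> x2 <= `|q * x2 - p * x1| -> 1 <= p ^+ 2 \/ 1 <= q ^+ 2.
Proof.
move=> h1 h2 h3 h4.
have [h|h] : x2 <= `|p * x1| \/ x2 <= `|q * x2|.
  move: h3 h4; case: (ger0P (p * x1)); case: (ger0P (q * x2));
  case: (ger0P (p * x1 + q * x2)); case: (ger0P (q * x2 - p * x1)) => *; lra.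
- left; have : x1 <= `|p| * x1 by rewrite -{2}(@ger0_norm _ x1) -?normrM; lra.
  rewrite ler_pMl; last by lra.
  by move=> p1; rewrite -real_normK ?num_real // exprn_ege1.
- right; have : x2 <= `|q| * x2 by rewrite -{2}(@ger0_norm _ x2) -?normrM; lra.
  rewrite ler_pMl; last by lra.
  by move=> p1; rewrite -real_normK ?num_real // exprn_ege1.
Qed.

(** A label is 2 cos (pi/m): the listed values belong to m = 2, 3, 4, 5, and the last alternative
    covers everything from m = 6 on. *)
Definition labels x :=
  [\/ x = 0, x = 1, x ^+ 2 = 2 | x ^+ 2 = x + 1] \/ 3 <= x ^+ 2.

Lemma labels_ge1 x : labels x -> 0 <= x -> x = 0 \/ 1 <= x.
Proof. by move=> [[]|] *; [left|right|right|right|right]; nra. Qed.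

(** [x1 ^+ 2 + x2 ^+ 2 < 4] is the positivity of the Gram determinant of three roots two of which
    are orthogonal; it leaves room for at most one label above 1. *)
Lemma labels_K2 x1 x2 : labels x1 -> labels x2 -> 1 <= x1 -> x1 <= x2 ->
  x1 ^+ 2 + x2 ^+ 2 < 4 -> x1 = 1 /\ [\/ x2 = 1, x2 ^+ 2 = 2 | x2 ^+ 2 = x2 + 1].
Proof.
move=> d1 d2 h1 h12 h; have h2 : 1 <= x2 ^+ 2 by apply: exprn_ege1; lra.
have h3 : x1 ^+ 2 <= x2 ^+ 2 by rewrite ler_pXn2r ?nnegrE //; lra.
split; first by case: d1 => [[]|] ?; nra.
case: d2 => [[]|] ?; [lra|by constructor 1|by constructor 2|by constructor 3|].
have : 1 <= x1 ^+ 2 by apply: exprn_ege1.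
lra.
Qed.

Lemma labels_K3 x y : labels x -> labels y -> 1 <= x -> 1 <= y -> x ^+ 2 + y ^+ 2 < 4 ->
  (x = 1 /\ [\/ y = 1, y ^+ 2 = 2 | y ^+ 2 = y + 1]) \/
  (y = 1 /\ (x ^+ 2 = 2 \/ x ^+ 2 = x + 1)).
Proof.
move=> dx dy x1 y1 h.
have hx : 1 <= x ^+ 2 by apply: exprn_ege1.
have hy : 1 <= y ^+ 2 by apply: exprn_ege1.
case: dx => [[]|] ex; case: dy => [[]|] ey; try lra;
  try (by left; split=> //; by [constructor 1|constructor 2|constructor 3]);
  by right; split=> //; by [left|right].
Qed.

End RealInequalities.

(** * The chamber at a vertex of a set with enough mirrors *)

Section Classify.
Variable R : realType.
Local Notation E3 := 'rV[R]_3.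
Variables (V : {fset E3}) (v : E3).
Implicit Types (r s t : E3) (Q : E3 -> Prop).

Definition preserved_by r := forall x, x \in V -> refl r x \in V.

Definition unit_root r := dot r r = 1 /\ preserved_by r.

(** What the polyhedron contributes once its centre is the origin: the vertices span space, they are
    linked by pairs [u], [w] whose perpendicular bisector is a mirror, and two mirrors pass through
    [v]. Connectedness is stated as an induction principle. *)
Record reflection_configuration : Prop := ReflectionConfiguration {
  rc_in : v \in V;
  rc_span : forall a, (forall x, x \in V -> dot a x = 0) -> a = 0;
  rc_connected : forall Q, Q v ->
    (forall u w, u \in V -> w \in V -> Q u -> preserved_by (u - w) ->
                 dot u u = dot w w -> Q w) ->
    forall u, u \in V -> Q u;
  rc_mirrors : exists n1 n2, [/\ dot v n1 = 0, dot v n2 = 0, cross n1 n2 != 0,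
                                 preserved_by n1 & preserved_by n2] }.

Hypothesis hV : reflection_configuration.

Let vV : v \in V := rc_in hV.

Lemma unit_root_system : root_system unit_root.
Proof.
split=> [r []//|r s [r1 hr] [s1 hs]]; split; first by rewrite dot_refl.
by move=> x xV; rewrite refl_conj; apply/hr/hs/hr.
Qed.

Lemma normalize s : s != 0 -> preserved_by s ->
  exists2 k, 0 < k & unit_root (k *: s).
Proof.
move=> /dot_gt0 s0 hs; exists (Num.sqrt (dot s s))^-1.
  by rewrite invr_gt0 sqrtr_gt0.
have q0 : Num.sqrt (dot s s) != 0 by rewrite gt_eqF // sqrtr_gt0.
split; last by move=> x xV; rewrite reflZ ?invr_eq0 //; apply: hs.
rewrite !dotE -{3}(@sqr_sqrtr _ (dot s s)) ?dot_ge0 //.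
by field.
Qed.

(** [V] spans space, so some point of it is moved by the reflection, and its displacement gives the
    direction of the root. *)
Lemma unit_root_inj s t : unit_root s -> unit_root t ->
  (forall x, x \in V -> refl s x = refl t x) -> t = s \/ t = - s.
Proof.
move=> [s1 _] [t1 _] hst.
have [x [xV xs]] : exists x, x \in V /\ dot x s <> 0.
  apply: contrapT => /forallNP hn.
  have s0 : s = 0.
    apply: (rc_span hV) => x xV; rewrite dotC.
    by have /not_andP[//|/contrapT] := hn x.
  by move: s1; rewrite s0 dot0l => /eqP; rewrite eq_sym oner_eq0.
have := hst x xV; rewrite !refl_unit // => /addrI/oppr_inj e.
have {}e : (2 * dot x s) *: s = (2 * dot x t) *: t := e.
have xs2 : dot x s != 0 by apply/eqP.
pose k := dot x t / dot x s.
have sk : s = k *: t.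
  have := congr1 (fun z => (2 * dot x s)^-1 *: z) e.
  rewrite !scalerA mulVf ?scale1r ?mulf_neq0 ?pnatr_eq0 // => ->.
  by congr (_ *: _); rewrite /k; field.
have : k ^+ 2 = 1 by rewrite -[RHS]s1 sk !dotE t1 mulr1 expr2.
move/eqP; rewrite sqrf_eq1 => /orP[]/eqP k1; move: sk; rewrite k1 ?scale1r ?scaleN1r.
  by left.
by move=> ->; right; rewrite opprK.
Qed.

Lemma root_argmin (P : E3 -> Prop) (h : E3 -> R) : (forall s, h (- s) = h s) ->
  (exists s, unit_root s /\ P s) ->
  exists s, [/\ unit_root s, P s & forall t, unit_root t -> P t -> h s <= h t].
Proof.
move=> hN [s0 [us0 Ps0]].
pose induced (g : {ffun V -> V}) s :=
  [/\ unit_root s, P s & forall x : V, val (g x) = refl s (val x)].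
pose good g := `[< exists s, induced g s >].
pose rep g := if pselect (exists s, induced g s) is left w then projT1 (cid w) else 0.
have repP g : good g -> induced g (rep g).
  by move=> /asboolP w; rewrite /rep; case: pselect => // w'; case: cid.
have indP s : unit_root s -> P s -> exists g, induced g s.
  move=> us Ps; case: (us) => _ hs.
  by exists [ffun x => [` hs _ (valP x)]%fset]; split=> // x; rewrite ffunE.
have goodP g s : induced g s -> good g by move=> w; apply/asboolP; exists s.
have [g0 ig0] := indP _ us0 Ps0.
case: (@arg_minP _ _ _ g0 good (h \o rep)) => [|g gg gmin]; first exact: goodP ig0.
have [ur Pr hr] := repP _ gg; exists (rep g); split=> // t ut Pt.
have [g' ig'] := indP _ ut Pt.
apply: le_trans (gmin g' (goodP _ _ ig')) _ => /=.
have [ur' _ hr'] := repP _ (goodP _ _ ig').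
have [|<-//|->] := unit_root_inj ut ur'; last by rewrite hN.
by move=> x xV; have [_ _ ht] := ig'; rewrite -(ht [` xV]%fset) (hr' [` xV]%fset).
Qed.

(** If [v] were the origin, [rc_connected] would give every vertex norm zero, and the vertices would
    not span. *)
Lemma center_neq0 : v != 0.
Proof.
have [n1 [n2 [_ _ n12 _ _]]] := rc_mirrors hV.
apply: contra_neq n12 => v0; apply: (rc_span hV) => x xV.
suff -> : x = 0 by rewrite dot0r.
move: x xV; apply: (rc_connected hV) => // u w _ _ -> _.
by rewrite dot0l => /esym/dot_eq0.
Qed.

Let v0 := center_neq0.

Definition axial_root s := unit_root s /\ dot v s = 0.

Lemma axial_root_system : root_system axial_root.
Proof.
split=> [r [[]]//|r s [ur vr] [us vs]]; split.
  by case: unit_root_system => _; apply.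
by rewrite -dot_reflC refl_perp.
Qed.

Lemma axial_roots : exists s t,
  [/\ axial_root s, axial_root t, t <> s & t <> - s].
Proof.
have [n1 [n2 [vn1 vn2 n12 h1 h2]]] := rc_mirrors hV.
have cross0l x : cross 0 x = 0 :> E3 by apply: row3P; rewrite !vec3E !mxE; ring.
have crossx0 x : cross x 0 = 0 :> E3 by apply: row3P; rewrite !vec3E !mxE; ring.
have [k1 k10 u1] : exists2 k, 0 < k & unit_root (k *: n1).
  by apply: normalize => //; apply: contraNneq n12 => ->; rewrite cross0l.
have [k2 k20 u2] : exists2 k, 0 < k & unit_root (k *: n2).
  by apply: normalize => //; apply: contraNneq n12 => ->; rewrite crossx0.
have crossZ a b : cross (a *: n1) (b *: n2) = (a * b) *: cross n1 n2.
  by apply: row3P; rewrite !mxE /=; ring.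
have crossxx x : cross x x = 0 :> E3 by apply: row3P; rewrite !vec3E !mxE; ring.
have crossxN x : cross x (- x) = 0 :> E3 by apply: row3P; rewrite !vec3E !mxE; ring.
have k12 : k1 * k2 != 0 by rewrite gt_eqF // mulr_gt0.
exists (k1 *: n1), (k2 *: n2); split; try by split=> //; rewrite dotE ?vn1 ?vn2 mulr0.
  move=> e; have /eqP := crossxx (k1 *: n1); rewrite -{2}e crossZ scaler_eq0.
  by rewrite (negPf k12) (negPf n12).
move=> e; have /eqP := crossxN (k1 *: n1); rewrite -e crossZ scaler_eq0.
by rewrite (negPf k12) (negPf n12).
Qed.

(** If every mirror contained [v], no link could leave [v]; then [V] would be reduced to [v] and
    would not span. *)
Lemma nonaxial_root : exists s, unit_root s /\ dot v s <> 0.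
Proof.
apply: contrapT => /forallNP hn.
have [n1 [n2 [vn1 vn2 n12 _ _]]] := rc_mirrors hV.
have n10 : n1 != 0.
  by apply: contraNneq n12 => ->; apply/eqP/row3P; rewrite !vec3E !mxE; ring.
case/eqP: n10; apply: (rc_span hV) => x xV.
suff -> : x = v by rewrite dotC.
move: x xV; apply: (rc_connected hV) => // _ w _ wV -> hvw vw.
apply/esym/eqP; rewrite -subr_eq0; apply/negPn/negP => vw0.
have [k k0 uk] := normalize vw0 hvw.
apply: (hn (k *: (v - w))); split=> //; rewrite dotE => /eqP.
rewrite mulf_eq0 gt_eqF //= => /eqP e.
by have := dot_gt0 vw0; rewrite !dotE (dotC w v); rewrite !dotE in e; lra.
Qed.

(** Both [v] and [x] are multiples of [cross a b], and they are orthogonal. *)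
Lemma perp3 a b x : a <> b -> a <> - b -> dot a a = 1 -> dot b b = 1 ->
  dot v a = 0 -> dot v b = 0 ->
  dot x a = 0 -> dot x b = 0 -> dot x v = 0 -> x = 0.
Proof.
move=> ab aNb a1 b1 va vb xa xb xv.
have c0 : cross a b != 0.
  apply/eqP => c; have a0 : a != 0.
    by apply: contra_eq_neq a1 => ->; rewrite dot0l eq_sym oner_eq0.
  have [k e] := cross0 a0 c; subst b.
  have /eqP : k ^+ 2 = 1 by rewrite -[RHS]b1 !dotE a1; ring.
  rewrite sqrf_eq1 => /orP[]/eqP k1; first by apply: ab; rewrite k1 scale1r.
  by apply: aNb; rewrite k1 scaleN1r opprK.
have [k e] := perp_cross c0 va vb; have [l f] := perp_cross c0 xa xb.
have k0 : k != 0 by apply: contra_neq v0 => k0; rewrite e k0 scale0r.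
have -> : x = (l / k) *: v by rewrite f e scalerA divfK.
move: xv; rewrite f e !dotE => /eqP.
rewrite !mulf_eq0 (negPf k0) (gt_eqF (dot_gt0 c0)) !orbF => /eqP ->.
by rewrite mul0r scale0r.
Qed.

(** The diagrams in which [r] is an end node: [x] labels the pair [r], [b] and [y] the pair [a],
    [b]. With x = 2 cos (pi/p) and y = 2 cos (pi/q) they belong to the Platonic solids {p,q}. *)
Definition golden_or_less (x y : R) :=
  (x = 1 /\ [\/ y = 1, y ^+ 2 = 2 | y ^+ 2 = y + 1]) \/
  (y = 1 /\ (x ^+ 2 = 2 \/ x ^+ 2 = x + 1)).

(** The vertex lies on the mirrors of [a] and [b] but not on that of [r]; the labels are minus twice
    the inner products. The last clause, an induction principle, says that the three reflections
    carry [v] to every point of [V]. *)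
Definition simple_roots a b r (x1 x2 y : R) :=
  [/\ [/\ unit_root a, unit_root b & unit_root r],
      [/\ dot v a = 0, dot v b = 0 & 0 < dot v r],
      [/\ dot a b = - (y / 2), dot r a = - (x1 / 2) & dot r b = - (x2 / 2)],
      [/\ 0 <= x1, 0 <= x2 & 0 <= y] &
      forall Q, closed_under (fun s => [\/ s = a, s = b | s = r]) Q ->
        Q v -> forall u, u \in V -> Q u].

(* The pairs (x1, x2), y are the Coxeter labels of a chamber: 0, 1, sqrt 2 and
   the golden ratio stand for the dihedral angles pi/2, pi/3, pi/4, pi/5. *)
Lemma classification : exists a b r x1 x2 y, simple_roots a b r x1 x2 y /\
  ((x1 = 0 /\ golden_or_less x2 y) \/
   (y = 0 /\ x1 = 1 /\ [\/ x2 = 1, x2 ^+ 2 = 2 | x2 ^+ 2 = x2 + 1])).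
Proof.
have hR := unit_root_system; have hB := axial_root_system.
have [r [ur vr rmin]] : exists r, [/\ unit_root r, 0 < dot v r &
    forall s, unit_root s -> dot v s = 0 \/ dot v r <= `|dot v s|].
  have [||r [ur vr rmin]] := @root_argmin (fun s => dot v s <> 0) (fun s => `|dot v s|).
  - by move=> s; rewrite dotNr normrN.
  - exact: nonaxial_root.
  have {}rmin s : unit_root s -> dot v s = 0 \/ `|dot v r| <= `|dot v s|.
    by move=> us; case: (pselect (dot v s = 0)); [left|right; apply: rmin].
  case: (ltrgtP (dot v r) 0) vr => // vr _.
    exists (- r); split; [exact: root_opp hR _|by rewrite dotNr oppr_gt0|].
    by rewrite dotNr -(ltr0_norm vr).
  by exists r; rewrite -{2}(gtr0_norm vr).
have [r1 _] := ur.
have Bdisc s x : axial_root s -> dot r s = - (x / 2) -> 0 <= x ->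
    [\/ x = 0, x = 1, x ^+ 2 = 2 | x ^+ 2 = x + 1] \/ 3 <= x ^+ 2.
  move=> [us vs] rs x0.
  by apply: (@height_discrete _ unit_root v s r (dot v r)) => //; rewrite dotC.
have signed (P : E3 -> Prop) : (forall s, P s -> P (- s)) -> (exists s, axial_root s /\ P s) ->
    exists s, [/\ axial_root s, P s, dot r s <= 0 &
      forall t, axial_root t -> P t -> `|dot r s| <= `|dot r t|].
  move=> PN [s0 [[us0 vs0] Ps0]].
  have [|| s [us [vs Ps] smin]] :=
      @root_argmin (fun s => dot v s = 0 /\ P s) (fun s => `|dot r s|).
  - by move=> s; rewrite dotNr normrN.
  - by exists s0.
  case: (lerP (dot r s) 0) => rs.
    by exists s; split=> // t [ut vt] Pt; apply: smin.
  exists (- s); split; [|exact: PN|by rewrite dotNr; lra|].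
    by apply: (root_opp hB).
  by move=> t [ut vt] Pt; rewrite dotNr normrN; apply: smin.
have [s0 [t0 [Bs0 Bt0 ts tNs]]] := axial_roots.
have [//||a [Ba _ ra amin]] := signed (fun _ => True); first by exists s0.
have [|| b [Bb [ba bNa] rb bmin]] := signed (fun s => s <> a /\ s <> - a).
- by move=> s [sa sNa]; split=> e; [apply: sNa|apply: sa]; rewrite -?e ?opprK //;
    apply/oppr_inj; rewrite e.
- case: (pselect (s0 = a \/ s0 = - a)) => [hs|/not_orP[? ?]]; last by exists s0.
  exists t0; split=> //; case: hs => e; subst s0; first by [].
  by rewrite opprK in tNs.
have {}bmin s : axial_root s -> s = a \/ s = - a \/ `|dot r b| <= `|dot r s|.
  move=> Bs; case: (pselect (s = a)); first by left.
  move=> sa; case: (pselect (s = - a)); first by right; left.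
  by move=> sNa; right; right; apply: bmin.
have {signed}amin s : axial_root s -> `|dot r a| <= `|dot r s|.
  by move=> Bs; apply: amin.
(* If [a] is orthogonal to [r], its sign is still free and is used to make [dot a b] nonpositive.
   Otherwise the sign of [dot a b] is settled later by minimality. *)
have {a ba bNa ra Ba amin bmin}[a [[Ba ra ab0] [ba bNa] amin bmin]] : exists a',
    [/\ [/\ axial_root a', dot r a' <= 0 & dot r a' = 0 -> dot a' b <= 0],
      b <> a' /\ b <> - a', forall s, axial_root s -> `|dot r a'| <= `|dot r s| &
      forall s, axial_root s -> s = a' \/ s = - a' \/ `|dot r b| <= `|dot r s|].
  case: (pselect (dot r a = 0 /\ 0 < dot a b)) => [[ra0 ab]|h]; last first.
    exists a; split=> //; split=> // ra0; rewrite leNgt; apply/negP => ab.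
    exact: h.
  exists (- a); rewrite opprK; split.
  - by split; [exact: root_opp hB _|rewrite dotNr ra0 oppr0|rewrite dotNl oppr_le0 ltW].
  - by split.
  - by move=> s /amin; rewrite dotNr normrN.
  by move=> s /bmin[|[|]] h; [right; left|left|right; right].
have u1 s : axial_root s -> dot s s = 1 by case: hB => h _; apply: h.
have [a1 b1] := (u1 _ Ba, u1 _ Bb).
have va : dot v a = 0 by case: Ba.
have vb : dot v b = 0 by case: Bb.
have [x1 [rax x10]] : exists x, dot r a = - (x / 2) /\ 0 <= x.
  by exists (- 2 * dot r a); split; lra.
have [x2 [rbx x20]] : exists x, dot r b = - (x / 2) /\ 0 <= x.
  by exists (- 2 * dot r b); split; lra.
have nab z : dot z a = 0 -> dot z b = 0 -> dot z v = 0 -> z = 0.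
  by apply: perp3 => // e; [apply: ba|apply: bNa; rewrite e opprK].
pose S s := axial_root s \/ s = r.
have genV Q : closed_under S Q -> Q v -> forall u, u \in V -> Q u.
  move=> hQ Qv u uV.
  have SR s : S s -> unit_root s by case=> [[]|->].
  have Sr : S r by right.
  (* Otherwise [s] is positive on the whole orbit of [v]. The sum [c] of the orbit is fixed by the
     reflections of [S], so it is orthogonal to [a], [b] and [r] and vanishes, although its product
     with [s] is positive. *)
  have neg s : unit_root s -> exists2 w, word_in S w & dot s (act w v) <= 0.
    move=> us; apply: contrapT => hn.
    have {}hn w : word_in S w -> 0 < dot s (act w v).
      by move=> hw; rewrite ltNge; apply/negP => le0; apply: hn; exists w.
    pose O := [fset x in V | `[< exists2 w, word_in S w & x = act w v >]]%fset.
    have inO x : (x \in O) = (x \in V) && `[< exists2 w, word_in S w & x = act w v >].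
      by rewrite !inE.
    pose c := \sum_(x <- O) x.
    have stable t x : S t -> x \in O -> refl t x \in O.
      move=> St; rewrite !inO => /andP[xV /asboolP[w hw e]]; apply/andP; split.
        by have [_] := SR _ St; apply.
      apply/asboolP; exists (t :: w); last by rewrite e.
      by move=> q; rewrite inE => /predU1P[->//|/hw].
    have ct t : S t -> dot c t = 0.
      move=> St; have : refl t c = c.
        rewrite /c linear_sum /= -(big_map (refl t) predT id).
        apply: perm_big; apply: uniq_perm; rewrite ?fset_uniq //.
          by rewrite map_inj_uniq ?fset_uniq //; apply: inv_inj (@reflK _ t).
        move=> x; apply/mapP/idP => [[y yO ->]|xO]; first exact: stable.
        by exists (refl t x); rewrite ?reflK //; apply: stable.
      have [t1 _] := SR _ St; rewrite refl_unit // => /eqP.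
      rewrite -subr_eq0 addrAC subrr add0r oppr_eq0 scaler_eq0 mulf_eq0 pnatr_eq0 /=.
      case/orP => [/eqP//|/eqP e]; first by rewrite e dot0r.
    have : 0 < dot c s.
      rewrite /c dot_suml; have vO : v \in O.
        by rewrite inO vV; apply/asboolP; exists [::].
      rewrite (big_fsetD1 v vO) /= ltr_pwDl //.
        by rewrite dotC; apply: (hn [::]).
      rewrite big_seq; apply: sumr_ge0 => x.
      by rewrite in_fsetD1 inO dotC => /and3P[_ _ /asboolP[w /hn /ltW ? ->]].
    suff -> : c = 0 by rewrite dot0l ltxx.
    have [[ca cb] cr] := (ct a (or_introl Ba), ct b (or_introl Bb), ct r Sr).
    pose k := dot c v / dot v v.
    have e : c - k *: v = 0.
      apply: nab; rewrite !dotE ?ca ?cb ?va ?vb ?mulr0 ?oppr0 ?addr0 //.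
      by rewrite /k; field; rewrite gt_eqF // dot_gt0.
    move/eqP: e; rewrite subr_eq0 => /eqP e; move: cr; rewrite e dotE.
    by move/eqP; rewrite mulf_eq0 (gt_eqF vr) orbF => /eqP ->; rewrite scale0r.
  move: u uV; apply: (rc_connected hV) => // u w uV wV Qu hs uw.
  have [<-//|] := eqVneq u w; rewrite -subr_eq0 => uw0.
  have [k k0 uk] := normalize uw0 hs.
  have [|| p [t [hp St e]]] := root_conjugate hR SR Sr vr rmin _ _ neg uk.
  - by move=> s [[_ ?]|->]; [right|left].
  - by move=> s us vs; left.
  suff : Q (refl (k *: (u - w)) u) by rewrite reflZ ?gt_eqF // refl_swap.
  by case: e => ->; rewrite ?reflN; apply: (closed_refl_act hQ).
have spanF t : (forall u, u \in V -> dot u t = 0) -> t = 0.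
  by move=> h; apply: (rc_span hV) => x xV; rewrite dotC h.
have a0 : a <> 0 by move=> e; move: a1; rewrite e dot0l => /eqP; rewrite eq_sym oner_eq0.
have gram y : dot a b = - (y / 2) ->
    -2 < y < 2 /\ x1 ^+ 2 + x2 ^+ 2 + y ^+ 2 + x1 * x2 * y < 4.
  move=> aby.
  have y2 : -2 < y < 2.
    rewrite !ltNge -negb_or; apply/negP => /orP[y2|y2].
      by apply: ba; apply: unit_eq => //; rewrite dotC; lra.
    by apply: bNa; apply: unit_eq; rewrite ?dotNl ?dotNr ?opprK ?a1 ?b1 // dotC; lra.
  (* Up to the factor [4 - y ^+ 2], [z] is the component of [r] orthogonal to [a] and [b]; that its
     norm is positive is the positivity of the Gram determinant. *)
  split=> //; pose z := (4 - y ^+ 2) *: r + (2 * x1 + x2 * y) *: a + (2 * x2 + x1 * y) *: b.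
  have d0 : 0 < 4 - y ^+ 2 by nra.
  have z0 : z != 0.
    apply/eqP => /(congr1 (dot v)); rewrite /z !dotE va vb => /eqP.
    by rewrite !mulr0 !addr0 mulf_eq0 !gt_eqF.
  have := dot_gt0 z0.
  have -> : dot z z = (4 - y ^+ 2) *
      (4 - (x1 ^+ 2 + x2 ^+ 2 + y ^+ 2 + x1 * x2 * y)).
    by rewrite /z !dotE a1 b1 r1 (dotC a r) (dotC b r) (dotC b a) aby rax rbx; field.
  by rewrite pmulr_rgt0 // subr_gt0.
have x12 : x1 <= x2.
  have := amin _ Bb; rewrite rax rbx !normrN !ger0_norm; clear -hV x10 x20; lra.
have bmin' s : axial_root s -> s = a \/ s = - a \/ x2 / 2 <= `|dot r s|.
  by move=> Bs; move: (bmin _ Bs); rewrite rbx normrN ger0_norm // divr_ge0 ?ler0n.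
have d1 := Bdisc _ _ Ba rax x10; have d2 := Bdisc _ _ Bb rbx x20.
have uniq_root s : axial_root s -> forall p q, dot s a = p -> dot s b = q ->
    dot a b = 0 -> s = p *: a + q *: b /\ p ^+ 2 + q ^+ 2 = 1.
  move=> Bs p q sa sb ab; have vs : dot v s = 0 by case: Bs.
  have e : s = p *: a + q *: b.
    apply/eqP; rewrite -subr_eq0; apply/eqP/nab; rewrite !dotE ?(dotC b a) ?sa ?sb ?ab ?a1 ?b1;
      rewrite ?(dotC s v) ?(dotC a v) ?(dotC b v) ?vs ?va ?vb; ring.
  split=> //; rewrite -(u1 _ Bs) e !dotE (dotC b a) ab a1 b1; ring.
have only s p q : s = p *: a + q *: b -> p ^+ 2 + q ^+ 2 = 1 -> 1 <= q ^+ 2 ->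
    s = b \/ s = - b.
  move=> -> pq q1; have p0 : p = 0.
    by apply/eqP; rewrite -sqrf_eq0 eq_le sqr_ge0 andbT; clear -hV pq q1; lra.
  move: pq; rewrite p0 expr0n add0r => /eqP; rewrite sqrf_eq1 scale0r add0r.
  by case/orP => /eqP ->; rewrite ?scale1r ?scaleN1r; [left|right].
have finish Q : closed_under (fun s => [\/ s = a, s = b | s = r]) Q ->
    (forall s, axial_root s -> s = a \/ s = - a \/ s = b \/ s = - b) ->
    Q v -> forall u, u \in V -> Q u.
  move=> hQ Bab; apply: genV => s x [/Bab[|[|[|]]]|] -> Qx; rewrite ?reflN; apply: (hQ) => //;
  by [constructor 1|constructor 2|constructor 3].
(* If [x1] is not zero, [r] is the middle node: minimality of [b] forces [a] and [b] to be
   orthogonal, and up to sign they are the only axial roots. *)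
have [x1s|x1ge] := labels_ge1 d1 x10; last first.
  have [y aby] : exists y, dot a b = - (y / 2) by exists (- 2 * dot a b); clear -hV; lra.
  have [/andP[y2 _] G] := gram _ aby.
  have Bba : axial_root (refl a b) by case: hB => _ h; apply: h.
  have yN0 : y <> 0 -> refl a b <> a /\ refl a b <> - a.
    move=> y0; split=> /(congr1 (refl a)); rewrite reflK ?linearN /= refl_id ?opprK => e;
      by [apply: bNa|apply: ba].
  have rba : dot r (refl a b) = - ((x2 + y * x1) / 2).
    by rewrite refl_unit // !dotE (dotC b a) aby rax rbx; clear -hV; lra.
  have half z : `|- (z / 2)| = `|z| / 2 :> R.
    by rewrite normrN normrM (@ger0_norm _ (2^-1)) ?invr_ge0 ?ler0n.
  have y0 : 0 <= y.
    rewrite leNgt; apply/negP => ylt.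
    have [|n1 n2] := yN0; first by clear -hV ylt; lra.
    case: (bmin' _ Bba) => [//|[//|]]; rewrite rba half => h.
    by apply: (second_lt0 x1ge x12 ylt y2); clear -hV h; lra.
  have {y0} y0 : y = 0.
    apply/eqP; rewrite eq_le y0 andbT leNgt; apply/negP => ylt.
    have y1 := gram_lt1 x1ge x12 ylt G.
    have Bab : axial_root (refl b a) by case: hB => _ h; apply: h.
    have Bc : axial_root (refl a (refl b a)) by case: hB => _ h; apply: h.
    have rc : dot r (refl a (refl b a)) = - (((y ^+ 2 - 1) * x1 + y * x2) / 2).
      by rewrite (refl_unit (refl b a) a1) refl_unit // !dotE (dotC b a) a1 aby rax rbx; field.
    have ac : dot a (refl a (refl b a)) = y ^+ 2 / 2 - 1.
      by rewrite -dot_reflC refl_id refl_unit // !dotE a1 aby; field.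
    have ysq : 0 < y ^+ 2 < 1 by rewrite exprn_gt0 //= expr_lt1 ?ltW.
    case: (bmin' _ Bc) => [e|[e|]].
    - by move: ac; rewrite e a1; clear -hV ysq; lra.
    - by move: ac; rewrite e dotE a1; clear -hV ysq; lra.
    by rewrite rc half => h; apply: (second_gt0 x1ge x12 ylt y1); clear -hV h; lra.
  subst y; rewrite mul0r oppr0 in aby.
  have Bonly s : axial_root s -> s = a \/ s = - a \/ s = b \/ s = - b.
    move=> Bs; have [e pq] := uniq_root s Bs _ _ erefl erefl aby.
    set p := dot s a in e pq; set q := dot s b in e pq.
    case: (pselect (s = a)) => [|sa]; first by left.
    case: (pselect (s = - a)) => [|sNa]; first by right; left.
    have Bs' : axial_root (refl a s) by case: hB => _ h; apply: h.
    have h1 : x2 / 2 <= `|dot r s| by case: (bmin' _ Bs) => [//|[]].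
    have h2 : x2 / 2 <= `|dot r (refl a s)|.
      case: (bmin' _ Bs') => [e'|[e'|//]]; have := congr1 (refl a) e';
      by rewrite reflK ?linearN /= refl_id ?opprK.
    have e1 : dot r s = - ((p * x1 + q * x2) / 2).
      by rewrite e !dotE rax rbx; field.
    have e2 : dot r (refl a s) = - ((q * x2 - p * x1) / 2).
      by rewrite refl_unit // -/p !dotE e1 rax; field.
    rewrite e1 half in h1; rewrite e2 half in h2.
    have [p1|q1] : 1 <= p ^+ 2 \/ 1 <= q ^+ 2 by apply: (sign_pair x1ge x12); clear -hV h1 h2; lra.
      have q0 : q = 0 by apply/eqP; rewrite -sqrf_eq0 eq_le sqr_ge0 andbT; clear -hV pq p1; lra.
      have : p ^+ 2 = 1 by move: pq; rewrite q0; clear -hV; lra.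
      move/eqP; rewrite sqrf_eq1 => /orP[]/eqP p3; move: e; rewrite p3 q0 scale0r addr0.
        by rewrite scale1r.
      by rewrite scaleN1r.
    by right; right; apply: (only _ _ _ e pq).
  exists a, b, r, x1, x2, 0; split.
    split=> //; [by case: Ba => ua _; case: Bb => ub _|by rewrite mul0r oppr0|].
    by move=> Q hQ; apply: finish.
  by right; split=> //; apply: labels_K2 => //; clear -hV G; lra.
subst x1; rewrite mul0r oppr0 in rax.
have [x2s|x2ge] := labels_ge1 d2 x20.
  (* [r] is parallel to [v], and all vertices are [v] or [- v] *)
  subst x2; rewrite mul0r oppr0 in rbx.
  case: a0; apply: spanF.
  suff h u : u \in V -> u = v \/ u = - v.
    by move=> u /h[]->; rewrite ?dotNl va ?oppr0.
  apply: (genV (fun u => u = v \/ u = - v)); last by left.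
  have rv : refl r v = - v.
    pose k := dot r v / dot v v.
    have e : r = k *: v.
      apply/eqP; rewrite -subr_eq0; apply/eqP/nab; rewrite !dotE ?rax ?rbx ?va ?vb; try ring.
      by rewrite /k; field; rewrite gt_eqF // dot_gt0.
    have k0 : k != 0 by apply: contra_eq_neq r1 => k0; rewrite e k0 scale0r dot0l eq_sym oner_eq0.
    by rewrite e reflZ // refl_id.
  move=> s x [[_ vs]|->] [] ->; rewrite ?linearN /= ?rv ?opprK; try by [left|right].
    by left; rewrite refl_perp.
  by right; rewrite refl_perp.
have [y [aby y0]] : exists y, dot a b = - (y / 2) /\ 0 <= y.
  by exists (- 2 * dot a b); have h := ab0 rax; split; clear -hV h; lra.
have dy : labels y.
  (* Among the axial roots, [- r] plays the part of the vertex, [a] that of a mirror through it and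
     [b] that of the nearest other mirror. *)
  apply: (@height_discrete _ axial_root (- r) a b (x2 / 2)) => //.
  - by rewrite dotNl rax oppr0.
  - by rewrite dotNl rbx opprK.
  - by clear -hV x2ge; lra.
  move=> s Bs; rewrite dotNl; case: (bmin' _ Bs) => [->|[->|h]].
  - by left; rewrite rax oppr0.
  - by left; rewrite dotNr rax !oppr0.
  by right; rewrite normrN.
have [/andP[_ y2] G] := gram _ aby.
have [y0'|y1] := labels_ge1 dy y0.
  (* all vertices lie in the mirror of [a] *)
  subst y; rewrite mul0r oppr0 in aby.
  case: a0; apply: spanF.
  have Bonly s : axial_root s -> s = a \/ s = - a \/ s = b \/ s = - b.
    move=> Bs; have [e pq] := uniq_root s Bs _ _ erefl erefl aby.
    set p := dot s a in e pq; set q := dot s b in e pq.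
    case: (bmin' _ Bs) => [|[|h]]; [by left|by right; left|right; right].
    apply: (only _ _ _ e pq); rewrite -real_normK ?num_real // exprn_ege1 //.
    move: h; rewrite e !dotE rax rbx mulr0 add0r mulrN normrN normrM.
    by rewrite (@ger0_norm _ (x2 / 2)) ?ler_pMl //; clear -hV x2ge; lra.
  apply: finish => // s x [->|->|->]; rewrite dot_reflC ?refl_id ?dotNr.
  - by move=> ->; rewrite oppr0.
  - by rewrite refl_perp.
  - by rewrite refl_perp // dotC.
have cases := labels_K3 d2 dy x2ge y1 _.
have {}cases := cases ltac:(clear -hV G; lra).
exists a, b, r, 0, x2, y; split; last by left.
split=> //; [by case: Ba => ua _; case: Bb => ub _|by rewrite mul0r oppr0|].
move=> Q hQ Qv; apply: genV => // s x [Bs|->] Qx; last by apply: (hQ) => //; constructor 3.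
pose S' s := [\/ s = a, s = - a | s = b].
have hQ' : closed_under S' Q.
  by move=> t z [->|->|->]; rewrite ?reflN; apply: (hQ); [constructor 1|constructor 1|constructor 2].
have S'B t : S' t -> axial_root t.
  by case=> ->//; apply: (root_opp hB).
have rN : dot (- r) b = x2 / 2 by rewrite dotNl rbx opprK.
(* A second use of [root_conjugate], now among the axial roots, reduces every axial reflection to
   those in [a] and [b]. *)
have [||||||w [t [hw St e]]] := @root_conjugate _ axial_root S' (- r) b hB S'B _ _ _ _ _ _ s Bs.
- by constructor 3.
- by rewrite rN; clear -hV x2ge; lra.
- move=> t Bt; rewrite rN dotNl; case: (bmin' _ Bt) => [->|[->|h]].
  + by left; rewrite rax oppr0.
  + by left; rewrite dotNr rax !oppr0.
  by right; rewrite normrN.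
- by move=> t [->|->|->]; [right|right|by left]; rewrite ?dotNr dotNl rax ?oppr0.
- move=> t Bt; rewrite dotNl; case: (bmin' _ Bt) => [->|[->|h]]; [by constructor 1|by constructor 2|].
  by move=> /eqP; rewrite oppr_eq0 => /eqP rt; move: h; rewrite rt normr0; clear -hV x2ge; lra.
(* The projection of [- r] to the plane of [a] and [b] lies on the mirror of [a]. Its images under
   1, b, ab, bab, abab include the vertices of a regular triangle, square or pentagon centred at 0,
   so [t] cannot be positive on all of them. *)
- move=> t Bt; apply: contrapT => hn.
  have {}hn w0 : word_in S' w0 -> 0 < dot t (act w0 (- r)).
    by move=> hw; rewrite ltNge; apply/negP => le0; apply: hn; exists w0.
  have Sa : S' a by constructor 1.
  have Sb : S' b by constructor 3.
  have inS w0 : all (fun z => (z == a) || (z == b)) w0 -> word_in S' w0.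
    by move=> /allP h z /h /orP[]/eqP ->.
  set p := dot t a; set q := dot t b.
  (* [z] is orthogonal to [a] and [b], hence a multiple of [v], hence orthogonal to [t]; this
     expresses [dot t (- r)] by [p] and [q]. *)
  have tr : (4 - y ^+ 2) * dot t (- r) = x2 * (2 * q + p * y).
    pose z := (4 - y ^+ 2) *: (- r) - (x2 * y) *: a - (2 * x2) *: b.
    have zt : dot z t = 0.
      pose k := dot z v / dot v v.
      have e : z - k *: v = 0.
        apply: nab; rewrite /z !dotE ?a1 ?b1 ?(dotC b a) ?aby ?rax ?rbx ?va ?vb; try by clear -hV v0; field.
        by rewrite /k /z !dotE; field; rewrite gt_eqF // dot_gt0.
      have vt : dot v t = 0 by case: Bt.
      by move/eqP: e; rewrite subr_eq0 => /eqP ->; rewrite dotE vt mulr0.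
    move: zt; rewrite /z !dotE (dotC r t) (dotC a t) (dotC b t) -/p -/q; clear -hV; lra.
  have p1 : dot t (- r) > 0 by apply: (hn [::]).
  have lin m c u w0 : refl m (u - c *: w0) = refl m u - c *: refl m w0.
    by rewrite linearB linearZ.
  have lin3 m u d w0 : refl m (u + d *: w0) = refl m u + d *: refl m w0.
    by rewrite linearD linearZ.
  have lin2 m c u d w0 : refl m (c *: u + d *: w0) = c *: refl m u + d *: refl m w0.
    by rewrite linearD !linearZ.
  have e2 : refl b (- r) = - r - x2 *: b.
    by rewrite refl_unit // dotNl rbx; congr (_ - _ *: _); field.
  have p2 : 0 < dot t (refl b (- r)) by apply: (hn [:: b]); apply: inS; rewrite /= eqxx orbT.
  have e3 : refl a (refl b (- r)) = - r - x2 *: (b + y *: a).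
    rewrite e2 linearB linearZ /= [refl a b]refl_unit // (dotC b a) aby refl_perp; last by rewrite dotNl rax oppr0.
    by apply: row3P; clear -hV v0; rewrite !mxE; field.
  have p3 : 0 < dot t (refl a (refl b (- r))).
    by apply: (hn [:: a; b]); apply: inS; rewrite /= !eqxx orbT.
  have rb' : refl b a = a + y *: b.
    by rewrite refl_unit // aby; apply: row3P; clear -hV v0; rewrite !mxE; field.
  have e4 : refl b (refl a (refl b (- r))) = - r - x2 *: (y *: a + y ^+ 2 *: b).
    rewrite e3 lin lin3 refl_id rb' e2.
    by apply: row3P; clear -hV v0; rewrite !mxE; ring.
  have p4 : 0 < dot t (refl b (refl a (refl b (- r)))).
    by apply: (hn [:: b; a; b]); apply: inS; rewrite /= !eqxx !orbT.
  have ra' : refl a b = b + y *: a.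
    by rewrite refl_unit // (dotC b) aby; apply: row3P; clear -hV v0; rewrite !mxE; field.
  have e5 : refl a (refl b (refl a (refl b (- r)))) = - r - x2 *: ((y ^+ 3 - y) *: a + y ^+ 2 *: b).
    rewrite e4 lin lin2 refl_id ra' (@refl_perp _ a (- r)).
      by apply: row3P; clear -hV v0; rewrite !mxE; ring.
    by rewrite dotNl rax oppr0.
  have p5 : 0 < dot t (refl a (refl b (refl a (refl b (- r))))).
    by apply: (hn [:: a; b; a; b]); apply: inS; rewrite /= !eqxx !orbT.
  move: p1 p2 p3 p4 p5; rewrite e5 e4 e3 e2 ![dot t (_ - _)]dotDr ![dot t (- (_ *: _))]dotNr ![dot t (_ *: _)]dotZr
    ![dot t (_ + _)]dotDr ![dot t (_ *: _)]dotZr -/p -/q.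
  move: tr; set m := dot t (- r) => tr p1 p2 p3 p4 p5.
  have [ey|[ey|ey]] : y = 1 \/ y ^+ 2 = 2 \/ y ^+ 2 = y + 1.
    by case: cases => [[_ []]|[]]; [left|right; left|right; right|left].
  - by subst y; clear -hV tr p1 p2 p3 p4 p5; lra.
  - by move: tr; rewrite ey; clear -hV p1 p2 p3 p4 p5 ey; lra.
  have ey3 : y ^+ 3 = 2 * y + 1 by rewrite exprS ey mulrDr -expr2 ey; ring.
  have : (4 - y ^+ 2) * (m + (m - x2 * q) + (m - x2 * (q + y * p)) + (m - x2 * (y * p + y ^+ 2 * q))
      + (m - x2 * ((y ^+ 3 - y) * p + y ^+ 2 * q))) = 0.
    transitivity (5 * ((4 - y ^+ 2) * m) - (4 - y ^+ 2) * x2 * ((y ^+ 3 + y) * p + (2 * y ^+ 2 + 2) * q)); first by ring.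
    by rewrite tr ey3 ey; move: ey; rewrite expr2 => ey; ring: ey.
  have : 0 < 4 - y ^+ 2 by clear -hV y1 y2; nra.
  by move=> d0 /eqP; rewrite mulf_eq0 gt_eqF //= => /eqP; clear -hV p1 p2 p3 p4 p5; lra.
case: e => ->; rewrite ?reflN; exact: (closed_refl_act hQ').
Qed.

End Classify.

(** * Exact arithmetic in Z[phi] and the eight standard chambers *)

Definition zphi : Type := (int * int)%type.
Definition zvec : Type := (zphi * zphi * zphi)%type.

Definition padd (x y : zphi) : zphi := (x.1 + y.1, x.2 + y.2).
Definition popp (x : zphi) : zphi := (- x.1, - x.2).
(** The pair [(a, b)] stands for a + b phi, where phi^2 = phi + 1. *)
Definition pmul (x y : zphi) : zphi :=
  (x.1 * y.1 + x.2 * y.2, x.1 * y.2 + x.2 * y.1 + x.2 * y.2).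

Definition vsub (x y : zvec) : zvec :=
  (padd x.1.1 (popp y.1.1), padd x.1.2 (popp y.1.2), padd x.2 (popp y.2)).
Definition vscale (k : zphi) (x : zvec) : zvec :=
  (pmul k x.1.1, pmul k x.1.2, pmul k x.2).
Definition vdot (x y : zvec) : zphi :=
  padd (padd (pmul x.1.1 y.1.1) (pmul x.1.2 y.1.2)) (pmul x.2 y.2).
Definition vcross (x y : zvec) : zvec :=
  (padd (pmul x.1.2 y.2) (popp (pmul x.2 y.1.2)),
   padd (pmul x.2 y.1.1) (popp (pmul x.1.1 y.2)),
   padd (pmul x.1.1 y.1.2) (popp (pmul x.1.2 y.1.1))).

(** The equation [reflE], in which the division by the norm of [r] has been cleared. *)
Definition is_refl (r x y : zvec) : bool :=
  vscale (vdot r r) (vsub x y) == vscale (pmul (2, 0) (vdot x r)) r.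

(* Exact for the roots below, whose squared lengths are integers dividing the
   coefficients; [is_refl] checks each use. *)
Definition vrefl (r x : zvec) : zvec :=
  let n := (vdot r r).1 in
  let d := vscale (pmul (2, 0) (vdot x r)) r in
  let q (z : zphi) : zphi := ((z.1 %/ n)%Z, (z.2 %/ n)%Z) in
  vsub x (q d.1.1, q d.1.2, q d.2).

Definition zint (a b c : int) : zvec := ((a, 0), (b, 0), (c, 0)).

(** A vertex and three roots in the order [a], [b], [r] of [simple_roots], not normalized, so that
    the coordinates stay in Z[phi]. *)
Definition chamber : Type := (zvec * (zvec * zvec * zvec))%type.

Definition phi_ : zphi := (0, 1).
Definition phi_inv : zphi := (-1, 1).

Definition tetrahedron : chamber :=
  (zint 1 1 1, (zint 0 1 (-1), zint 1 (-1) 0, zint 0 1 1)).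
Definition octahedron : chamber :=
  (zint 1 0 0, (zint 0 0 1, zint 0 1 (-1), zint 1 (-1) 0)).
Definition cube : chamber :=
  (zint 1 1 1, (zint 1 (-1) 0, zint 0 1 (-1), zint 0 0 1)).
Definition icosahedron : chamber :=
  (((0, 0), phi_, (-1, 0)),
   (zint 2 0 0, (popp phi_, phi_inv, (1, 0)), zint 0 0 (-2))).
Definition dodecahedron : chamber :=
  (zint 1 1 1,
   (((-1, 0), phi_, popp phi_inv), (popp phi_inv, (-1, 0), phi_),
    (phi_, phi_inv, (-1, 0)))).
(** The octahedron once more, as the orbit belonging to the middle node of A3; the next two chambers
    belong to the middle nodes of B3 and H3. *)
Definition octahedron2 : chamber :=
  (zint 1 0 0, (zint 0 1 (-1), zint 0 1 1, zint 1 (-1) 0)).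
Definition cuboctahedron : chamber :=
  (zint 1 1 0, (zint 1 (-1) 0, zint 0 0 1, zint 0 1 (-1))).
Definition icosidodecahedron : chamber :=
  (zint 2 0 0, (zint 0 2 0, zint 0 0 2, (phi_inv, (-1, 0), popp phi_))).

Definition orbit_step (g : zvec * zvec * zvec) (l : seq zvec) : seq zvec :=
  undup (l ++ map (vrefl g.1.1) l ++ map (vrefl g.1.2) l ++ map (vrefl g.2) l).

(** The longest element of H3, the largest group that occurs, has length 15, so 15 rounds exhaust
    each orbit; [orbit_ok] verifies that the result is closed. *)
Definition chamber_orbit (c : chamber) : seq zvec :=
  iter 15 (orbit_step c.2) [:: c.1].

Arguments chamber_orbit : simpl never.
Arguments vrefl : simpl never.
Arguments is_refl : simpl never.

Definition orbit_ok (c : chamber) : bool :=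
  let l := chamber_orbit c in
  all (fun a => (a != zint 0 0 0) &&
     all (fun x => is_refl a x (vrefl a x) && (vrefl a x \in l)) l)
  [:: c.2.1.1; c.2.1.2; c.2.2].

Definition chambers : seq chamber :=
  [:: tetrahedron; octahedron; cube; icosahedron; dodecahedron; octahedron2;
      cuboctahedron; icosidodecahedron].

Lemma orbit_okP (c : chamber) (a : zvec) :
  orbit_ok c -> a \in [:: c.2.1.1; c.2.1.2; c.2.2] -> a != zint 0 0 0 /\
  forall x, x \in chamber_orbit c -> is_refl a x (vrefl a x) /\ vrefl a x \in chamber_orbit c.
Proof.
rewrite /orbit_ok => /allP h /h /andP[a0 /allP h']; split=> // x /h' /andP[].
by split.
Qed.

Lemma sqr_5_nat (m n : nat) : (m ^ 2 = 5 * n ^ 2)%N -> n = 0%N.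
Proof.
case: n => // n e; have /(congr1 (logn 5)) := e.
have m0 : (0 < m)%N by case: m e.
rewrite lognM // ?expn_gt0 // !lognX (@logn_prime 5 5) //= => h.
by have := congr1 odd h; rewrite oddD !oddM.
Qed.

(** Four times the norm form is [(2 * a + b) ^+ 2 - 5 * b ^+ 2]; by the parity of the exponent of 5
    in a square it vanishes only for [b = 0]. *)
Lemma norm_phi_eq0 (a b : int) : a ^+ 2 + a * b - b ^+ 2 = 0 -> a = 0 /\ b = 0.
Proof.
move=> e; have {}e : (2 * a + b) ^+ 2 = 5 * b ^+ 2 by lia.
have b0 : `|b|%N = 0%N.
  have := congr1 absz e; rewrite abszX abszM abszX; exact: sqr_5_nat.
have {}b0 : b = 0 by lia.
by subst b; split=> //; nia.
Qed.

(** * Evaluation of Z[phi] in the reals *)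

Section Evaluation.
Variable R : realType.
Local Notation E3 := 'rV[R]_3.
Local Notation phi := (golden R).

Lemma sqrt5_sqr : Num.sqrt 5 ^+ 2 = 5 :> R.
Proof. by rewrite sqr_sqrtr // ler0n. Qed.

Lemma golden_sqr : phi ^+ 2 = phi + 1.
Proof. by rewrite /golden; have := sqrt5_sqr; set q := Num.sqrt _ => h; field: h. Qed.

Lemma golden_gt : 8 / 5 < phi.
Proof.
rewrite /golden; have := sqrt5_sqr; have := sqrtr_ge0 (5 : R).
by set q := Num.sqrt _ => *; nra.
Qed.

Lemma golden_lt : phi < 13 / 8.
Proof.
rewrite /golden; have := sqrt5_sqr; have := sqrtr_ge0 (5 : R).
by set q := Num.sqrt _ => *; nra.
Qed.

Lemma golden_uniq (y : R) : 0 <= y -> y ^+ 2 = y + 1 -> y = phi.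
Proof.
move=> y0 hy; have h := golden_sqr; have g := golden_gt.
have /eqP : (y - phi) * (y + phi - 1) = 0 by lra.
by rewrite mulf_eq0 => /orP[]/eqP; lra.
Qed.

Definition ev (x : zphi) : R := x.1%:~R + x.2%:~R * phi.

Lemma ev_add x y : ev (padd x y) = ev x + ev y.
Proof. by rewrite /ev /= !intrD; ring. Qed.

Lemma ev_opp x : ev (popp x) = - ev x.
Proof. by rewrite /ev /= !intrN; ring. Qed.

Lemma ev_mul x y : ev (pmul x y) = ev x * ev y.
Proof.
rewrite /ev /= !intrD !intrM; have h := golden_sqr; rewrite expr2 in h; ring: h.
Qed.

(** Multiplication by the conjugate a + b - b phi turns the value into the integral norm. *)
Lemma ev_eq0 x : ev x = 0 -> x = (0, 0).
Proof.
case: x => a b; rewrite /ev /= => e.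
have : (a ^+ 2 + a * b - b ^+ 2)%:~R = 0 :> R.
  transitivity ((a%:~R + b%:~R * phi) * (a%:~R + b%:~R - b%:~R * phi)); last by rewrite e mul0r.
  by rewrite !expr2 !intrD !intrN !intrM; have h := golden_sqr; rewrite expr2 in h; ring: h.
by move/eqP; rewrite intr_eq0 => /eqP/norm_phi_eq0[-> ->].
Qed.

Lemma ev_inj : injective ev.
Proof.
move=> x y e; have : ev (padd x (popp y)) = 0 by rewrite ev_add ev_opp e subrr.
by case: x y {e} => a b [c d] /ev_eq0[] h1 h2; congr pair; lia.
Qed.

Definition evv (x : zvec) : E3 := vec3 (ev x.1.1) (ev x.1.2) (ev x.2).

Lemma evv_inj : injective evv.
Proof.
move=> [[a b] c] [[a' b'] c'] e.
have h j := congr1 (fun z : E3 => z 0 j) e.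
have := (h 0, h 1, h 2%:R); rewrite !vec3E /= => -[[e1 e2] e3].
by rewrite (ev_inj e1) (ev_inj e2) (ev_inj e3).
Qed.

Lemma evv_sub x y : evv (vsub x y) = evv x - evv y.
Proof. by apply: row3P; rewrite !mxE /= ev_add ev_opp. Qed.

Lemma evv_scale k x : evv (vscale k x) = ev k *: evv x.
Proof. by apply: row3P; rewrite !mxE /= ev_mul. Qed.

Lemma dot_evv x y : dot (evv x) (evv y) = ev (vdot x y).
Proof. by rewrite dot3 !vec3E /vdot !ev_add !ev_mul. Qed.

Lemma cross_evv x y : cross (evv x) (evv y) = evv (vcross x y).
Proof. by apply: row3P; rewrite !vec3E /vcross /= !ev_add !ev_opp !ev_mul. Qed.

Lemma evv_eq0 x : evv x = 0 -> x = zint 0 0 0.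
Proof. by move=> e; apply: evv_inj; rewrite e; apply: row3P; rewrite !mxE /ev /= mul0r addr0. Qed.

Lemma evv_neq0 x : x != zint 0 0 0 -> evv x != 0.
Proof. by apply: contra_neq => /evv_eq0. Qed.

Lemma is_reflP r x y : r != zint 0 0 0 -> reflect (refl (evv r) (evv x) = evv y) (is_refl r x y).
Proof.
move=> r0; have e2 : ev (2, 0) = 2 by rewrite /ev /= mul0r addr0.
apply: (iffP eqP) => [/(congr1 evv)|e].
  rewrite !evv_scale evv_sub !ev_mul e2 -!dot_evv; exact: refl_uniq (evv_neq0 r0).
apply: evv_inj; rewrite !evv_scale evv_sub -e !ev_mul e2 -!dot_evv.
by apply: reflE; exact: 0.
Qed.

(** * Placing a standard chamber in space *)

(** Stacked as rows, the triples satisfy [A1 *m A1^T = A0 *m A0^T], so [invmx A0 *m A1] is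
    orthogonal; it also transports the fact that the standard triple spans space. *)
Lemma gram_frame (a0 b0 c0 a b c : E3) :
  dot (cross a0 b0) c0 != 0 ->
  dot a a = dot a0 a0 -> dot b b = dot b0 b0 -> dot c c = dot c0 c0 ->
  dot a b = dot a0 b0 -> dot a c = dot a0 c0 -> dot b c = dot b0 c0 ->
  exists2 A, orthogonal_mx A & [/\ a = a0 *m A, b = b0 *m A & c = c0 *m A] /\
    forall z, dot z a = 0 -> dot z b = 0 -> dot z c = 0 -> z = 0.
Proof.
move=> d0 aa bb cc ab ac bc.
pose M (x y z : E3) : 'M[R]_3 := \matrix_i [:: x; y; z]`_i.
have MR x y z i : row i (M x y z) = [:: x; y; z]`_i by rewrite rowK.
have Mdot x y z x' y' z' i j : (M x y z *m (M x' y' z')^T) i j =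
    dot ([:: x; y; z]`_i) ([:: x'; y'; z']`_j).
  by rewrite mxE -!MR; apply: eq_bigr => l _; rewrite !mxE.
pose A0 := M a0 b0 c0; pose A1 := M a b c.
have perp0 z : dot z a0 = 0 -> dot z b0 = 0 -> dot z c0 = 0 -> z = 0.
  move=> za zb zc; have n0 : cross a0 b0 != 0.
    by apply: contra_neq d0 => ->; rewrite dot0l.
  have [k zk] := perp_cross n0 za zb; move: zc; rewrite zk dotZl => /eqP.
  by rewrite mulf_eq0 (negPf d0) orbF => /eqP ->; rewrite scale0r.
have U0 : A0 \in unitmx.
  rewrite -unitmx_tr -row_free_unit -kermx_eq0; apply/rowV0P => z /sub_kermxP e.
  have h i : dot z (row i A0) = 0.
    have := congr1 (fun m : 'rV_3 => m 0 i) e; rewrite !mxE => e'.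
    by rewrite -[RHS]e'; apply: eq_bigr => j _; rewrite !mxE.
  by apply: perp0; [have := h 0|have := h 1|have := h 2%:R]; rewrite MR.
have G : A1 *m A1^T = A0 *m A0^T.
  apply/matrixP => -[[|[|[|//]]] i] [[|[|[|//]]] j]; rewrite !Mdot //=;
  by rewrite dotC ?ab ?ac ?bc // dotC.
have hA : orthogonal_mx (invmx A0 *m A1).
  rewrite /orthogonal_mx trmx_mul mulmxA -(mulmxA (invmx A0)) G.
  by rewrite mulmxA mulVmx // mul1mx trmx_inv mulmxV // unitmx_tr.
have hrow i : row i A1 = row i A0 *m (invmx A0 *m A1).
  by rewrite -row_mul mulKVmx.
exists (invmx A0 *m A1) => //.
have [ea eb ec] : [/\ a = a0 *m (invmx A0 *m A1), b = b0 *m (invmx A0 *m A1) &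
    c = c0 *m (invmx A0 *m A1)].
  by split; [have := hrow 0|have := hrow 1|have := hrow 2%:R]; rewrite !MR.
split=> // z; rewrite ea eb ec; set A := invmx A0 *m A1.
have zA : z = (z *m A^T) *m A by rewrite -mulmxA orth_tr // mulmx1.
rewrite zA !dot_orth // => h1 h2 h3.
by rewrite (perp0 _ h1 h2 h3) mul0mx.
Qed.

Section Framed.
Variables (V : {fset E3}) (v : E3).
Hypothesis hV : reflection_configuration V v.

Definition framed (c : chamber) (k : R) (A : 'M[R]_3) : Prop :=
  [/\ 0 < k, orthogonal_mx A, v = k *: (evv c.1 *m A) &
   forall x, x \in V <-> exists2 p, p \in chamber_orbit c & x = k *: (evv p *m A)].

(** [n1], [n2], [n3] are the lengths of the standard roots, so that the stretched simple roots have
    the standard Gram matrix. Once these are aligned, [v], being orthogonal to two of them, is a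
    positive multiple of the placed standard vertex. *)
Lemma frame_chamber (c : chamber) a b r x1 x2 y n1 n2 n3 :
  simple_roots V v a b r x1 x2 y ->
  0 < n1 -> 0 < n2 -> 0 < n3 ->
  n1 ^+ 2 = ev (vdot c.2.1.1 c.2.1.1) -> n2 ^+ 2 = ev (vdot c.2.1.2 c.2.1.2) ->
  n3 ^+ 2 = ev (vdot c.2.2 c.2.2) ->
  - (n1 * n2 * y / 2) = ev (vdot c.2.1.1 c.2.1.2) ->
  - (n1 * n3 * x1 / 2) = ev (vdot c.2.1.1 c.2.2) ->
  - (n2 * n3 * x2 / 2) = ev (vdot c.2.1.2 c.2.2) ->
  [/\ orbit_ok c, vdot (vcross c.2.1.1 c.2.1.2) c.2.2 != (0, 0),
      vdot c.1 c.2.1.1 = (0, 0), vdot c.1 c.2.1.2 = (0, 0) &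
      0 < ev (vdot c.1 c.2.2)] ->
  exists k A, framed c k A.
Proof.
case: c => [w [[a0 b0] c0]] /= [[[a1 pa] [b1 pb] [r1 pr]] [va vb vr] [ab ra rb] _ gen].
move=> n10 n20 n30 e1 e2 e3 e12 e13 e23 [ok d0 wa wb wc].
have [|||||||A hA [[ea eb er] sp]] := @gram_frame (evv a0) (evv b0) (evv c0) (n1 *: a) (n2 *: b) (n3 *: r).
- by rewrite cross_evv dot_evv; apply: contra_neq d0 => /ev_eq0.
- by rewrite dot_evv -e1 !dotE a1; ring.
- by rewrite dot_evv -e2 !dotE b1; ring.
- by rewrite dot_evv -e3 !dotE r1; ring.
- by rewrite dot_evv -e12 !dotE ab; field.
- by rewrite dot_evv -e13 !dotE (dotC a r) ra; field.
- by rewrite dot_evv -e23 !dotE (dotC b r) rb; field.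
have dw p q : dot (evv p *m A) (evv q *m A) = ev (vdot p q) by rewrite dot_orth // dot_evv.
have ev0 : ev (0, 0) = 0 by rewrite /ev /= mul0r addr0.
pose k := n3 * dot v r / ev (vdot w c0).
have k0 : 0 < k by rewrite divr_gt0 // mulr_gt0.
have vE : v = k *: (evv w *m A).
  apply/eqP; rewrite -subr_eq0; apply/eqP/sp; rewrite dotDl dotNl dotZl.
  - by rewrite ea dw wa ev0 -ea dotZr va; ring.
  - by rewrite eb dw wb ev0 -eb dotZr vb; ring.
  by rewrite er dw -er dotZr /k; field; rewrite gt_eqF.
have act_ok z s n p : z \in [:: a0; b0; c0] -> n != 0 -> n *: s = evv z *m A ->
    p \in chamber_orbit (w, (a0, b0, c0)) ->
    refl s (k *: (evv p *m A)) = k *: (evv (vrefl z p) *m A) /\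
    vrefl z p \in chamber_orbit (w, (a0, b0, c0)).
  move=> zin n0 es pL; have [z0 /(_ _ pL)[/(is_reflP _ _ z0) hr ->]] := orbit_okP ok zin.
  by split=> //; rewrite -hr -(reflZ _ _ n0) es linearZ /= refl_orth.
have [za zb zc] : [/\ a0 \in [:: a0; b0; c0], b0 \in [:: a0; b0; c0] & c0 \in [:: a0; b0; c0]].
  by rewrite !inE !eqxx !orbT.
have [n1' n2' n3'] : [/\ n1 != 0, n2 != 0 & n3 != 0] by split; rewrite gt_eqF.
set L := chamber_orbit _ in act_ok *.
have wL : w \in L.
  rewrite /L /chamber_orbit; elim: (15%N) => [|n IH]; first by rewrite inE.
  by rewrite iterS mem_undup mem_cat IH.
exists k, A; split=> // x; split.
  apply: (gen (fun x => exists2 p, p \in L & x = k *: (evv p *m A))); last by exists w.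
  move=> s _ [->|->|->] [p pL ->].
  - by have [-> h] := act_ok _ _ _ p za n1' ea pL; exists (vrefl a0 p).
  - by have [-> h] := act_ok _ _ _ p zb n2' eb pL; exists (vrefl b0 p).
  - by have [-> h] := act_ok _ _ _ p zc n3' er pL; exists (vrefl c0 p).
(* The reverse inclusion follows the construction of the orbit round by round, since the three roots
   preserve [V]. *)
suff h p : p \in L -> k *: (evv p *m A) \in V by case=> p /h ? ->.
have hL n : {subset iter n (orbit_step (a0, b0, c0)) [:: w] <= L} ->
    p \in iter n (orbit_step (a0, b0, c0)) [:: w] -> k *: (evv p *m A) \in V.
  elim: n p => [|n IH] p; first by rewrite inE => _ /eqP ->; rewrite -vE; case: hV.
  rewrite iterS => sub.
  have sub' : {subset iter n (orbit_step (a0, b0, c0)) [:: w] <= L}.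
    by move=> q hq; apply: sub; rewrite mem_undup mem_cat hq.
  rewrite mem_undup !mem_cat => /or4P[/(IH _ sub')//|/mapP|/mapP|/mapP] [q hq ->].
  - by have [<- _] := act_ok _ _ _ q za n1' ea (sub' _ hq); apply/pa/IH.
  - by have [<- _] := act_ok _ _ _ q zb n2' eb (sub' _ hq); apply/pb/IH.
  - by have [<- _] := act_ok _ _ _ q zc n3' er (sub' _ hq); apply/pr/IH.
have Lit : L = iter 15 (orbit_step (a0, b0, c0)) [:: w] by rewrite /L /chamber_orbit.
move=> pL; apply: (hL 15%N) => [q|]; first by rewrite -Lit.
by rewrite -Lit.
Qed.

Lemma orbits_ok : all orbit_ok chambers.
Proof. by vm_compute. Qed.

Ltac frame_tac hV e1 e2 e3 q0 qq hp gp :=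
  rewrite ?e1 ?e2 ?e3;
  repeat match goal with |- context [vdot ?a ?b] =>
    let z := eval vm_compute in (vdot a b) in change (vdot a b) with z end;
  clear -hV q0 qq hp gp;
  first [split=> //; rewrite /ev /= ?NegzE; lra
        | rewrite /ev /= ?NegzE ?expr2 ?rmorphN /=; lra].

Lemma reflection_configuration_framed :
  exists c k A, c \in chambers /\ framed c k A.
Proof.
have [a [b [r [x1 [x2 [y [h H]]]]]]] := classification hV.
have [_ _ _ [x10 x20 y0] _] := h.
pose q : R := Num.sqrt 2.
have q0 : 0 < q by rewrite sqrtr_gt0 ltr0n.
have qq : q ^+ 2 = 2 by rewrite sqr_sqrtr // ler0n.
have qu (z : R) : 0 <= z -> z ^+ 2 = 2 -> z = q.
  by move=> z0 z2; rewrite /q -z2 sqrtr_sqr ger0_norm.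
have hp := golden_sqr; have gp := golden_gt.
have two : 0 < 2 :> R by rewrite ltr0n.
have pick c n1 n2 n3 : c \in chambers -> 0 < n1 -> 0 < n2 -> 0 < n3 ->
    n1 ^+ 2 = ev (vdot c.2.1.1 c.2.1.1) -> n2 ^+ 2 = ev (vdot c.2.1.2 c.2.1.2) ->
    n3 ^+ 2 = ev (vdot c.2.2 c.2.2) ->
    - (n1 * n2 * y / 2) = ev (vdot c.2.1.1 c.2.1.2) ->
    - (n1 * n3 * x1 / 2) = ev (vdot c.2.1.1 c.2.2) ->
    - (n2 * n3 * x2 / 2) = ev (vdot c.2.1.2 c.2.2) ->
    [/\ vdot (vcross c.2.1.1 c.2.1.2) c.2.2 != (0, 0),
      vdot c.1 c.2.1.1 = (0, 0), vdot c.1 c.2.1.2 = (0, 0) &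
      0 < ev (vdot c.1 c.2.2)] ->
    exists c k A, c \in chambers /\ framed c k A.
  move=> cc h1 h2 h3 h4 h5 h6 h7 h8 h9 [h10 h11 h12 h13].
  have [|k [A f]] := frame_chamber h h1 h2 h3 h4 h5 h6 h7 h8 h9; last by exists c, k, A.
  by split=> //; apply: (allP orbits_ok).
rewrite expr2 in qq; rewrite expr2 in hp.
case: H => [[e1 [[e2 e3]|[e3 e2]]]|[e3 [e1 e2]]].
- case: e3 => [e3|/(qu _ y0) e3|/(golden_uniq y0) e3].
  + by apply: (pick tetrahedron q q q) => //; frame_tac hV e1 e2 e3 q0 qq hp gp.
  + by apply: (pick octahedron 1 q q) => //; frame_tac hV e1 e2 e3 q0 qq hp gp.
  + by apply: (pick icosahedron 2 2 2) => //; frame_tac hV e1 e2 e3 q0 qq hp gp.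
- case: e2 => [/(qu _ x20) e2|/(golden_uniq x20) e2].
  + by apply: (pick cube q q 1) => //; frame_tac hV e1 e2 e3 q0 qq hp gp.
  + by apply: (pick dodecahedron 2 2 2) => //; frame_tac hV e1 e2 e3 q0 qq hp gp.
- case: e2 => [e2|/(qu _ x20) e2|/(golden_uniq x20) e2].
  + by apply: (pick octahedron2 q q q) => //; frame_tac hV e1 e2 e3 q0 qq hp gp.
  + by apply: (pick cuboctahedron q 1 q) => //; frame_tac hV e1 e2 e3 q0 qq hp gp.
  + by apply: (pick icosidodecahedron 2 2 2) => //; frame_tac hV e1 e2 e3 q0 qq hp gp.
Qed.

End Framed.
End Evaluation.

Local Open Scope nat_scope.

(** * Combinatorics of maps: corners, fans and connectedness *)

Lemma cycle_closed (T : eqType) (r : rel T) (s : seq T) (S : T -> Prop) x0 :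
  path.cycle r s -> (forall x y, x \in s -> y \in s -> r x y -> S x -> S y) ->
  x0 \in s -> S x0 -> forall x, x \in s -> S x.
Proof.
move=> cs hS x0s Sx0; case: (rot_to x0s) => i s' es.
have ms y : (y \in x0 :: s') = (y \in s) by rewrite -es mem_rot.
move: cs; rewrite -(rot_cycle i) es /= rcons_path => /andP[ps _].
move=> x; rewrite -ms.
have: {subset x0 :: s' <= s} by move=> y; rewrite ms.
elim: s' x0 Sx0 ps {es ms x0s} => [|y s' IH] x0 Sx0 /=.
  by move=> _ _; rewrite inE => /eqP ->.
move=> /andP[xy ps] sub; rewrite inE => /predU1P[->//|].
apply: IH => //; last by move=> z hz; apply: sub; rewrite inE hz orbT.
by apply: hS xy Sx0; apply: sub; rewrite !inE eqxx ?orbT.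
Qed.

Lemma uniq_map_inj (T U : eqType) (h : T -> U) (s : seq T) :
  uniq (map h s) -> {in s &, injective h}.
Proof.
elim: s => //= x s IH /andP[hx us] y z; rewrite !inE.
move=> /predU1P[->|ys] /predU1P[->|zs] // e.
- by case/mapP: hx; exists z.
- by case/mapP: hx; exists y.
exact: IH.
Qed.

Section MapCombinatorics.
Variable M : cells.
Hypothesis hM : is_map M.
Implicit Types (v w : vertex M) (e : edge M) (f : face M).

Lemma other_end v e : inVE v e -> exists w,
  [/\ w != v, inVE w e & forall x, inVE x e -> x = v \/ x = w].
Proof.
move=> ve; have /eqP/cards2P[x [y [xy exy]]] := edge_ends hM e.
have mE z : inVE z e = (z == x) || (z == y).
  by have /finset.setP/(_ z) := exy; rewrite !inE.
move: (ve); rewrite mE => /orP[]/eqP ?; subst v.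
  exists y; rewrite eq_sym mE eqxx orbT; split=> // z.
  by rewrite mE => /orP[]/eqP ->; [left|right].
exists x; rewrite mE eqxx; split=> // z.
by rewrite mE => /orP[]/eqP ->; [right|left].
Qed.

Lemma other_side e f : inEF e f -> exists g,
  [/\ g != f, inEF e g & forall x, inEF e x -> x = f \/ x = g].
Proof.
move=> ve; have /eqP/cards2P[x [y [xy exy]]] := edge_sides hM e.
have mE z : inEF e z = (z == x) || (z == y).
  by have /finset.setP/(_ z) := exy; rewrite !inE.
move: (ve); rewrite mE => /orP[]/eqP ?; subst f.
  exists y; rewrite eq_sym mE eqxx orbT; split=> // z.
  by rewrite mE => /orP[]/eqP ->; [left|right].
exists x; rewrite mE eqxx; split=> // z.
by rewrite mE => /orP[]/eqP ->; [right|left].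
Qed.

Lemma corner v e f : inVE v e -> inEF e f -> exists e1,
  [/\ e1 != e, inVE v e1, inEF e1 f &
      forall x, inVE v x -> inEF x f -> x = e \/ x = e1].
Proof.
move=> ve ef; have [s [cs u1 u2 ms]] := face_boundary hM f.
have us : uniq s by apply: map_uniq u1.
have step a : a \in s -> walk_step a (next s a) by move=> /(next_cycle cs).
have ends a x : a \in s -> inVE x a.2 -> x = a.1 \/ x = (next s a).1.
  move=> /step/and3P[n h1 h2] hx; have [w [wn hw all_w]] := other_end h1.
  by case: (all_w _ h2) => e2; [rewrite e2 eqxx in n|rewrite e2; apply: all_w].
have inj1 a b : a \in s -> b \in s -> a.1 = b.1 -> a = b.
  by move=> as_ bs; apply: (uniq_map_inj u1).
have inj2 a b : a \in s -> b \in s -> a.2 = b.2 -> a = b.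
  by move=> as_ bs; apply: (uniq_map_inj u2).
have at_v x : inVE v x -> inEF x f -> exists2 a, a \in s & x = a.2 /\ (v = a.1 \/ v = (next s a).1).
  move=> vx; rewrite -ms => /mapP[a as_ ea]; subst x; exists a => //; split=> //.
  exact: ends.
have [c cs_ vc] : exists2 c, c \in s & v = c.1.
  have [a as_ [_ [->|->]]] := at_v e ve ef; first by exists a.
  by exists (next s a) => //; rewrite mem_next.
pose p := prev s c; have ps : p \in s by rewrite mem_prev.
have np : next s p = c by apply: next_prev.
have /and3P[pc1 hp hpc] : walk_step p c by rewrite -np; apply: step.
have /and3P[_ hc _] := step _ cs_.
have pc2 : p.2 != c.2 by apply: contra_neq pc1 => /(inj2 _ _ ps cs_) ->.
have two x : inVE v x -> inEF x f -> x = c.2 \/ x = p.2.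
  move=> vx xf; have [a as_ [-> [va|va]]] := at_v x vx xf.
    by left; congr snd; apply: inj1; rewrite // -va.
  right; congr snd; apply: (can_inj (prev_next us)); rewrite np.
  by apply: inj1; rewrite ?mem_next // -va.
have cf : inEF c.2 f by rewrite -ms map_f.
have pf : inEF p.2 f by rewrite -ms map_f.
case: (two _ ve ef) => ->.
  by exists p.2; split=> //; rewrite vc.
exists c.2; split; rewrite // 1?eq_sym ?vc // => x; rewrite -vc => vx xf.
by case: (two x vx xf); [right|left].
Qed.

Lemma face_connected f (S : edge M -> Prop) e0 : inEF e0 f -> S e0 ->
  (forall v e e', inVE v e -> inVE v e' -> inEF e f -> inEF e' f -> S e -> S e') ->
  forall e, inEF e f -> S e.
Proof.
move=> e0f S0 hS; have [s [cs u1 u2 ms]] := face_boundary hM f.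
move: (e0f); rewrite -ms => /mapP[a0 a0s ea0] e; rewrite -ms => /mapP[a as_ ->].
apply: (@cycle_closed _ _ s (fun a => S a.2) a0 cs) => //; last by rewrite -ea0.
move=> x y xs ys /and3P[_ h1 h2]; apply: (hS y.1) => //; rewrite -?ms ?map_f //.
have := next_cycle cs ys; by case/and3P.
Qed.

Lemma star_connected v (S : edge M -> Prop) e0 : inVE v e0 -> S e0 ->
  (forall f e e', inVE v e -> inVE v e' -> inEF e f -> inEF e' f -> S e -> S e') ->
  forall e, inVE v e -> S e.
Proof.
move=> ve0 S0 hS; have [s [cs u1 u2 ms _]] := vertex_star hM v.
move: (ve0); rewrite -ms => /mapP[a0 a0s ea0] e; rewrite -ms => /mapP[a as_ ->].
apply: (@cycle_closed _ _ s (fun a => S a.1) a0 cs) => //; last by rewrite -ea0.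
by move=> x y xs ys /and3P[_ h1 h2]; apply: (hS x.2) => //; rewrite -ms map_f.
Qed.

Lemma vertex_connected (S : vertex M -> Prop) v0 : S v0 ->
  (forall e v w, inVE v e -> inVE w e -> S v -> S w) -> forall v, S v.
Proof.
move=> S0 hS v; have /connectP[p] := map_connected hM v0 v.
elim: p v0 S0 => [|w p IH] v0 S0 /=; first by move=> _ ->.
move=> /andP[/existsP[e /andP[h1 h2]] hp]; apply: IH => //.
exact: hS h1 h2 S0.
Qed.

Lemma edge_has_vertex e : exists v, inVE v e.
Proof.
have /eqP/cards2P[x [y [_ exy]]] := edge_ends hM e.
by exists x; have /finset.setP/(_ x) := exy; rewrite !inE eqxx.
Qed.

Lemma edge_has_face e : exists f, inEF e f.
Proof.
have /eqP/cards2P[x [y [_ exy]]] := edge_sides hM e.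
by exists x; have /finset.setP/(_ x) := exy; rewrite !inE eqxx.
Qed.

(** Induction over edges that moves only across a corner: the star of a vertex is filled first, then
    the neighbouring vertices are reached. *)
Lemma edge_connected (S : edge M -> Prop) e0 : S e0 ->
  (forall v f e e', inVE v e -> inVE v e' -> inEF e f -> inEF e' f -> S e -> S e') ->
  forall e, S e.
Proof.
move=> S0 hS.
have star v e : inVE v e -> S e -> forall e', inVE v e' -> S e'.
  by move=> ve Se; apply: (star_connected ve) => // f; apply: hS.
have [v0 ve0] := edge_has_vertex e0.
have all_v v : forall e, inVE v e -> S e.
  move: v; apply: (@vertex_connected (fun v => forall e, inVE v e -> S e) v0).
    by move=> e; apply: star ve0 S0 e.
  by move=> e v w ve we hv e' we'; apply: (star w e) => //; apply: hv.
by move=> e; have [v ve] := edge_has_vertex e; apply: all_v ve.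
Qed.

(** Each edge has two faces, and each of these has two edges at [v]. If [e] and [e1] have both faces
    in common, they close up the fan around [v], which is a single cycle. *)
Lemma shared_sides v e e1 f f' : inVE v e -> inVE v e1 -> e != e1 -> f != f' ->
  inEF e f -> inEF e1 f -> inEF e f' -> inEF e1 f' -> degree v = 2%N.
Proof.
move=> ve ve1 n nf h1 h2 h3 h4.
have all_e x : inVE v x -> x = e \/ x = e1.
  apply: (@star_connected v (fun x => x = e \/ x = e1) e ve); first by left.
  have close y y' z : inVE v y -> inVE v z -> inEF y f -> inEF z f -> inEF y f' -> inEF z f' ->
      y != z -> forall g, inEF y g -> inVE v y' -> inEF y' g -> y' = y \/ y' = z.
    move=> vy vz yf zf yf' zf' yz g yg vy' y'g.
    have [g' [gn yg' hg]] := other_side yf.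
    have gff : g = f \/ g = f'.
      case: (hg f' yf') => ef'; first by rewrite ef' eqxx in nf.
      by rewrite ef'; apply: hg.
    have zg : inEF z g by case: gff => ->.
    have [t [tn _ _ ht]] := corner vy yg.
    case: (ht z vz zg) => ezt; first by rewrite ezt eqxx in yz.
    by rewrite ezt; apply: ht.
  move=> g y y' vy vy' yg y'g [] ey; subst y.
    exact: (close e y' e1 ve ve1 h1 h2 h3 h4 n g yg vy' y'g).
  rewrite eq_sym in n.
  by case: (close e1 y' e ve1 ve h2 h1 h4 h3 n g yg vy' y'g); [right|left].
rewrite /degree; have -> : [set x | inVE v x] = [set e; e1].
  apply/finset.setP => x; rewrite !inE; apply/idP/orP => [/all_e[]->|[]/eqP->//]; rewrite ?eqxx; by [left|right].
by rewrite cards2 n.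
Qed.

End MapCombinatorics.

Local Open Scope ring_scope.

(** * Convex hulls and hull distances under similarities *)

Section Hull.
Variable R : realType.
Local Notation E3 := 'rV[R]_3.
Implicit Types (V : {fset E3}) (x y u w a : E3).

(** Weights defined on all of space, with the values off [V] ignored, can be reused for other vertex
    sets and allow single vertices to be split off a sum. *)
Lemma conv_hullE V x : conv_hull V x <-> exists c : E3 -> R,
  [/\ forall v, v \in V -> 0 <= c v, \sum_(v <- V) c v = 1
    & x = \sum_(v <- V) c v *: v].
Proof.
split=> -[c [c0 c1 ->]]; last first.
  exists (fun v => c (val v)); split=> [v||].
  - exact/c0/valP.
  - by rewrite -c1 big_seq_fsetE.
  - by rewrite big_seq_fsetE.
exists (fun v => if insub v is Some v' then c v' else 0); split=> [v vV||].
- by case: insubP => // v' _ _; apply: c0.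
- by rewrite -c1 big_seq_fsetE; apply: eq_bigr => v _; rewrite valK.
- by rewrite [RHS]big_seq_fsetE; apply: eq_bigr => v _; rewrite valK.
Qed.

Lemma conv_hull_sub V x : x \in V -> conv_hull V x.
Proof.
move=> xV; apply/conv_hullE; exists (fun v => (v == x)%:R); split.
- by move=> *; rewrite ler0n.
- rewrite (big_fsetD1 x) //= eqxx big_seq big1 ?addr0 // => i.
  by rewrite !inE => /andP[/negPf ->].
- rewrite (big_fsetD1 x) //= eqxx big_seq big1 ?addr0 ?scale1r // => i.
  by rewrite !inE => /andP[/negPf ->]; rewrite scale0r.
Qed.

Lemma conv_hull_le V a b x : (forall v, v \in V -> dot a v <= b) ->
  conv_hull V x -> dot a x <= b.
Proof.
move=> h /conv_hullE[c [c0 c1 ->]]; rewrite dotC dot_suml -[b]mul1r -c1 mulr_suml.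
rewrite big_seq [X in _ <= X]big_seq; apply: ler_sum => v vV.
by rewrite dotZl dotC ler_wpM2l ?c0 ?h.
Qed.

(* On a supporting hyperplane only the touching vertices carry weight. *)
Lemma hull_edge_vertices V a b u w : u \in V -> w \in V -> u <> w ->
  (forall v, v \in V -> v != u -> v != w -> dot a v < b) ->
  dot a u = b -> dot a w = b -> hull_edge V u w.
Proof.
move=> uV wV uw lt au aw; split=> //; exists a, b.
have le v : v \in V -> dot a v <= b.
  move=> vV; have [->|vu] := eqVneq v u; first by rewrite au.
  by have [->|vw] := eqVneq v w; [rewrite aw|apply/ltW/lt].
have u2 : u \in [fset u; w]%fset by rewrite !inE eqxx.
have w2 : w \in ([fset u; w] `\ u)%fset by rewrite !inE eqxx orbT andbT eq_sym; apply/eqP.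
have set2 v : v \in ([fset u; w] `\ u `\ w)%fset = false.
  by rewrite !inE; case: (v == u); case: (v == w).
split; first by move=> x; apply: conv_hull_le.
apply/seteqP; split=> x /=; last first.
  move=> /conv_hullE[c [c0 c1 ->]].
  move: c1; rewrite !(big_fsetD1 u u2) !(big_fsetD1 w w2) /=.
  rewrite !big_seq big1 ?addr0 => [cuw|v]; last by rewrite set2.
  rewrite [X in _ + (_ + X)]big1 ?addr0 => [|v]; last by rewrite set2.
  have w2' : w \in [fset u; w]%fset by rewrite !inE eqxx orbT.
  split; last by rewrite !dotE au aw -mulrDl cuw mul1r.
  apply/conv_hullE; exists (fun v => if v == u then c u else if v == w then c w else 0).
  have w3 : w \in (V `\ u)%fset by rewrite !inE wV andbT eq_sym; apply/eqP.
  have wu : (w == u) = false by apply/eqP => e; apply: uw.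
  split.
  - by move=> v _; case: eqP => _; [apply: c0|case: eqP => _; first exact: c0].
  - rewrite (big_fsetD1 u uV) (big_fsetD1 w w3) /= !eqxx wu big_seq big1 ?addr0 // => v.
    by rewrite !inE => /and3P[/negPf -> /negPf ->].
  - rewrite (big_fsetD1 u uV) (big_fsetD1 w w3) /= !eqxx wu big_seq big1 ?addr0 // => v.
    by rewrite !inE => /and3P[/negPf -> /negPf ->]; rewrite scale0r.
move=> [/conv_hullE[c [c0 c1 ->]] ax].
have c0' v : v \in V -> v != u -> v != w -> c v = 0.
  move=> vV vu vw; apply/eqP; rewrite eq_le c0 // andbT leNgt; apply/negP => cv.
  suff : dot a (\sum_(v <- V) c v *: v) < b by rewrite ax ltxx.
  rewrite dotC dot_suml -[b]mul1r -c1 mulr_suml (big_fsetD1 v vV) /= [X in _ < X](big_fsetD1 v vV) /=.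
  apply: ltr_leD; first by rewrite dotZl dotC ltr_pM2l // lt.
  rewrite big_seq [X in _ <= X]big_seq; apply: ler_sum => t.
  by rewrite !inE => /andP[_ tV]; rewrite dotZl dotC ler_wpM2l ?c0 ?le.
apply/conv_hullE; exists c; split.
- by move=> v; rewrite !inE => /orP[]/eqP ->; apply: c0.
- have w3 : w \in (V `\ u)%fset by rewrite !inE wV andbT eq_sym; apply/eqP.
  move: c1; rewrite (big_fsetD1 u uV) (big_fsetD1 w w3) /= => <-.
  rewrite (big_fsetD1 u u2) (big_fsetD1 w w2) /= !big_seq !big1 // => v.
    by rewrite !inE => /and3P[h1 h2 h3]; apply: c0'.
  by rewrite set2.
- have w3 : w \in (V `\ u)%fset by rewrite !inE wV andbT eq_sym; apply/eqP.
  rewrite (big_fsetD1 u uV) (big_fsetD1 w w3) /=.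
  rewrite (big_fsetD1 u u2) (big_fsetD1 w w2) /= !big_seq !big1 // => v.
    by rewrite set2.
  by rewrite !inE => /and3P[h1 h2 h3]; rewrite c0' // scale0r.
Qed.

Section Image.
Variables (k : R) (A : 'M[R]_3) (t : E3).
Hypotheses (k0 : 0 < k) (hA : orthogonal_mx A).

Definition simil x : E3 := k *: (x *m A) + t.
Definition simil_inv y : E3 := k^-1 *: ((y - t) *m A^T).

Lemma similK : cancel simil simil_inv.
Proof.
move=> x; rewrite /simil /simil_inv addrK -scalemxAl scalerA mulVf ?gt_eqF //.
by rewrite scale1r -mulmxA hA mulmx1.
Qed.

Lemma simil_invK : cancel simil_inv simil.
Proof.
move=> x; rewrite /simil /simil_inv -scalemxAl scalerA mulfV ?gt_eqF //.
by rewrite scale1r -mulmxA orth_tr // mulmx1 subrK.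
Qed.

Lemma simil_inj : injective simil.
Proof. exact: can_inj similK. Qed.

Lemma simil_similarity : similarity simil.
Proof. by exists k => // x y; rewrite affine_edist // ltW. Qed.

Lemma simil_inv_affine y : simil_inv y = k^-1 *: (y *m A^T) + simil_inv 0.
Proof. by rewrite /simil_inv mulmxBl sub0r mulNmx -scalerDr. Qed.

Lemma dot_simil a x : dot (a *m A) (simil x) = k * dot a x + dot (a *m A) t.
Proof. by rewrite dotDr dotZr dot_orth. Qed.

Lemma conv_hull_simil V x : conv_hull V x -> conv_hull [fset simil v | v in V]%fset (simil x).
Proof.
move=> /conv_hullE[c [c0 c1 ->]]; apply/conv_hullE; exists (c \o simil_inv); split.
- by move=> v /imfsetP[u /= uV ->]; rewrite similK c0.
- rewrite big_imfset /=; last by move=> ? ? _ _; apply: simil_inj.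
  by rewrite -[RHS]c1; apply: eq_bigr => v _; rewrite similK.
- rewrite big_imfset /=; last by move=> ? ? _ _; apply: simil_inj.
  rewrite /simil mulmx_suml scaler_sumr -[t in LHS]scale1r -c1 scaler_suml -big_split /=.
  by apply: eq_bigr => v _; rewrite similK scalerDr -scalemxAl scalerA mulrC -scalerA.
Qed.

End Image.

Lemma simil_inv_simil k A t : (@simil_inv k A t) =1 simil k^-1 A^T (simil_inv k A t 0).
Proof. by move=> y; rewrite simil_inv_affine. Qed.

Lemma simil_invS k A t V : 0 < k -> orthogonal_mx A ->
  [fset simil k^-1 A^T (simil_inv k A t 0) v | v in [fset simil k A t v | v in V]]%fset = V.
Proof.
move=> k0 hA; rewrite imfset_compE; apply: eq_idfset => x.
by rewrite -simil_inv_simil similK.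
Qed.

Lemma conv_hull_simil_iff k A t V y : 0 < k -> orthogonal_mx A ->
  conv_hull [fset simil k A t v | v in V]%fset y <->
  exists2 x, conv_hull V x & y = simil k A t x.
Proof.
move=> k0 hA; split=> [h|[x h ->]]; last exact: conv_hull_simil.
exists (simil_inv k A t y); last by rewrite simil_invK.
have k'0 : 0 < k^-1 by rewrite invr_gt0.
have := conv_hull_simil (simil_inv k A t 0) k'0 (orth_trmx hA) h.
by rewrite simil_invS // -simil_inv_simil.
Qed.

Lemma hull_edge_simil k A t V u w : 0 < k -> orthogonal_mx A ->
  hull_edge V u w -> hull_edge [fset simil k A t v | v in V]%fset (simil k A t u) (simil k A t w).
Proof.
move=> k0 hA [uw [a [b [le eq]]]]; split; first by move=> /(simil_inj k0 hA).
exists (a *m A), (k * b + dot (a *m A) t); split.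
  move=> y /(conv_hull_simil_iff _ _ _ k0 hA)[x hx ->].
  by rewrite dot_simil // lerD2r ler_pM2l // le.
have -> : [fset simil k A t u; simil k A t w]%fset = [fset simil k A t v | v in [fset u; w]]%fset.
  apply/fsetP => z; rewrite !inE; apply/orP/imfsetP => /=.
    by case=> /eqP ->; [exists u|exists w]; rewrite // !inE eqxx ?orbT.
  by case=> x; rewrite !inE => /orP[]/eqP -> ->; rewrite eqxx; [left|right].
apply/seteqP; split=> y /=.
  move=> [/(conv_hull_simil_iff _ _ _ k0 hA)[x hx ->]].
  rewrite dot_simil // => /addIr/(mulfI (lt0r_neq0 k0)) ax.
  apply/(conv_hull_simil_iff _ _ _ k0 hA); exists x => //.
  by rewrite -eq.
move=> /(conv_hull_simil_iff _ _ _ k0 hA)[x]; rewrite -eq => -[hx ax] ->.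
split; first by apply/(conv_hull_simil_iff _ _ _ k0 hA); exists x.
by rewrite dot_simil // ax.
Qed.

Lemma hull_path_simil k A t V u w n : 0 < k -> orthogonal_mx A ->
  hull_path V u w n ->
  hull_path [fset simil k A t v | v in V]%fset (simil k A t u) (simil k A t w) n.
Proof.
move=> k0 hA; elim=> [x|x y z m hxy _ IH]; first exact: hull_path0.
by apply: hull_pathS IH; apply: hull_edge_simil.
Qed.

Lemma hull_distance_simil k A t V u w n : 0 < k -> orthogonal_mx A ->
  hull_distance V u w n ->
  hull_distance [fset simil k A t v | v in V]%fset (simil k A t u) (simil k A t w) n.
Proof.
move=> k0 hA [hp hmin]; split; first exact: hull_path_simil.
move=> m hm; apply: hmin; have k'0 : 0 < k^-1 by rewrite invr_gt0.
have := hull_path_simil (simil_inv k A t 0) k'0 (orth_trmx hA) hm.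
by rewrite simil_invS // -!simil_inv_simil !similK.
Qed.

Lemma hull_distance_uniq V u w n m : hull_distance V u w n -> hull_distance V u w m -> n = m.
Proof.
by move=> [h1 h2] [h3 h4]; apply/eqP; rewrite eqn_leq h2 // h4.
Qed.

Lemma hull_edge_sym V u w : hull_edge V u w -> hull_edge V w u.
Proof.
move=> [uw [a [b h]]]; split; first by move=> e; apply: uw.
by exists a, b; rewrite fsetUC.
Qed.

Lemma hull_path_rcons V u v w n : hull_path V u v n -> hull_edge V v w -> hull_path V u w n.+1.
Proof.
elim=> [x h|x y z m hxy _ IH h]; first exact: hull_pathS h (hull_path0 _ _).
exact: hull_pathS hxy (IH h).
Qed.

Lemma hull_path_sym V u w n : hull_path V u w n -> hull_path V w u n.
Proof.
elim=> [x|x y z m hxy _ IH]; first exact: hull_path0.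
exact: hull_path_rcons IH (hull_edge_sym hxy).
Qed.

Lemma hull_distance_sym V u w n : hull_distance V u w n -> hull_distance V w u n.
Proof.
move=> [hp hm]; split; first exact: hull_path_sym.
by move=> m /hull_path_sym/hm.
Qed.

End Hull.

Lemma index2_mul (gT : finGroupType) (G H : {group gT}) (x y : gT) :
  H \subset G -> #|G : H|%g = 2%N -> x \in G -> y \in G -> x \notin H -> y \notin H ->
  (x * y)%g \in H.
Proof.
move=> HG i2 xG yG xH yH.
have yD : (y^-1)%g \in G :\: H by rewrite !inE !groupV yH.
have : x \in G :\: H by rewrite inE xH.
by rewrite -(rcoset_index2 HG i2 yD) mem_rcoset invgK.
Qed.

Lemma fset2_eq (K : choiceType) (u w u' w' : K) : [fset u; w]%fset = [fset u'; w']%fset ->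
  (u = u' /\ w = w') \/ (u = w' /\ w = u').
Proof.
move=> /fsetP h; have := (h u, h w, h u', h w'); rewrite !inE !eqxx ?orbT /=.
move=> [[[/esym/orP h1 /esym/orP h2] /orP h3] /orP h4].
case: h1 => /eqP h1; case: h2 => /eqP h2; subst u w; try by [left|right].
  by left; split=> //; case: h4 => /eqP.
by right; split=> //; case: h3 => /eqP.
Qed.

(** * Orthogonal maps that preserve a plane *)

Section LinearMaps.
Variable R : realType.
Local Notation E3 := 'rV[R]_3.

(** [F x - H x] is orthogonal to the images of [p], [q] and [cross p q], which span space. *)
Lemma isometry_ext (p q : E3) (F H : E3 -> E3) :
  (forall x y, dot (F x) (F y) = dot x y) -> (forall x y, dot (H x) (H y) = dot x y) ->
  cross (F p) (F q) != 0 ->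
  F p = H p -> F q = H q -> F (cross p q) = H (cross p q) -> F =1 H.
Proof.
move=> hF hH n0 ep eq_ en x.
have d0 y : F y = H y -> dot (F x - H x) (F y) = 0.
  by move=> e; rewrite dotDl dotNl hF {1}e hH subrr.
have [k e] := perp_cross n0 (d0 p ep) (d0 q eq_).
have Fn : F (cross p q) != 0.
  apply: contra_neq n0 => n0; have /dot_eq0 c0 : dot (cross p q) (cross p q) = 0.
    by rewrite -hF n0 dot0l.
  apply: dot_eq0; rewrite cross_norm !hF -cross_norm c0; exact: dot0l.
have [l fn] : exists l, F (cross p q) = l *: cross (F p) (F q).
  by apply: perp_cross => //; rewrite hF dotC (dot_crossl, dot_crossr).
have l0 : l != 0 by apply: contra_neq Fn => l0; rewrite fn l0 scale0r.
have := d0 _ en; rewrite e fn dotZl dotZr => /eqP.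
rewrite !mulf_eq0 (negPf l0) (gt_eqF (dot_gt0 n0)) !orbF => /eqP k0.
by apply/eqP; rewrite -subr_eq0 e k0 scale0r.
Qed.

(** The plane of [p] and [q] is mapped to itself, so its normal is mapped to a multiple of itself of
    the same norm. *)
Lemma isometry_normal (p q : E3) (A : 'M[R]_3) : orthogonal_mx A -> cross p q != 0 ->
  (p *m A = p /\ q *m A = q) \/ (p *m A = q /\ q *m A = p) ->
  cross p q *m A = cross p q \/ cross p q *m A = - cross p q.
Proof.
move=> hA n0 hpq; have [h1 h2] : dot (cross p q *m A) p = 0 /\ dot (cross p q *m A) q = 0.
  case: hpq => -[e1 e2]; split; rewrite dotC.
  - by rewrite -[X in dot X]e1 dot_orth // dot_crossl.
  - by rewrite -[X in dot X]e2 dot_orth // dot_crossr.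
  - by rewrite -[X in dot X]e2 dot_orth // dot_crossr.
  by rewrite -[X in dot X]e1 dot_orth // dot_crossl.
have [k e] := perp_cross n0 h1 h2.
have : dot (cross p q *m A) (cross p q *m A) = dot (cross p q) (cross p q) by rewrite dot_orth.
rewrite e dotZl dotZr mulrA => kk.
have /eqP : (k * k - 1) * dot (cross p q) (cross p q) = 0 by rewrite mulrBl mul1r kk subrr.
rewrite mulf_eq0 (gt_eqF (dot_gt0 n0)) orbF.
by rewrite subr_eq0 -expr2 sqrf_eq1 => /orP[]/eqP ->; rewrite ?scale1r ?scaleN1r; [left|right].
Qed.

(** The sign on the normal is the only freedom left by the action on the plane. *)
Lemma fix_plane (p q : E3) (A : 'M[R]_3) : orthogonal_mx A -> cross p q != 0 ->
  p *m A = p -> q *m A = q -> (forall x : E3, x *m A = x) \/ (forall x : E3, x *m A = refl (cross p q) x).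
Proof.
move=> hA n0 ep eq_; have hF x y : dot (x *m A) (y *m A) = dot x y by apply: dot_orth.
case: (isometry_normal hA n0 (or_introl (conj ep eq_))) => en; [left|right].
  by apply: (@isometry_ext p q (fun x => x *m A) id) => //; rewrite ep eq_.
apply: (@isometry_ext p q (fun x => x *m A) (refl (cross p q))) => //.
- by move=> x y; rewrite dot_refl.
- by rewrite ep eq_.
- by rewrite ep refl_perp ?dot_crossl.
- by rewrite eq_ refl_perp ?dot_crossr.
by rewrite en refl_id.
Qed.

Lemma swap_plane (p q : E3) (A : 'M[R]_3) : orthogonal_mx A -> cross p q != 0 ->
  dot p p = dot q q -> p *m A = q -> q *m A = p ->
  (forall x : E3, x *m A = refl (p - q) x) \/
  (forall x : E3, x *m A = refl (p - q) (refl (cross p q) x)).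
Proof.
move=> hA n0 epq ep eq_; have hF x y : dot (x *m A) (y *m A) = dot x y by apply: dot_orth.
have n0' : cross (p *m A) (q *m A) != 0.
  rewrite ep eq_; apply: contra_neq n0 => c0; apply/row3P; move: (congr1 (fun z : E3 => (z 0 0, z 0 1, z 0 2%:R)) c0);
  rewrite !vec3E !mxE => -[*]; lra.
have nr : refl (p - q) (cross p q) = cross p q.
  by apply: refl_perp; rewrite dotDr dotNr ![dot (cross _ _) _]dotC dot_crossl dot_crossr subrr.
have sp : refl (p - q) p = q by apply: refl_swap.
have sq : refl (p - q) q = p by rewrite -{2}(reflK (p - q) p) sp.
case: (isometry_normal hA n0 (or_intror (conj ep eq_))) => en; [left|right].
  apply: (@isometry_ext p q (fun x => x *m A) (refl (p - q))) => //; rewrite ?ep ?eq_ ?sp ?sq ?en ?nr //.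
  by move=> x y; rewrite dot_refl.
apply: (@isometry_ext p q (fun x => x *m A) (refl (p - q) \o refl (cross p q))) => //=.
- by move=> x y; rewrite !dot_refl.
- by rewrite ep (@refl_perp _ (cross p q) p) ?dot_crossl.
- by rewrite eq_ (@refl_perp _ (cross p q) q) ?dot_crossr.
by rewrite en refl_id linearN /= nr.
Qed.

End LinearMaps.

(** * From a polyhedron of index 2 to a reflection configuration *)

Section Geometry.
Variables (R : realType) (X : figure R).
Local Notation E3 := 'rV[R]_3.
Hypothesis hX : regular_index2 X.
Hypothesis hlen : edges_of_different_lengths X.

Local Notation M := (map_of X).
Implicit Types (u v w : vertex M) (e : edge M) (f : face M) (g h : cell_perm M).

Let polyX : is_polyhedron X. Proof. by case: hX. Qed.
Let hM : is_map M. Proof. by case: polyX. Qed.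
Let regX : regular M. Proof. by case: hX. Qed.
Let i2 : #|Gamma M : Gsym X|%g = 2%N. Proof. by case: hX. Qed.
Let GG : Gsym X \subset Gamma M. Proof. exact: Gsym_sub_Gamma. Qed.

Lemma Gamma_inc g : g \in Gamma M ->
  (forall v e, inVE (g.1.1 v) (g.1.2 e) = inVE v e) /\
  (forall e f, inEF (g.1.2 e) (g.2 f) = inEF e f).
Proof.
rewrite inE => /andP[/'forall_forallP h1 /'forall_forallP h2].
by split=> x y; [apply/eqP/h1|apply/eqP/h2].
Qed.

Definition edge_equiv e e' := exists2 g, g \in Gsym X & g.1.2 e = e'.

Lemma edge_equiv_trans e e' e'' : edge_equiv e e' -> edge_equiv e' e'' -> edge_equiv e e''.
Proof.
by move=> [g gG <-] [h hG <-]; exists (g * h)%g; rewrite ?groupM //= permM.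
Qed.

Lemma edge_equiv_sym e e' : edge_equiv e e' -> edge_equiv e' e.
Proof. by move=> [g gG <-]; exists (g^-1)%g; rewrite ?groupV //= permK. Qed.

Definition lies v e f := inVE v e /\ inEF e f.

Lemma flag_map v e f v' e' f' : lies v e f -> lies v' e' f' ->
  exists g, [/\ g \in Gamma M, g.1.1 v = v', g.1.2 e = e' & g.2 f = f'].
Proof.
move=> [h1 h2] [h3 h4].
have [||g gG [e1 e2 e3]] := regX (x := (v, e, f)) (y := (v', e', f')).
- exact/andP.
- exact/andP.
by exists g.
Qed.

Lemma edge_fset u w e : inVE u e -> inVE w e -> u != w -> val e = [fset val u; val w]%fset.
Proof.
move=> ue we uw; apply/fsetP => x; rewrite !inE; apply/idP/orP => [xe|[]/eqP->//].
have xV : x \in verts X by apply: (edges_on_verts polyX (valP e)).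
have [t [_ te ht]] := other_end hM ue.
have ew : w = t by case: (ht w we) => // wu; rewrite wu eqxx in uw.
subst t; case: (ht [` xV]%fset xe) => <-; by [left|right].
Qed.

Lemma edge_ext u w e e' : inVE u e -> inVE w e -> u != w -> inVE u e' -> inVE w e' -> e = e'.
Proof. by move=> *; apply: val_inj; rewrite (@edge_fset u w e) // (@edge_fset u w e'). Qed.

(** * The center and linear parts *)

Definition center : E3 := (#|` verts X|%:R)^-1 *: \sum_(x <- verts X) x.

Definition lin (A : 'M[R]_3) (x : E3) : E3 := (x - center) *m A + center.

Lemma linE A x : lin A x = simil 1 A (center - center *m A) x.
Proof. by rewrite /lin /simil scale1r mulmxBl addrAC addrA. Qed.

Lemma vertex_exists : exists v : vertex M, True.
Proof. by have /card_gt0P[v _] := map_inhabited hM; exists v. Qed.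

(** A symmetry permutes the vertices, so it fixes their centroid and is linear about it. *)
Lemma symmetry_lin s : symmetry X s -> exists2 A, orthogonal_mx A & s = lin A.
Proof.
move=> [is_s Xs]; have Vs : [fset s x | x in verts X]%fset = verts X.
  by rewrite -[in RHS]Xs.
have [|A hA sA] := @similarity_affine _ s 1 ltr01 _; first by move=> x y; rewrite mul1r is_s.
exists A => //; have {sA}[c0 sA] : exists c0, forall x, s x = x *m A + c0.
  by exists (s 0) => x; rewrite sA scale1r.
have inj_s : injective s.
  move=> x y; rewrite !sA => /addIr /(congr1 (mulmx^~ A^T)).
  by rewrite -!mulmxA hA !mulmx1.
have n0 : #|` verts X|%:R != 0 :> R.
  rewrite pnatr_eq0 -lt0n cardfs_gt0; apply/fset0Pn.
  by have [v _] := vertex_exists; exists (val v); apply: valP.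
have sc : s center = center.
  have c0E : c0 = (#|` verts X|%:R)^-1 *: (#|` verts X|%:R *: c0).
    by rewrite scalerA mulVf // scale1r.
  rewrite sA /center -scalemxAl {1}c0E -scalerDr; congr (_ *: _).
  rewrite -[in RHS]Vs big_imfset /=; last by move=> ? ? _ _; apply: inj_s.
  under [RHS]eq_bigr do rewrite sA.
  rewrite big_split /= -mulmx_suml; congr (_ + _).
  by rewrite big_const_seq count_predT iter_addr_0 scaler_nat.
apply/funext => x; rewrite /lin -{2}sc !sA mulmxBl.
by rewrite addrA subrK.
Qed.

Lemma Gsym_lin g : g \in Gsym X -> exists A,
  [/\ orthogonal_mx A, symmetry X (lin A) & induces (lin A) g].
Proof.
rewrite inE => /asboolP[s Xs ig]; have [A hA e] := symmetry_lin Xs.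
by exists A; rewrite -e.
Qed.

Definition rel v : E3 := val v - center.

Definition acts g (F : E3 -> E3) := forall v, rel (g.1.1 v) = F (rel v).

Lemma acts_lin g A : induces (lin A) g -> acts g (fun x => x *m A).
Proof. by move=> [h _ _] v; rewrite /rel h /lin addrK. Qed.

Lemma acts_comp g h F H : acts g F -> acts h H -> acts (g * h)%g (H \o F).
Proof. by move=> hF hH v; rewrite /= permM hH hF. Qed.

Lemma rel_inj : injective rel.
Proof. by move=> v w /addIr/val_inj. Qed.

(** Edges and faces are sets built from vertices, and a symmetry acts on them through its action on
    points. *)
Lemma Gsym_trivial g : g \in Gsym X -> (forall v, g.1.1 v = v) -> g = 1%g.
Proof.
rewrite inE => /asboolP[s _ [h1 h2 h3]] gv.
have sv x : x \in verts X -> s x = x.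
  by move=> xV; rewrite -(h1 [` xV]%fset) gv.
have se (e : edges X) : image_edge s (val e) = val e.
  rewrite /image_edge -[RHS]imfset_id; apply: eq_in_imfset => // x xe.
  by apply: sv; apply: (edges_on_verts polyX (valP e)).
have sf (f : faces X) : image_face s (val f) = val f.
  rewrite /image_face -[RHS]imfset_id; apply: eq_in_imfset => // x xf.
  have xE := faces_on_edges polyX (valP f) xf.
  exact: (se [` xE]%fset).
case: g h1 h2 h3 gv => [[g1 g2] g3] /= h1 h2 h3 gv.
congr (_, _, _); apply/permP => x; rewrite perm1.
- exact: gv.
- by apply: val_inj; apply: etrans (h2 x) (se x).
- by apply: val_inj; apply: etrans (h3 x) (sf x).
Qed.

Lemma Gsym_acts_id g : g \in Gsym X -> acts g id -> g = 1%g.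
Proof. by move=> gG h; apply: Gsym_trivial => // v; apply/rel_inj/h. Qed.

(** * The two edge orbits *)

Definition edge_length e n :=
  exists u w : E3, val e = [fset u; w]%fset /\ hull_distance (verts X) u w n.

Lemma edge_length_uniq e n m : edge_length e n -> edge_length e m -> n = m.
Proof.
move=> [u [w [eE h]]] [u' [w' [eE' h']]].
have [[eu ew]|[eu ew]] := fset2_eq (etrans (esym eE) eE'); subst u w.
  exact: hull_distance_uniq h h'.
exact: hull_distance_uniq h (hull_distance_sym h').
Qed.

Lemma edge_length_image A e e' n : orthogonal_mx A ->
  [fset lin A x | x in verts X]%fset = verts X ->
  image_edge (lin A) (val e) = val e' -> edge_length e n -> edge_length e' n.
Proof.
move=> hA hV he [u [w [eE h]]]; exists (lin A u), (lin A w); split.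
  rewrite -he eE /image_edge; apply/fsetP => z; rewrite !inE.
  apply/imfsetP/orP => /= [[x + ->]|[]/eqP ->].
  - by rewrite !inE => /orP[]/eqP ->; rewrite eqxx; [left|right].
  - by exists u; rewrite // !inE eqxx.
  - by exists w; rewrite // !inE eqxx orbT.
have := hull_distance_simil (center - center *m A) ltr01 hA h.
have hV' : [fset simil 1 A (center - center *m A) x | x in verts X]%fset = verts X.
  by rewrite -[RHS]hV; apply: eq_imfset => // x; rewrite linE.
by rewrite hV' -!linE.
Qed.

Lemma edge_length_equiv e e' n : edge_equiv e e' -> edge_length e n -> edge_length e' n.
Proof.
move=> [g gG <-]; have [A [hA [_ XA] [_ h2 _]]] := Gsym_lin gG.
by apply: edge_length_image hA _ _; [rewrite -[in RHS]XA|rewrite h2].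
Qed.

Lemma edge_lengths_differ : exists e e' n n',
  [/\ edge_length e n, edge_length e' n' & n <> n'].
Proof.
have [u [w [u' [w' [n [n' [E1 E2 d1 d2 nn]]]]]]] := hlen.
exists [` E1]%fset, [` E2]%fset, n, n'; split=> //; first by exists u, w.
by exists u', w'.
Qed.

Definition corner_at v e e1 f := [/\ e1 != e, lies v e f & lies v e1 f].

Lemma corner_exists v e f : lies v e f -> exists e1, corner_at v e e1 f.
Proof. by move=> [h1 h2]; have [e1 [? ? ? _]] := corner hM h1 h2; exists e1. Qed.

Lemma corner_uniq v e e1 e2 f : corner_at v e e1 f -> corner_at v e e2 f -> e1 = e2.
Proof.
move=> [n [h1 h2] [h3 h4]] [n' _ [h5 h6]]; have [t [_ _ _ ht]] := corner hM h1 h2.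
case: (ht _ h3 h4) => e3; first by rewrite e3 eqxx in n.
by case: (ht _ h5 h6) => e4; [rewrite e4 eqxx in n'|rewrite e3 e4].
Qed.

Lemma corner_Gamma v e e1 f g : g \in Gamma M -> corner_at v e e1 f ->
  corner_at (g.1.1 v) (g.1.2 e) (g.1.2 e1) (g.2 f).
Proof.
move=> gG [n [h1 h2] [h3 h4]]; have [i1 i2'] := Gamma_inc gG.
by rewrite /corner_at /lies !i1 !i2' (inj_eq perm_inj).
Qed.

(* If adjacent edges were equivalent at one corner, they would be at all. *)
Lemma corner_not_equiv v e e1 f : corner_at v e e1 f -> ~ edge_equiv e e1.
Proof.
move=> c [g gG ge]; have [_ [h1 h2] _] := c.
have all_e e' : edge_equiv e e'.
  move: e'; apply: (edge_connected hM (e0 := e)).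
    by exists 1%g; rewrite ?group1 //= perm1.
  move=> w f' e' e'' we' we'' f'e' f'e'' he'.
  have [<-//|ne] := eqVneq e' e''.
  have [h [hG hv he hf]] := flag_map (conj h1 h2) (conj we' f'e').
  apply: edge_equiv_trans he' _; exists (g ^ h)%g.
    by rewrite memJ_norm // (fintype.subsetP (normal_norm (index2_normal GG i2))).
  have -> : e'' = h.1.2 e1.
    apply: (@corner_uniq w e' _ _ f'); first by split; rewrite 1?eq_sym.
    by rewrite -hv -he -hf; apply: corner_Gamma.
  by rewrite /= !permM -he permK ge.
have [e' [e'' [n [n' [d1 d2 nn]]]]] := edge_lengths_differ.
apply: nn; apply: edge_length_uniq d2; apply: edge_length_equiv d1.
by apply: edge_equiv_trans (all_e _); apply: edge_equiv_sym.
Qed.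

Lemma edge_flag e : exists v f, lies v e f.
Proof.
have [v hv] := edge_has_vertex hM e; have [f hf] := edge_has_face hM e.
by exists v, f.
Qed.

(* Otherwise [g] times an automorphism fixing all but the edge of a flag would
   be a symmetry carrying an edge to an adjacent one. *)
Lemma edge_stabilizer g e : g \in Gamma M -> g.1.2 e = e -> g \in Gsym X.
Proof.
move=> gG ge; apply/negPn/negP => gN.
have [v [f vef]] := edge_flag e; have [e1 c] := corner_exists vef.
have [_ _ ve1f] := c; have [r [rG rv re rf]] := flag_map vef ve1f.
have rN : r \notin Gsym X.
  by apply/negP => rG'; apply: (corner_not_equiv c); exists r.
apply: (corner_not_equiv c); apply: edge_equiv_sym; exists (r^-1 * g)%g.
  by apply: (index2_mul GG i2); rewrite ?groupV.
by rewrite /= permM -re permK.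
Qed.

(** Let [r] carry [e] to [e1] and [g] carry [e] to [e']. The former is not a symmetry; if the latter
    is not one either, [r^-1 * g] is, and it carries [e1] to [e']. *)
Lemma edge_two_orbits v e e1 f e' : corner_at v e e1 f -> edge_equiv e e' \/ edge_equiv e1 e'.
Proof.
move=> c; have [_ vef ve1f] := c; have [v' [f' hf']] := edge_flag e'.
have [r [rG rv re rf]] := flag_map vef ve1f.
have [g [gG gv ge gf]] := flag_map vef hf'.
have [gH|gN] := boolP (g \in Gsym X); first by left; exists g.
have rN : r \notin Gsym X.
  by apply/negP => rG'; apply: (corner_not_equiv c); exists r.
right; exists (r^-1 * g)%g; first by apply: (index2_mul GG i2); rewrite ?groupV.
by rewrite /= permM -re permK.
Qed.

(** The isometry need only preserve the vertices, not the polyhedron, because edge lengths depend on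
    the vertices alone; and [e], [e1] represent all edges up to symmetry. *)
Lemma corner_not_congruent v e e1 f A : corner_at v e e1 f -> orthogonal_mx A ->
  [fset lin A x | x in verts X]%fset = verts X -> image_edge (lin A) (val e) <> val e1.
Proof.
move=> c hA hV he1; have [_ vef _] := c.
have len a b n : edge_equiv a b -> edge_length b n -> edge_length a n.
  by move=> /edge_equiv_sym; apply: edge_length_equiv.
have e01 n : edge_length e n -> edge_length e1 n by apply: edge_length_image he1.
have [e' [e'' [n [n' [d1 d2 nn]]]]] := edge_lengths_differ.
case: (edge_two_orbits e' c) => /len/(_ d1) l1; case: (edge_two_orbits e'' c) => /len/(_ d2) l2.
- exact: nn (edge_length_uniq l1 l2).
- exact: nn (edge_length_uniq (e01 _ l1) l2).
- exact: nn (edge_length_uniq l1 (e01 _ l2)).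
- exact: nn (edge_length_uniq l1 l2).
Qed.

(** * Reflections attached to an edge *)

(** The automorphism reversing [e] within the face [f]; as it stabilizes [e], it is a symmetry. *)
Lemma turn_exists v e f w : lies v e f -> w != v -> inVE w e ->
  exists2 a, a \in Gsym X & [/\ a.1.1 v = w, a.1.1 w = v, a.1.2 e = e & a.2 f = f].
Proof.
move=> hf wv we; have [a [aG av ae af]] := flag_map hf (conj we (proj2 hf)).
exists a; first exact: edge_stabilizer ae.
split=> //; have [h _] := Gamma_inc aG.
have [t [_ _ ht]] := other_end hM (proj1 hf).
have ewt : w = t by case: (ht w we) => // e0; rewrite e0 eqxx in wv.
have hw : inVE (a.1.1 w) e by rewrite -ae h.
case: (ht _ hw) => // e0; rewrite -ewt -{2}av in e0.
by move/perm_inj: e0 => e0; rewrite e0 eqxx in wv.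
Qed.

Lemma flip_exists v e f : lies v e f ->
  exists2 b, b \in Gsym X & [/\ b.1.2 e = e, b.2 f != f, inEF e (b.2 f) & forall w, inVE w e -> b.1.1 w = w].
Proof.
move=> hf; have [f' [f'f ef' _]] := other_side hM (proj2 hf).
have [b [bG bv be bf]] := flag_map hf (conj (proj1 hf) ef').
exists b; first exact: edge_stabilizer be.
split=> //; rewrite ?bf //; have [h _] := Gamma_inc bG.
have [t [tv te ht]] := other_end hM (proj1 hf).
move=> w /ht[->//|->].
have hw : inVE (b.1.1 t) e by rewrite -be h.
by case: (ht _ hw) => // e0; rewrite -bv in e0; move/perm_inj: e0 => e0; rewrite e0 eqxx in tv.
Qed.

Lemma degree_neq2 v : degree v <> 2%N.
Proof. by move=> d; have := degree_ge3 polyX v; rewrite d. Qed.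

(** A turn moves [v], whereas every symmetry fixes the centre. *)
Lemma rel_neq0 v : rel v != 0.
Proof.
have hv : (0 < degree v)%N by apply: leq_trans (degree_ge3 polyX v).
move: hv; rewrite /degree => /card_gt0P[e]; rewrite inE => ve.
have [f ef] := edge_has_face hM e; have [w [wv we _]] := other_end hM ve.
have [a aG [av aw _ _]] := turn_exists (conj ve ef) wv we.
have [A [hA _ /acts_lin act_a]] := Gsym_lin aG.
apply: contra_neq wv => v0; apply: rel_inj.
by rewrite v0 -av act_a v0 mul0mx.
Qed.

(** The turn equalizes the norms, so dependent ends would be antipodal. The flip of an adjacent edge
    [e1] fixes [v], hence also its antipode [w], hence [e]; then [e] and [e1] have both faces in
    common, which forces degree 2. *)
Lemma edge_rel_indep v e f w : lies v e f -> w != v -> inVE w e ->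
  dot (rel v) (rel v) = dot (rel w) (rel w) /\ cross (rel v) (rel w) != 0.
Proof.
move=> hf wv we; have [a aG [av aw _ _]] := turn_exists hf wv we.
have [A [hA _ /acts_lin act_a]] := Gsym_lin aG.
have nvw : dot (rel v) (rel v) = dot (rel w) (rel w).
  by rewrite -av act_a dot_orth.
split=> //; apply/eqP => c0; have [k ek] := cross0 (rel_neq0 v) c0.
have /eqP : (k * k - 1) * dot (rel v) (rel v) = 0.
  by rewrite mulrBl mul1r {2}nvw ek dotZl dotZr; ring.
rewrite mulf_eq0 (gt_eqF (dot_gt0 (rel_neq0 v))) orbF subr_eq0 -expr2 sqrf_eq1.
case/orP => /eqP k1; rewrite k1 ?scale1r ?scaleN1r in ek.
  by move/rel_inj: ek => ek; rewrite ek eqxx in wv.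
have [e1 [n [ve ef] [ve1 e1f]]] := corner_exists hf.
have [d dG [de df e1df dv]] := flip_exists (conj ve1 e1f).
have [D [hD _ /acts_lin act_d]] := Gsym_lin dG.
have dw : d.1.1 w = w.
  by apply: rel_inj; rewrite act_d ek mulNmx -act_d dv.
have [h1 h2] := Gamma_inc (fintype.subsetP GG _ dG).
have ede : d.1.2 e = e.
  apply: (@edge_ext v w) => //; rewrite 1?eq_sym //.
    by rewrite -(dv v ve1) h1.
  by rewrite -dw h1.
have edf : inEF e (d.2 f) by rewrite -ede h2.
apply: (@degree_neq2 v); apply: (shared_sides hM ve ve1 _ _ ef e1f edf e1df); by rewrite eq_sym.
Qed.

(** The plane through the centre and the edge is fixed pointwise, and the flip is not the identity
    because it moves [f]. *)
Lemma flip_acts b v w e f : b \in Gsym X -> lies v e f -> w != v -> inVE w e ->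
  b.1.1 v = v -> b.1.1 w = w -> b.2 f != f -> acts b (refl (cross (rel v) (rel w))).
Proof.
move=> bG hf wv we bv bw bf; have [_ n0] := edge_rel_indep hf wv we.
have [A [hA _ /acts_lin act_b]] := Gsym_lin bG.
have [||h|h] := fix_plane hA n0; rewrite -?act_b ?bv ?bw //.
  have b1 : b = 1%g by apply: Gsym_acts_id => // u; rewrite act_b h.
  by case/eqP: bf; rewrite b1 perm1.
by move=> u; rewrite act_b h.
Qed.

Lemma turn_acts a v w e f : a \in Gsym X -> lies v e f -> w != v -> inVE w e ->
  a.1.1 v = w -> a.1.1 w = v ->
  acts a (refl (rel v - rel w)) \/
  acts a (refl (rel v - rel w) \o refl (cross (rel v) (rel w))).
Proof.
move=> aG hf wv we av aw; have [vw n0] := edge_rel_indep hf wv we.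
have [A [hA _ /acts_lin act_a]] := Gsym_lin aG.
have [||h|h] := swap_plane hA n0 vw; rewrite -?act_a ?av ?aw //.
  by left=> u; rewrite act_a h.
by right=> u; rewrite act_a h.
Qed.

(** For [false] a plane reflection; for [true], with [p] and [q] of equal norm, the half-turn about
    the axis through the origin and the midpoint of [p] and [q]. *)
Definition turn_kind (x : bool) (p q : E3) : E3 -> E3 :=
  if x then refl (p - q) \o refl (cross p q) else refl (p - q).

(* The flag (v, e, f), the adjacent edge e1, and the symmetries a, c reversing
   e, e1 and b, d fixing them; an automorphism fixing v and f and exchanging e
   and e1 conjugates a, b into c, d. *)
Record flag_frame v w w1 f (e e1 : edge M) (a b c d : cell_perm M) (x y : bool) : Prop := FlagFrame {
  ff_e : val e = [fset val v; val w]%fset;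
  ff_e1 : val e1 = [fset val v; val w1]%fset;
  ff_corner : corner_at v e e1 f;
  ff_G : [/\ a \in Gsym X, b \in Gsym X, c \in Gsym X & d \in Gsym X];
  ff_f : a.2 f = f /\ c.2 f = f;
  ff_a : acts a (turn_kind x (rel v) (rel w));
  ff_b : acts b (refl (cross (rel v) (rel w)));
  ff_c : acts c (turn_kind y (rel v) (rel w1));
  ff_d : acts d (refl (cross (rel v) (rel w1)));
  ff_norm : dot (rel v) (rel v) = dot (rel w) (rel w) /\ dot (rel v) (rel v) = dot (rel w1) (rel w1);
  ff_indep : [/\ cross (rel v) (rel w) != 0, cross (rel v) (rel w1) != 0 &
     cross (cross (rel v) (rel w)) (cross (rel v) (rel w1)) != 0];
  ff_swap : forall n, ((a * d) ^+ n = 1 <-> (c * b) ^+ n = 1)%g /\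
                      ((a * b * d) ^+ n = 1 <-> (c * d * b) ^+ n = 1)%g }.

(** [c] and [d] are the conjugates of [a] and [b] by an automorphism [r] exchanging [e] and [e1];
    they are symmetries because a subgroup of index 2 is normal. *)
Lemma flag_frame_exists v : exists w w1 f e e1 a b c d x y, flag_frame v w w1 f e e1 a b c d x y.
Proof.
have hv : (0 < degree v)%N by apply: leq_trans (degree_ge3 polyX v).
move: hv; rewrite /degree => /card_gt0P[e]; rewrite inE => ve.
have [f ef] := edge_has_face hM e; have hf : lies v e f by [].
have [w [wv we _]] := other_end hM ve.
have [e1 c1] := corner_exists hf; have [n _ hf1] := c1; have [ve1 e1f] := hf1.
have [w1 [w1v w1e _]] := other_end hM ve1.
have [a aG [av aw ae af]] := turn_exists hf wv we.
have [b bG [be bf ebf bv]] := flip_exists hf.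
have [r [rG rv re rf]] := flag_map hf hf1.
have nG : r \in 'N(Gsym X)%g by apply: (fintype.subsetP (normal_norm (index2_normal GG i2))).
have cG : (a ^ r)%g \in Gsym X by rewrite memJ_norm.
have dG : (b ^ r)%g \in Gsym X by rewrite memJ_norm.
have vr : (r^-1)%g.1.1 v = v by rewrite -{1}rv /= permK.
have er : (r^-1)%g.1.2 e1 = e by rewrite -re /= permK.
have fr : (r^-1)%g.2 f = f by rewrite -{1}rf /= permK.
have [r1 r2] := Gamma_inc rG.
have rw : r.1.1 w = w1.
  have hw : inVE (r.1.1 w) e1 by rewrite -re r1.
  have [t [_ _ ht]] := other_end hM ve1.
  have ewt : w1 = t by case: (ht w1 w1e) => // e0; rewrite e0 eqxx in w1v.
  case: (ht _ hw) => [e0|->//]; rewrite -rv in e0.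
  by move/perm_inj: e0 => e0; rewrite e0 eqxx in wv.
have wr : (r^-1)%g.1.1 w1 = w by rewrite -rw /= permK.
have Jv g u : (g ^ r)%g.1.1 u = r.1.1 (g.1.1 ((r^-1)%g.1.1 u)) by rewrite /= !permM.
have Jf g f0 : (g ^ r)%g.2 f0 = r.2 (g.2 ((r^-1)%g.2 f0)) by rewrite /= !permM.
have cv : (a ^ r)%g.1.1 v = w1 by rewrite Jv vr av rw.
have cw1 : (a ^ r)%g.1.1 w1 = v by rewrite Jv wr aw rv.
have cf : (a ^ r)%g.2 f = f by rewrite Jf fr af rf.
have dv : (b ^ r)%g.1.1 v = v by rewrite Jv vr bv // rv.
have dw1 : (b ^ r)%g.1.1 w1 = w1 by rewrite Jv wr bv // rw.
have df : (b ^ r)%g.2 f != f by rewrite Jf fr -{2}rf (inj_eq perm_inj).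
have [x act_a] : exists x, acts a (turn_kind x (rel v) (rel w)).
  by case: (turn_acts aG hf wv we av aw); [exists false|exists true].
have [y act_c] : exists y, acts (a ^ r)%g (turn_kind y (rel v) (rel w1)).
  by case: (turn_acts cG hf1 w1v w1e cv cw1); [exists false|exists true].
have act_b := flip_acts bG hf wv we (bv v ve) (bv w we) bf.
have act_d := flip_acts dG hf1 w1v w1e dv dw1 df.
have [nw n0] := edge_rel_indep hf wv we; have [nw1 n10] := edge_rel_indep hf1 w1v w1e.
(* Parallel normals would put [w1] on the mirror of the flip [b]. Then [b] would fix [e1], which
   would have both faces in common with [e]. *)
have nn : cross (cross (rel v) (rel w)) (cross (rel v) (rel w1)) != 0.
  apply/eqP => c0; have [k ek] := cross0 n0 c0.
  have k0 : k != 0 by apply: contra_neq n10 => k0; rewrite ek k0 scale0r.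
  have bw1 : b.1.1 w1 = w1.
    apply: rel_inj; rewrite act_b -(reflZ _ _ k0) -ek refl_perp // ?dot_crossr //.
  have [h1 h2] := Gamma_inc (fintype.subsetP GG _ bG).
  have be1 : b.1.2 e1 = e1.
    apply: (@edge_ext v w1) => //; rewrite 1?eq_sym //.
      by rewrite -(bv v ve) h1.
    by rewrite -bw1 h1.
  have e1bf : inEF e1 (b.2 f) by rewrite -be1 h2.
  apply: (@degree_neq2 v); apply: (shared_sides hM ve ve1 _ _ ef e1f ebf e1bf); by rewrite eq_sym.
have re1 : r.1.2 e1 = e.
  have := corner_Gamma rG c1; rewrite rv re rf => c2.
  have c3 : corner_at v e1 e f by split; rewrite // eq_sym.
  exact: corner_uniq c2 c3.
(* [r] is not a symmetry, but its square fixes [e] and therefore is one; it fixes [v], [w] and [w1],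
   which span space. So conjugation by [r] exchanges the two pairs of symmetries. *)
have rr : (r * r)%g = 1%g.
  have rrG : (r * r)%g \in Gsym X.
    by apply: (@edge_stabilizer _ e); [rewrite groupM|rewrite /= permM re].
  have [A [hA _ /acts_lin act_r]] := Gsym_lin rrG.
  have rrE u : (r * r)%g.1.1 u = r.1.1 (r.1.1 u) by rewrite /= permM.
  have rrv : (r * r)%g.1.1 v = v by rewrite rrE rv rv.
  have rrw u e0 : inVE u e0 -> u != v -> inVE v e0 -> r.1.2 (r.1.2 e0) = e0 -> (r * r)%g.1.1 u = u.
    move=> ue0 uv ve0 re0; have hu : inVE ((r * r)%g.1.1 u) e0 by rewrite rrE -re0 !r1.
    have [t [_ _ ht]] := other_end hM ve0.
    have eut : u = t by case: (ht u ue0) => // e'; rewrite e' eqxx in uv.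
    case: (ht _ hu) => [e'|->//]; rewrite -rrv in e'.
    by move/perm_inj: e' => e'; rewrite e' eqxx in uv.
  have rrw' : (r * r)%g.1.1 w = w by apply: (rrw w e); rewrite // re re1.
  have rrw1 : (r * r)%g.1.1 w1 = w1 by apply: (rrw w1 e1); rewrite // re1 re.
  have [||h|h] := fix_plane hA n0; rewrite -?act_r ?rrv ?rrw' //.
    by apply: Gsym_acts_id => // u; rewrite act_r h.
  have := act_r w1; rewrite rrw1 h => /esym e0.
  have d0 : dot (rel w1) (cross (rel v) (rel w)) = 0.
    have : dot (rel w1) (cross (rel v) (rel w)) = - dot (rel w1) (cross (rel v) (rel w)).
      by rewrite -{1}e0 dot_reflC refl_id dotNr.
    by move/eqP; rewrite -addr_eq0 -mulr2n mulrn_eq0 /= => /eqP.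
  have [k ek] := perp_cross n10 (etrans (dotC _ _) (dot_crossl (rel v) (rel w))) (etrans (dotC _ _) d0).
  by case/eqP: nn; rewrite ek crossZ_self.
have J2 g : ((g ^ r) ^ r)%g = g by rewrite -conjgM rr conjg1.
exists w, w1, f, e, e1, a, b, (a ^ r)%g, (b ^ r)%g, x, y; split=> //.
- by apply: edge_fset => //; rewrite eq_sym.
- by apply: edge_fset => //; rewrite eq_sym.
move=> m; have swap (g h : cell_perm M) : (g ^ r)%g = h -> (g ^+ m = 1 <-> h ^+ m = 1)%g.
  move=> <-; rewrite -conjXg; split=> [->|/(congr1 (conjg^~ (r^-1)%g))]; first exact: conj1g.
  by rewrite conjgK conj1g.
by split; apply: swap; [rewrite conjMg J2|rewrite (conjMg (a * b)%g) (conjMg a) J2].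
Qed.

(** * The reflection configuration *)

Definition config : {fset E3} := [fset x - center | x in verts X]%fset.

Lemma configP x : reflect (exists v, x = rel v) (x \in config).
Proof.
apply: (iffP (imfsetP _ _ _ _)) => /= [[y yV ->]|[v ->]]; first by exists [` yV]%fset.
by exists (val v) => //; apply: valP.
Qed.

Lemma acts_preserved g r : acts g (refl r) -> preserved_by config r.
Proof. by move=> h x /configP[v ->]; apply/configP; exists (g.1.1 v). Qed.

(** If the turn is a half-turn, composition with the flip leaves the reflection. *)
Lemma turn_refl v e f w : lies v e f -> w != v -> inVE w e ->
  exists2 g, g \in Gsym X & acts g (refl (rel v - rel w)).
Proof.
move=> hf wv we; have [a aG [av aw _ _]] := turn_exists hf wv we.
case: (turn_acts aG hf wv we av aw) => h; first by exists a.
have [b bG [be bf ebf bv]] := flip_exists hf.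
have hb := flip_acts bG hf wv we (bv v (proj1 hf)) (bv w we) bf.
exists (b * a)%g; rewrite ?groupM // => u.
by rewrite (acts_comp hb h) /= reflK.
Qed.

(** The positions of [v], [w], [w1] span space, the links are the edges with their reflections
    [turn_refl], and the two mirrors through [v] are those of the flips of [e] and [e1]. *)
Lemma config_reflection v : reflection_configuration config (rel v).
Proof.
have [w [w1 [f [e [e1 [a [b [c [d [x [y F]]]]]]]]]]] := flag_frame_exists v.
have [n0 n10 nn] := ff_indep F.
split.
- by apply/configP; exists v.
- move=> z hz; have h u : dot z (rel u) = 0 by apply: hz; apply/configP; exists u.
  have [k ek] := perp_cross n0 (h v) (h w).
  have [k0|k0] := eqVneq k 0; first by rewrite ek k0 scale0r.
  have d0 : dot (cross (rel v) (rel w)) (rel w1) = 0.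
    by have := h w1; rewrite ek dotZl => /eqP; rewrite mulf_eq0 (negPf k0) => /eqP.
  have [l el] := perp_cross n10 (etrans (dotC _ _) (dot_crossl (rel v) (rel w))) d0.
  by case/eqP: nn; rewrite el crossZ_self.
- move=> Q Qv hQ u /configP[u' ->].
  apply: (vertex_connected hM (S := fun u => Q (rel u)) Qv) => e0 t t' te te' Qt.
  have [<-//|tt] := eqVneq t t'.
  have [f0 ef0] := edge_has_face hM e0.
  have t't : t' != t by rewrite eq_sym.
  have [g gG hg] := turn_refl (conj te ef0) t't te'.
  apply: hQ Qt _ _; [by apply/configP; exists t|by apply/configP; exists t'|..].
    exact: acts_preserved hg.
  by have [] := edge_rel_indep (conj te ef0) t't te'.
exists (cross (rel v) (rel w)), (cross (rel v) (rel w1)); split=> //.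
- exact: dot_crossl.
- exact: dot_crossl.
- exact: acts_preserved (ff_b F).
- exact: acts_preserved (ff_d F).
Qed.

End Geometry.

Local Open Scope nat_scope.

(** * Tests on permutations of a finite set of points *)

Definition vzero := zint 0 0 0.

(* Permutations of the points of [l], as lists of indices; an index out of
   range marks a reflection which does not preserve [l]. *)
Definition refl_perm (l : seq zvec) (r : zvec) : seq nat :=
  [seq find (is_refl r x) l | x <- l].

Definition is_sym (l : seq zvec) (r : zvec) : bool :=
  (r != vzero) && all (fun i => i < size l) (refl_perm l r).

(** [q] acts first, opposite to the order of a product of permutations; hence [pcomp d a] for
    [a * d] below. *)
Definition pcomp (p q : seq nat) : seq nat := [seq nth 0 p i | i <- q].

(* Which of the third and fifth powers are trivial. *)
Definition power_signature (n : nat) (p : seq nat) : seq bool :=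
  [seq iter m (pcomp p) (iota 0 n) == iota 0 n | m <- [:: 3; 5]].

Definition point (l : seq zvec) (i : nat) : zvec := nth vzero l i.

(** Necessary for an edge: the reflection reversing it and the flip both preserve the vertices. *)
Definition admissible (l : seq zvec) (v w : zvec) : bool :=
  if is_sym l (vsub v w) then is_sym l (vcross v w) else false.

Definition neighbours (l : seq zvec) (v : zvec) : seq zvec :=
  [seq w <- l | admissible l v w].

Definition turn_perm (l : seq zvec) (x : bool) (v w : zvec) : seq nat :=
  let p := refl_perm l (vsub v w) in
  if x then pcomp p (refl_perm l (vcross v w)) else p.

(* An automorphism exchanging the edges [v, w] and [v, w1] conjugates the
   symmetries a, b of the one into the symmetries c, d of the other, so that ad
   and cb, and abd and cdb, have the same order; and no symmetry may exchange w
   and w1.  Nested conditionals are evaluated lazily, conjunctions are not. *)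
Definition consistent (l : seq zvec) (v w w1 : zvec) (x y : bool) : bool :=
  if vcross (vcross v w) (vcross v w1) == vzero then false else
  if (if vdot v w == vdot v w1 then is_sym l (vsub w w1) else false) then false else
  let n := size l in
  let a := turn_perm l x v w in let b := refl_perm l (vcross v w) in
  let c := turn_perm l y v w1 in let d := refl_perm l (vcross v w1) in
  (power_signature n (pcomp d a) == power_signature n (pcomp b c)) &&
  (power_signature n (pcomp d (pcomp b a)) == power_signature n (pcomp b (pcomp d c))).

Definition consistent_frames (l : seq zvec) (v : zvec) : seq (zvec * zvec * (bool * bool)) :=
  let nb := neighbours l v in
  [seq z <- [seq (u, x) | u <- [seq (w, w1) | w <- nb, w1 <- nb],
      x <- [seq (x, y) | x <- [:: false; true], y <- [:: false; true]]]
   | consistent l v z.1.1 z.1.2 z.2.1 z.2.2].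

Lemma mem_consistent_frames l v w w1 x y : w \in l -> w1 \in l ->
  admissible l v w -> admissible l v w1 -> consistent l v w w1 x y ->
  (w, w1, (x, y)) \in consistent_frames l v.
Proof.
move=> wl w1l aw aw1 h; rewrite mem_filter; apply/andP; split; first exact: h.
apply/allpairsPdep; exists (w, w1), (x, y); split=> //.
  by apply/allpairsPdep; exists w, w1; rewrite !mem_filter aw aw1.
by case: (x) (y) => -[].
Qed.

(** * Tables *)

(* Edges are pairs [(i, j)] with [i < j], faces sorted lists of edges. *)

Definition pair_edge (i j : nat) : nat * nat := if i < j then (i, j) else (j, i).

Definition edge_le (e e' : nat * nat) : bool :=
  (e.1 < e'.1) || ((e.1 == e'.1) && (e.2 <= e'.2)).

Definition edge_perm (p : seq nat) (e : nat * nat) : nat * nat :=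
  pair_edge (nth 0 p e.1) (nth 0 p e.2).

Definition face_perm (p : seq nat) (f : seq (nat * nat)) : seq (nat * nat) :=
  sort edge_le (map (edge_perm p) f).

Definition closure_step (T : eqType) (fs : seq (T -> T)) (l : seq T) : seq T :=
  undup (l ++ flatten [seq map g l | g <- fs]).

Definition closure (T : eqType) (n : nat) (fs : seq (T -> T)) (l : seq T) : seq T :=
  iter n (closure_step fs) l.

(** Only this soundness is used; the number of rounds need only be large enough for the memberships
    that are checked by computation. *)
Lemma closure_ind (T : eqType) n (fs : seq (T -> T)) (l : seq T) (Q : T -> Prop) :
  (forall x, x \in l -> Q x) ->
  (forall g, List.In g fs -> forall x, Q x -> Q (g x)) ->
  forall x, x \in closure n fs l -> Q x.
Proof.
move=> hl hfs; rewrite /closure; elim: n => [|n IH] x; first exact: hl.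
rewrite iterS mem_undup mem_cat => /orP[/IH //|].
elim: fs hfs (iter n _ l) IH => //= g fs IHfs hfs l' IH.
rewrite mem_cat => /orP[/mapP[y /IH Qy ->]|]; first by apply: hfs => //; left.
by apply: IHfs => // h hin; apply: hfs; right.
Qed.

(** These four reflections are symmetries whatever the kinds of the two turns, so they generate
    edges and faces of the polyhedron out of those at one corner. *)
Definition frame_gens (l : seq zvec) (v w w1 : zvec) : seq (seq nat) :=
  [:: refl_perm l (vsub v w); refl_perm l (vcross v w);
      refl_perm l (vsub v w1); refl_perm l (vcross v w1)].

Definition frame_edges (l : seq zvec) (v w w1 : zvec) : seq (nat * nat) :=
  [:: pair_edge (index v l) (index w l); pair_edge (index v l) (index w1 l)].

(* The face is traversed as ..., c e, e1, e, a e1, ... *)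
Definition frame_face (l : seq zvec) (v w w1 : zvec) (x y : bool) : seq (nat * nat) :=
  let a := edge_perm (turn_perm l x v w) in let c := edge_perm (turn_perm l y v w1) in
  let e := pair_edge (index v l) (index w l) in
  let e1 := pair_edge (index v l) (index w1 l) in
  sort edge_le [:: e; e1; a e1; c e; a (c e); c (a e1)].

Definition dodeca : seq zvec := Eval vm_compute in chamber_orbit dodecahedron.
Definition dodeca0 : zvec := zint 1 1 1.

Lemma dodecaE : chamber_orbit dodecahedron = dodeca.
Proof. vm_cast_no_check (erefl dodeca). Qed.

Definition base_w := point dodeca 1.
Definition base_w1 := point dodeca 15.

Definition dodeca_edges : seq (nat * nat) := Eval vm_compute in
  sort edge_le (closure 12 (map edge_perm (frame_gens dodeca dodeca0 base_w base_w1))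
    (frame_edges dodeca dodeca0 base_w base_w1)).

(* The planar faces for [false], the skew ones for [true]. *)
Definition dodeca_faces (x : bool) : seq (seq (nat * nat)) := Eval vm_compute in
  if x then
    closure 12 (map face_perm (frame_gens dodeca dodeca0 base_w base_w1))
      [:: frame_face dodeca dodeca0 base_w base_w1 true true]
  else
    closure 12 (map face_perm (frame_gens dodeca dodeca0 base_w base_w1))
      [:: frame_face dodeca dodeca0 base_w base_w1 false false].

Definition on_edge (i : nat) (e : nat * nat) : bool := (i == e.1) || (i == e.2).

(** Every edge is continued at both ends within [f]; the boundary of a face, a single cycle, cannot
    properly contain such a nonempty set. *)
Definition face_closed (f : seq (nat * nat)) : bool :=
  all (fun e => has (fun e' => on_edge e.1 e' && (e' != e)) f &&
                has (fun e' => on_edge e.2 e' && (e' != e)) f) f.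

(** What makes a frame conclusive: the two turns are of one kind [x], the face at the corner is in
    the table of kind [x], and the symmetries of the frame generate at least the tabulated edges and
    faces. *)
Definition frame_ok (z : zvec * zvec * (bool * bool)) : bool :=
  let: (w, w1, (x, y)) := z in
  let gens := frame_gens dodeca dodeca0 w w1 in
  let f := frame_face dodeca dodeca0 w w1 x y in
  let es := closure 8 (map edge_perm gens) (frame_edges dodeca dodeca0 w w1) in
  let fs := closure 8 (map face_perm gens) [:: f] in
  [&& x == y, f \in dodeca_faces x, all (fun e => e \in es) dodeca_edges &
   all (fun f' => f' \in fs) (dodeca_faces x)].

Definition tables_ok (x : bool) : bool :=
  [&& all face_closed (dodeca_faces x),
   all (all (fun e => (e.1 < e.2) && (e.2 < 20))) (dodeca_faces x),
   all (fun f => all (fun g : seq (nat * nat) => (f == g) || has (fun e => e \notin g) f)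
     (dodeca_faces x))
     (dodeca_faces x) &
   all (fun e => [&& e.1 < e.2, e.2 < 20 &
     count (fun f => e \in f) (dodeca_faces x) == 2]) dodeca_edges].

(** The bound on the edges from above, as [frame_ok] gives the one from below. *)
Definition admissible_pairs_ok : bool :=
  all (fun i => all (fun j => (i < j) ==>
      (admissible dodeca (point dodeca i) (point dodeca j) ==> ((i, j) \in dodeca_edges)))
    (iota 0 20)) (iota 0 20).

Lemma frames_excluded c : c \in chambers ->
  c = dodecahedron \/ consistent_frames (chamber_orbit c) c.1 = [::].
Proof.
have h : all (fun c => (c == dodecahedron) || (consistent_frames (chamber_orbit c) c.1 == [::]))
    chambers.
  vm_cast_no_check (erefl true).
by move=> cin; case/orP: (allP h c cin) => /eqP e; [left|right]; exact e.
Qed.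

Lemma frames_ok : all frame_ok (consistent_frames dodeca dodeca0).
Proof. vm_cast_no_check (erefl true). Qed.

Lemma all_tables_ok x : tables_ok x.
Proof. by case: x; vm_compute. Qed.

Lemma all_admissible_pairs_ok : admissible_pairs_ok.
Proof. vm_cast_no_check (erefl true). Qed.

Local Open Scope ring_scope.

(** * Figures drawn from tables *)

Section Figures.
Variable R : realType.
Local Notation E3 := 'rV[R]_3.

Lemma imfset_seqE (T U W : choiceType) (s : T -> U) (t : U -> W) (l : seq T) :
  [fset t y | y in [fset s x | x in l]]%fset = [fset t (s x) | x in l]%fset.
Proof.
apply/fsetP => z; apply/imfsetP/imfsetP => /= [[y /imfsetP[x /= xl ->] ->]|].
  by exists x.
by case=> x xl ->; exists (s x) => //; apply/imfsetP; exists x.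
Qed.

Definition segment (P : nat -> E3) (e : nat * nat) : {fset E3} := [fset P e.1; P e.2]%fset.

Definition polygon (P : nat -> E3) (f : seq (nat * nat)) : {fset {fset E3}} :=
  [fset segment P e | e in f]%fset.

Definition table_figure (P : nat -> E3) (F : seq (seq (nat * nat))) : figure R :=
  Figure [fset P i | i in iota 0 20]%fset [fset segment P e | e in dodeca_edges]%fset
         [fset polygon P f | f in F]%fset.

Lemma segment_pair P i j : segment P (pair_edge i j) = [fset P i; P j]%fset.
Proof. by rewrite /pair_edge; case: ifP => _ //=; rewrite /segment /= fsetUC. Qed.

Lemma image_segment s P e : image_edge s (segment P e) = segment (s \o P) e.
Proof.
apply/fsetP => z; rewrite /segment !inE; apply/imfsetP/orP => /= [[x + ->]|[]/eqP ->].
- by rewrite !inE => /orP[]/eqP ->; rewrite eqxx; [left|right].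
- by exists (P e.1); rewrite // !inE eqxx.
- by exists (P e.2); rewrite // !inE eqxx orbT.
Qed.

Lemma image_polygon s P f : image_face s (polygon P f) = polygon (s \o P) f.
Proof.
rewrite /image_face /polygon imfset_seqE; apply: eq_imfset => // e.
exact: image_segment.
Qed.

Lemma image_table s P F : image_figure s (table_figure P F) = table_figure (s \o P) F.
Proof.
rewrite /image_figure /table_figure /= !imfset_seqE; congr Figure.
  by apply: eq_imfset => // e; apply: image_segment.
by apply: eq_imfset => // f; apply: image_polygon.
Qed.

(** An orthogonal matrix commutes with the cross product only up to the sign of its determinant,
    which a reflection does not see. *)
Lemma refl_cross_orth (x y z : E3) (A : 'M[R]_3) : orthogonal_mx A ->
  refl (cross (x *m A) (y *m A)) z = refl (cross x y *m A) z.
Proof.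
move=> hA; have nn : dot (cross (x *m A) (y *m A)) (cross (x *m A) (y *m A)) = dot (cross x y) (cross x y).
  by rewrite !cross_norm !dot_orth.
have [c0|c0] := eqVneq (cross (x *m A) (y *m A)) 0.
  by rewrite c0 dot0l in nn; rewrite c0 (dot_eq0 (esym nn)) mul0mx.
have n0 : cross x y != 0.
  by apply: contra_neq c0 => c0; apply: dot_eq0; rewrite nn c0 dot0l.
have [||k ek] := @perp_cross _ (x *m A) (y *m A) (cross x y *m A) c0.
- by rewrite dot_orth // dotC dot_crossl.
- by rewrite dot_orth // dotC dot_crossr.
have k0 : k != 0.
  apply: contra_neq n0 => k0; apply: dot_eq0.
  by rewrite -(dot_orth _ _ hA) ek k0 scale0r dot0l.
by rewrite ek reflZ.
Qed.

Definition small (e : nat * nat) : bool := (e.1 < 20)%N && (e.2 < 20)%N.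

Lemma dodeca_faces_facts x f : f \in dodeca_faces x ->
  [/\ face_closed f, all small f & all (fun e => e.1 < e.2)%N f].
Proof.
have /and4P[/allP h1 /allP h2 _ _] := all_tables_ok x.
move=> fF; split; first exact: h1.
  apply: sub_all (h2 _ fF) => e /andP[h h']; rewrite /small h' andbT.
  exact: ltn_trans h h'.
by apply: sub_all (h2 _ fF) => e /andP[].
Qed.

Lemma polygonP (P : nat -> E3) f z : reflect (exists2 e, e \in f & z = segment P e) (z \in polygon P f).
Proof. exact: (iffP (imfsetP _ _ _ _)). Qed.

Section Injective.
Variable P : nat -> E3.
Hypothesis P_inj : forall i j, (i < 20)%N -> (j < 20)%N -> P i = P j -> i = j.

Lemma segment_inj e e' : small e -> small e' -> (e.1 < e.2)%N -> (e'.1 < e'.2)%N ->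
  segment P e = segment P e' -> e = e'.
Proof.
case: e e' => i j [i' j'] /andP[/= h1 h2] /andP[/= h3 h4] ij ij' /fset2_eq /= [[e1 e2]|[e1 e2]].
  by rewrite (P_inj h1 h3 e1) (P_inj h2 h4 e2).
have e3 := P_inj h1 h4 e1; have e4 := P_inj h2 h3 e2; subst i' j'.
by have := ltn_trans ij ij'; rewrite ltnn.
Qed.

Lemma mem_polygon x f e : f \in dodeca_faces x -> small e -> (e.1 < e.2)%N ->
  (segment P e \in polygon P f) = (e \in f).
Proof.
move=> fF se le; have [_ /allP sf /allP lf] := dodeca_faces_facts fF.
apply/polygonP/idP => [[e' e'f /segment_inj ->]|ef] //; [exact: sf|exact: lf|by exists e].
Qed.

Lemma polygon_inj x f g : f \in dodeca_faces x -> g \in dodeca_faces x ->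
  polygon P f = polygon P g -> f = g.
Proof.
move=> fF gF; have /and4P[_ _ /allP h _] := all_tables_ok x.
have /orP[/eqP //|/hasP[e ef eg]] := allP (h f fF) g gF.
have [_ /allP sf /allP lf] := dodeca_faces_facts fF.
move=> /fsetP/(_ (segment P e)).
by rewrite (mem_polygon fF) ?(mem_polygon gF) ?sf ?lf // ef (negPf eg).
Qed.

End Injective.

End Figures.

(** * Translation of symmetries into index permutations *)

Section Recognition.
Variables (R : realType) (X : figure R).
Local Notation E3 := 'rV[R]_3.
Hypothesis hX : regular_index2 X.
Hypothesis hlen : edges_of_different_lengths X.
Local Notation M := (map_of X).
Local Notation rel := (@rel R X).

Section Chamber.
Variables (v : vertex M) (L : seq zvec) (p0 : zvec) (k : R) (A : 'M[R]_3).

Definition place (p : zvec) : E3 := k *: (evv R p *m A).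

Hypotheses (k0 : 0 < k) (hA : orthogonal_mx A) (uL : uniq L) (v_place : rel v = place p0).
Hypothesis config_L : forall x, x \in config X <-> exists2 p, p \in L & x = place p.

Lemma place_inj : injective place.
Proof.
move=> p q /(congr1 (fun z => k^-1 *: z)); rewrite /place !scalerA mulVf ?gt_eqF // !scale1r.
move=> /(congr1 (mulmx^~ A^T)); rewrite -!mulmxA hA !mulmx1; exact: evv_inj.
Qed.

Lemma place_rel u : exists2 p, p \in L & rel u = place p.
Proof. by apply/config_L/configP; exists u. Qed.

Lemma rel_place p : p \in L -> exists u, rel u = place p.
Proof.
move=> pL; have : place p \in config X by apply/config_L; exists p.
by move=> /configP[u e]; exists u.
Qed.

(** [q] records, by indices, how [g] moves the placed points; the range condition keeps the default
    of [nth] out. *)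
Definition follows (g : cell_perm M) (q : seq nat) : Prop :=
  size q = size L /\ forall u i, (i < size L)%N -> rel u = place (point L i) ->
  (nth 0%N q i < size L)%N /\ rel (g.1.1 u) = place (point L (nth 0%N q i)).

Lemma refl_place r p : refl (evv R r *m A) (place p) = k *: (refl (evv R r) (evv R p) *m A).
Proof. by rewrite /place linearZ /= refl_orth. Qed.

Lemma follows_refl g r : r != vzero -> acts g (refl (evv R r *m A)) ->
  is_sym L r /\ follows g (refl_perm L r).
Proof.
move=> r0 hg; have key p : p \in L -> exists2 q, q \in L & is_refl r p q.
  move=> pL; have [u eu] := rel_place pL; have [q qL eq_] := place_rel (g.1.1 u).
  exists q => //; apply/(is_reflP R _ _ r0).
  move: eq_; rewrite hg eu refl_place /place => /(congr1 (fun z => k^-1 *: z)).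
  rewrite !scalerA mulVf ?gt_eqF // !scale1r => /(congr1 (mulmx^~ A^T)).
  by rewrite -!mulmxA hA !mulmx1.
split.
  rewrite /is_sym r0 /=; apply/allP => i /mapP[p pL ->]; rewrite -has_find.
  by have [q qL hq] := key p pL; apply/hasP; exists q.
split; first by rewrite size_map.
move=> u i hi eu; rewrite (nth_map vzero) //.
have pL : point L i \in L by apply: mem_nth.
have hf : has (is_refl r (point L i)) L.
  by have [q qL hq] := key _ pL; apply/hasP; exists q.
split; first by rewrite -has_find.
have /(is_reflP R _ _ r0) e := nth_find vzero hf.
by rewrite hg eu refl_place e.
Qed.

Lemma follows_comp g h p q : follows g p -> follows h q -> follows (g * h)%g (pcomp q p).
Proof.
move=> [sp hp] [sq hq]; split; first by rewrite size_map.
move=> u i hi eu; have [h1 h2] := hp u i hi eu; have [h3 h4] := hq _ _ h1 h2.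
by rewrite /pcomp (nth_map 0%N) ?sp //= permM h4.
Qed.

Lemma follows_id g q : g \in Gsym X -> follows g q -> (g = 1%g <-> q = iota 0 (size L)).
Proof.
move=> gG [sq hq]; split=> [g1|qE].
  apply: (@eq_from_nth _ 0%N); rewrite ?size_iota // => i; rewrite sq => hi.
  rewrite nth_iota // add0n.
  have [u eu] := rel_place (mem_nth vzero hi).
  have [h1 h2] := hq u i hi eu; move: h2; rewrite g1 perm1 eu => /place_inj e.
  by apply/eqP; rewrite -(nth_uniq vzero h1 hi uL) -/(point _ _) -e.
apply: (Gsym_trivial hX gG) => u; apply: rel_inj.
have [p pL eu] := place_rel u; have hi : (index p L < size L)%N by rewrite index_mem.
have [|_ ->] := hq u (index p L) hi; first by rewrite /point nth_index.
by rewrite qE nth_iota // add0n /point nth_index.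
Qed.

Lemma follows_expg g q n : follows g q -> follows (g ^+ n)%g (iter n (pcomp q) (iota 0 (size L))).
Proof.
move=> hq; elim: n => [|n IH].
  split; first by rewrite size_iota.
  by move=> u i hi eu; rewrite nth_iota // add0n expg0 perm1.
by rewrite iterS expgSr; apply: follows_comp.
Qed.

(** A symmetry that fixes all vertices is trivial, so the triviality of a power can be read off the
    permutation. *)
Lemma follows_signature g h p q : g \in Gsym X -> h \in Gsym X -> follows g p -> follows h q ->
  (forall n, (g ^+ n = 1)%g <-> (h ^+ n = 1)%g) ->
  power_signature (size L) p = power_signature (size L) q.
Proof.
move=> gG hG hp hq e; rewrite /power_signature; apply: eq_map => n.
apply/eqP/eqP => e1.
  apply/(follows_id (groupX n hG) (follows_expg n hq)); apply/e.
  by apply/(follows_id (groupX n gG) (follows_expg n hp)).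
apply/(follows_id (groupX n gG) (follows_expg n hp)); apply/e.
by apply/(follows_id (groupX n hG) (follows_expg n hq)).
Qed.

Lemma place_sub p q : place p - place q = k *: (evv R (vsub p q) *m A).
Proof. by rewrite /place -scalerBr -mulmxBl -evv_sub. Qed.

Lemma refl_cross_place p q z :
  refl (cross (place p) (place q)) z = refl (evv R (vcross p q) *m A) z.
Proof.
rewrite -cross_evv -(refl_cross_orth _ _ _ hA) -[RHS](@reflZ _ (k * k)) ?mulf_neq0 ?gt_eqF //.
by congr (refl _ z); apply: row3P; rewrite !mxE /=; ring.
Qed.

Lemma refl_sub_place p q z : refl (place p - place q) z = refl (evv R (vsub p q) *m A) z.
Proof. by rewrite place_sub reflZ ?gt_eqF. Qed.

Lemma cross_place p q : cross (place p) (place q) != 0 -> vcross p q != vzero.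
Proof.
apply: contra_neq => e; rewrite /place -[cross _ _]/(cross _ _).
have e0 : cross (evv R p) (evv R q) = 0.
  by rewrite cross_evv e; apply: row3P; rewrite !mxE /ev /= mul0r addr0.
apply: dot_eq0; rewrite cross_norm !dotZl !dotZr !dot_orth //.
have := congr1 (fun z => dot z z) e0; rewrite cross_norm dot0l => h.
by rewrite -[RHS](mulr0 (k ^+ 4)) -h; ring.
Qed.

Hypothesis p0L : p0 \in L.

Lemma vsub_neq0 p q : p != q -> vsub p q != vzero.
Proof.
apply: contra_neq => e; apply: (@evv_inj R); apply/eqP; rewrite -subr_eq0 -evv_sub e.
by apply/eqP/row3P; rewrite !mxE /ev /= mul0r addr0.
Qed.

Lemma follows_turn_refl u e f w p q : lies u e f -> w != u -> inVE w e ->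
  rel u = place p -> rel w = place q ->
  is_sym L (vsub p q) /\ exists2 g, g \in Gsym X & follows g (refl_perm L (vsub p q)) /\
    acts g (refl (rel u - rel w)).
Proof.
move=> hf wu we eu ew; have [g gG hg] := turn_refl hX hlen hf wu we.
have pq : p != q by apply: contra_neq wu => pq; apply: rel_inj; rewrite eu ew pq.
have [|h1 h2] := @follows_refl g (vsub p q) (vsub_neq0 pq).
  by move=> t; rewrite hg eu ew refl_sub_place.
by split=> //; exists g.
Qed.

Lemma follows_flip u e f w p q : lies u e f -> w != u -> inVE w e ->
  rel u = place p -> rel w = place q -> vcross p q != vzero /\ is_sym L (vcross p q).
Proof.
move=> hf wu we eu ew; have [b bG [be bf ebf bv]] := flip_exists hX hlen hf.
have hb := flip_acts hX hlen bG hf wu we (bv u (proj1 hf)) (bv w we) bf.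
have [_ n0] := edge_rel_indep hX hlen hf wu we.
have pq : vcross p q != vzero by apply: cross_place; rewrite -eu -ew.
have [|h1 h2] := @follows_refl b (vcross p q) pq; last by [].
by move=> t; rewrite hb eu ew refl_cross_place.
Qed.

Lemma edge_admissible u e w p q : inVE u e -> inVE w e -> w != u ->
  rel u = place p -> rel w = place q -> admissible L p q.
Proof.
move=> ue we wu eu ew; have [f ef] := edge_has_face (polyhedron_map (let: And3 h _ _ := hX in h)) e.
have [s1 _] := follows_turn_refl (conj ue ef) wu we eu ew.
have [_ s2] := follows_flip (conj ue ef) wu we eu ew.
by rewrite /admissible s1 s2.
Qed.

Lemma follows_ext (g h : cell_perm M) q : (forall u, g.1.1 u = h.1.1 u) -> follows g q -> follows h q.
Proof. by move=> e [s hq]; split=> // u i hi eu; rewrite -e; apply: hq. Qed.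

Lemma refl_mx r : exists2 B, orthogonal_mx B & forall x : E3, x *m B = refl r x.
Proof.
exists (lin1_mx (refl r)); last by move=> x; rewrite mul_rV_lin1.
apply/matrixP => i j; rewrite !mxE.
have -> : \sum_l lin1_mx (refl r) i l * (lin1_mx (refl r))^T l j =
    dot (refl r (delta_mx 0 i)) (refl r (delta_mx 0 j)).
  by apply: eq_bigr => l _; rewrite !mxE.
rewrite dot_refl /dot (bigD1 i) //= big1 => [|l li]; last by rewrite !mxE (negPf li) andbF mul0r.
by rewrite !mxE !eqxx mul1r addr0 eq_sym.
Qed.

(** The reflection in [q - q1] would preserve the vertices, fix [u] and exchange [w] with [w1],
    which makes the two edges of the corner congruent. *)
Lemma sym_not_congruent u e e1 f w w1 q q1 : corner_at u e e1 f ->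
  val e = [fset val u; val w]%fset -> val e1 = [fset val u; val w1]%fset ->
  dot (rel u) (rel u) = dot (rel w) (rel w) -> dot (rel u) (rel u) = dot (rel w1) (rel w1) ->
  rel w = place q -> rel w1 = place q1 ->
  dot (rel u) (rel w) = dot (rel u) (rel w1) -> is_sym L (vsub q q1) -> False.
Proof.
move=> c eE e1E n n1 ew ew1 d /andP[r0 /allP sy].
have [B hB BE] := refl_mx (rel w - rel w1).
have img x : x \in verts X -> lin X B x \in verts X.
  move=> xV; have [p pL ep] := place_rel [` xV]%fset.
  have /sy : find (is_refl (vsub q q1) p) L \in refl_perm L (vsub q q1) by apply/mapP; exists p.
  rewrite -has_find => /hasP[p' p'L] /(is_reflP R _ _ r0) e'.
  have [u' eu'] := rel_place p'L.
  suff -> : lin X B x = val u' by apply: valP.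
  rewrite /lin BE -[x - _]/(rel [` xV]%fset) ep ew ew1 refl_sub_place // refl_place // e'.
  by rewrite -[k *: _]/(place p') -eu' /rel subrK.
have invol x : lin X B (lin X B x) = x by rewrite /lin addrK !BE reflK subrK.
apply: (corner_not_congruent hX hlen c hB).
  apply/fsetP => z; apply/imfsetP/idP => /= [[x xV ->]|zV]; first exact: img.
  by exists (lin X B z); rewrite ?invol //; apply: img.
have linr t t' : refl (rel w - rel w1) (rel t) = rel t' -> lin X B (val t) = val t'.
  by rewrite /lin BE => ->; rewrite /rel subrK.
have l1 : lin X B (val u) = val u.
  by apply: linr; rewrite refl_perp // dotDr dotNr d subrr.
have l2 : lin X B (val w) = val w1 by apply: linr; rewrite refl_swap // -n n1.
apply: etrans (esym e1E); apply: etrans (congr1 (image_edge (lin X B)) eE) _.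
apply/fsetP => z; rewrite !inE; apply/imfsetP/orP => /= [[x + ->]|[]/eqP ->].
- by rewrite !inE => /orP[]/eqP ->; rewrite ?l1 ?l2 eqxx; [left|right].
- by exists (val u); rewrite ?l1 // !inE eqxx.
- by exists (val w); rewrite ?l2 // !inE eqxx orbT.
Qed.

Lemma follows_turn a u e f w p q x : lies u e f -> w != u -> inVE w e ->
  rel u = place p -> rel w = place q -> acts a (turn_kind x (rel u) (rel w)) ->
  follows a (turn_perm L x p q).
Proof.
move=> hf wu we eu ew; have [_ [g gG [hg ag]]] := follows_turn_refl hf wu we eu ew.
case: x => /= ha; last first.
  by apply: follows_ext hg => t; apply: rel_inj; rewrite ag ha.
have [b bG [be bf ebf bv]] := flip_exists hX hlen hf.
have hb := flip_acts hX hlen bG hf wu we (bv u (proj1 hf)) (bv w we) bf.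
have [n0 _] := follows_flip hf wu we eu ew.
have [|_ fb] := @follows_refl b (vcross p q) n0.
  by move=> t; rewrite hb eu ew refl_cross_place.
apply: follows_ext (follows_comp fb hg) => t; apply: rel_inj.
by rewrite (acts_comp hb ag) ha.
Qed.

Lemma dot_place p q : dot (place p) (place q) = k ^+ 2 * ev R (vdot p q).
Proof. by rewrite /place !dotE dot_orth // dot_evv; ring. Qed.

Lemma frame_consistent w w1 f e e1 a b c d x y :
  flag_frame v w w1 f e e1 a b c d x y -> exists q q1,
  [/\ q \in L, q1 \in L, rel w = place q & rel w1 = place q1] /\
  [/\ admissible L p0 q, admissible L p0 q1, consistent L p0 q q1 x y,
      follows a (turn_perm L x p0 q) & follows c (turn_perm L y p0 q1)] /\
  forall s, s \in frame_gens L p0 q q1 -> exists2 g, g \in Gsym X & follows g s.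
Proof.
move=> F; have [_ [ve ef] [ve1 e1f]] := ff_corner F.
have hM : is_map M by case: hX => -[].
have we : inVE w e by rewrite /inVE /= (ff_e F) !inE eqxx orbT.
have w1e : inVE w1 e1 by rewrite /inVE /= (ff_e1 F) !inE eqxx orbT.
have wv : w != v.
  apply/eqP => wv; have [n0 _ _] := ff_indep F; case/eqP: n0; rewrite wv.
  by apply: row3P; rewrite !vec3E !mxE; ring.
have w1v : w1 != v.
  apply/eqP => wv'; have [_ n0 _] := ff_indep F; case/eqP: n0; rewrite wv'.
  by apply: row3P; rewrite !vec3E !mxE; ring.
have [q qL ew] := place_rel w; have [q1 q1L ew1] := place_rel w1.
exists q, q1; split=> //.
have fa := follows_turn (conj ve ef) wv we v_place ew (ff_a F).
have fc := follows_turn (conj ve1 e1f) w1v w1e v_place ew1 (ff_c F).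
have [n0 _] := follows_flip (conj ve ef) wv we v_place ew.
have [n10 _] := follows_flip (conj ve1 e1f) w1v w1e v_place ew1.
have [|_ fb] := @follows_refl b (vcross p0 q) n0.
  by move=> t; rewrite (ff_b F) v_place ew refl_cross_place.
have [|_ fd] := @follows_refl d (vcross p0 q1) n10.
  by move=> t; rewrite (ff_d F) v_place ew1 refl_cross_place.
have [aG bG cG dG] := ff_G F.
split; last first.
  have [_ [g gG [hg _]]] := follows_turn_refl (conj ve ef) wv we v_place ew.
  have [_ [g1 g1G [hg1 _]]] := follows_turn_refl (conj ve1 e1f) w1v w1e v_place ew1.
  by move=> s; rewrite !inE => /or4P[]/eqP ->; [exists g|exists b|exists g1|exists d].
split=> //.
- exact: (edge_admissible ve we wv v_place ew).
- exact: (edge_admissible ve1 w1e w1v v_place ew1).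
rewrite /consistent; case: eqP => [e0|_].
  have [_ _ nn] := ff_indep F; case/eqP: nn; rewrite v_place ew ew1.
  set N := cross (place p0) (place q); set N1 := cross (place p0) (place q1).
  have c0 : cross (evv R (vcross p0 q)) (evv R (vcross p0 q1)) = 0.
    by rewrite cross_evv e0; apply: row3P; rewrite !mxE /ev /= mul0r addr0.
  have [l el] := cross0 (evv_neq0 R n0) c0.
  have l0 : l != 0 by apply: contra_neq (evv_neq0 R n10) => l0; rewrite el l0 scale0r.
  (* [N] and [N1] agree with the placed cross products only up to a factor; that they are parallel
     is obtained from reflections, which ignore the factor. *)
  have e1' : refl N N1 = - N1.
    by rewrite -refl_id /N /N1 !refl_cross_place el -scalemxAl reflZ.
  have e2 := refl_opp e1'.
  by rewrite e2 crossZr_self.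
case: ifP => [|_]; first case: eqP => // dd sy.
  exfalso; have [n1 n2] := ff_norm F.
  apply: (sym_not_congruent (ff_corner F) (ff_e F) (ff_e1 F) n1 n2 ew ew1 _ sy).
  by rewrite v_place ew ew1 !dot_place dd.
apply/andP; split; apply/eqP.
  apply: (@follows_signature (a * d)%g (c * b)%g); rewrite ?groupM //; try exact: follows_comp.
  by move=> n; have [] := ff_swap F n.
apply: (@follows_signature (a * b * d)%g (c * d * b)%g); rewrite ?groupM //.
- by apply: follows_comp => //; apply: follows_comp.
- by apply: follows_comp => //; apply: follows_comp.
by move=> n; have [] := ff_swap F n.
Qed.

End Chamber.
End Recognition.

Lemma dodeca_uniq : uniq dodeca.
Proof. by vm_compute. Qed.

Lemma dodeca_faces_uniq x : uniq (dodeca_faces x).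
Proof. by case: x; vm_compute. Qed.

Lemma dodeca_size : size dodeca = 20%N.
Proof. by []. Qed.

Lemma admissible_edge p q : p \in dodeca -> q \in dodeca ->
  (index p dodeca < index q dodeca)%N -> admissible dodeca p q ->
  (index p dodeca, index q dodeca) \in dodeca_edges.
Proof.
have key : forall i, i \in iota 0 20 -> forall j, j \in iota 0 20 -> (i < j)%N ->
    admissible dodeca (point dodeca i) (point dodeca j) -> (i, j) \in dodeca_edges.
  move=> i /(allP all_admissible_pairs_ok) hi j /(allP hi)/implyP h ij.
  by apply/implyP; apply: h.
(* From here on the tables are variables, so that no tactic evaluates them. *)
move: key dodeca_size; move: dodeca dodeca_edges => l E key sl pl ql pq adm.
have hi r : r \in l -> index r l \in iota 0 20.
  by rewrite mem_iota add0n -sl index_mem.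
by apply: key; rewrite ?hi ?/point ?nth_index.
Qed.

Lemma In_map (T : eqType) (U : Type) (g : T -> U) s y :
  List.In y (map g s) -> exists2 x, x \in s & g x = y.
Proof.
elim: s => //= x s IH [<-|/IH[z zs <-]]; first by exists x; rewrite ?mem_head.
by exists z; rewrite // inE zs orbT.
Qed.

Section Recognition.
Variables (R : realType) (X : figure R).
Local Notation E3 := 'rV[R]_3.
Hypothesis hX : regular_index2 X.
Hypothesis hlen : edges_of_different_lengths X.
Local Notation M := (map_of X).
Local Notation rel := (@rel R X).

Let hM : is_map M. Proof. by case: hX => -[]. Qed.

Section Placed.
(* Unification would otherwise evaluate the tables. *)
Local Opaque dodeca dodeca_edges.
Variables (v : vertex M) (k : R) (A : 'M[R]_3).
Hypotheses (k0 : 0 < k) (hA : orthogonal_mx A) (v_place : rel v = place k A dodeca0).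
Hypothesis config_L : forall x, x \in config X <-> exists2 p, p \in dodeca & x = place k A p.

Definition spot (i : nat) : E3 := simil k A (center X) (evv R (point dodeca i)).

Lemma spotE i : spot i = place k A (point dodeca i) + center X.
Proof. by []. Qed.

Lemma spot_inj i j : (i < 20)%N -> (j < 20)%N -> spot i = spot j -> i = j.
Proof.
move=> hi hj /addIr/(place_inj k0 hA)/eqP.
by rewrite nth_uniq ?dodeca_uniq // => /eqP.
Qed.

Lemma spot_val (u : vertex M) p : rel u = place k A p -> p \in dodeca ->
  val u = spot (index p dodeca).
Proof. by move=> e pL; rewrite spotE /point nth_index // -e /rel subrK. Qed.

Lemma spot_vertex i : (i < 20)%N -> exists u : vertex M, val u = spot i /\ rel u = place k A (point dodeca i).
Proof.
move=> hi; have pL : point dodeca i \in dodeca by apply: mem_nth.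
have [u eu] := rel_place config_L pL; exists u; split=> //.
by rewrite spotE -eu /rel subrK.
Qed.

Lemma verts_spot : verts X = [fset spot i | i in iota 0 20]%fset.
Proof.
apply/fsetP => x; apply/idP/imfsetP => [xV|[i]].
  have [p pL e] := place_rel config_L [` xV]%fset.
  exists (index p dodeca); last by rewrite -(spot_val e pL).
  suff : index p dodeca \in iota 0 20 by [].
  by rewrite mem_iota add0n -dodeca_size index_mem.
move=> hi' ->; have hi : (i < 20)%N by have : i \in iota 0 20 := hi'; rewrite mem_iota.
by have [u [<- _]] := spot_vertex hi; apply: valP.
Qed.

Lemma follows_map g q : g \in Gsym X -> follows dodeca k A g q -> exists s,
  induces s g /\ forall i, (i < 20)%N -> s (spot i) = spot (nth 0%N q i) /\ (nth 0%N q i < 20)%N.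
Proof.
move=> gG [_ hq]; move: (gG); rewrite inE => /asboolP[s _ ig]; exists s; split=> // i hi.
have [u [eu ru]] := spot_vertex hi; have [h _ _] := ig.
have [h1 h2] := hq u i hi ru; split=> //.
by rewrite -eu -h spotE -h2 /rel subrK.
Qed.

Lemma segment_perm (s : E3 -> E3) q e :
  (forall i, (i < 20)%N -> s (spot i) = spot (nth 0%N q i) /\ (nth 0%N q i < 20)%N) ->
  small e -> small (edge_perm q e) /\ image_edge s (segment spot e) = segment spot (edge_perm q e).
Proof.
move=> hs /andP[h1 h2]; have [[e1 s1] [e2 s2]] := (hs _ h1, hs _ h2); split.
  by rewrite /edge_perm /pair_edge /small; case: ifP; rewrite /= ?s1 ?s2.
by rewrite image_segment /edge_perm segment_pair /segment /= e1 e2.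
Qed.

Definition good_edge e := small e /\ segment spot e \in edges X.

Lemma good_edge_perm g q e : g \in Gsym X -> follows dodeca k A g q ->
  good_edge e -> good_edge (edge_perm q e).
Proof.
move=> gG hq [se eE]; have [s [[_ h2 _] hs]] := follows_map gG hq.
have [se' ee] := segment_perm hs se; split=> //; rewrite -ee.
by rewrite -(h2 [` eE]%fset); apply: valP.
Qed.

Definition good_face f := all small f /\ polygon spot f \in faces X.

Lemma polygon_perm (s : E3 -> E3) q f :
  (forall i, (i < 20)%N -> s (spot i) = spot (nth 0%N q i) /\ (nth 0%N q i < 20)%N) ->
  all small f -> all small (face_perm q f) /\
  image_face s (polygon spot f) = polygon spot (face_perm q f).
Proof.
move=> hs /allP sf; split.
  by apply/allP => e; rewrite mem_sort => /mapP[e' /sf se ->]; have [] := segment_perm hs se.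
rewrite image_polygon; apply/fsetP => z; apply/imfsetP/imfsetP => /= -[e ef ->].
  exists (edge_perm q e); first by rewrite mem_sort map_f.
  by have [_ <-] := segment_perm hs (sf _ ef); rewrite image_segment.
move: ef; rewrite mem_sort => /mapP[e' e'f ->]; exists e' => //.
by have [_ <-] := segment_perm hs (sf _ e'f); rewrite image_segment.
Qed.

Lemma good_face_perm g q f : g \in Gsym X -> follows dodeca k A g q ->
  good_face f -> good_face (face_perm q f).
Proof.
move=> gG hq [sf fF]; have [s [[_ _ h3] hs]] := follows_map gG hq.
have [sf' ee] := polygon_perm hs sf; split=> //; rewrite -ee.
by rewrite -(h3 [` fF]%fset); apply: valP.
Qed.

Lemma edges_sub (E : edge M) : exists2 e, e \in dodeca_edges & val E = segment spot e.
Proof.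
have key (u w : vertex M) p q : inVE u E -> inVE w E -> w != u ->
    rel u = place k A p -> rel w = place k A q -> p \in dodeca -> q \in dodeca ->
    (index p dodeca < index q dodeca)%N -> exists2 e, e \in dodeca_edges & val E = segment spot e.
  move=> uE' wE' wu' eu ew pL qL pq; exists (index p dodeca, index q dodeca).
    have adm := edge_admissible hX hlen k0 hA config_L uE' wE' wu' eu ew.
    exact: admissible_edge.
  rewrite (edge_fset hX uE' wE') 1?eq_sym // /segment /=.
  by rewrite (spot_val eu pL) (spot_val ew qL).
have [u uE] := edge_has_vertex hM E; have [w [wu wE _]] := other_end hM uE.
have [p pL eu] := place_rel config_L u; have [q qL ew] := place_rel config_L w.
case: (ltngtP (index p dodeca) (index q dodeca)) => [pq|qp|e].
- exact: (key u w p q).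
- by apply: (key w u q p) => //; rewrite eq_sym.
case/eqP: wu; apply: val_inj; by rewrite (spot_val eu pL) (spot_val ew qL) e.
Qed.

Lemma two_on_vertex i e f : face_closed f -> e \in f -> on_edge i e ->
  exists2 e', e' \in f & on_edge i e' && (e' != e).
Proof.
move=> /allP h ef ie; apply/hasP.
by have /andP[h1 h2] := h e ef; case/orP: ie => /eqP ->.
Qed.

(* A face is a single cycle: it contains no further edge once it contains a
   closed polygon. *)
Lemma face_spot x f (F : face M) : f \in dodeca_faces x ->
  (forall e, e \in f -> segment spot e \in val F) -> val F = polygon spot f.
Proof.
move=> fx sub; have [fc /allP fs /allP fl] := dodeca_faces_facts fx.
have toE e : e \in f -> exists2 E : edge M, val E = segment spot e & inEF E F.
  move=> ef; have eF := sub e ef; have eE := faces_on_edges (let: And3 h _ _ := hX in h) (valP F) eF.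
  by exists [` eE]%fset.
have [e0 e0f] : exists e, e \in f.
  by move: fx; case: (x) => /=; rewrite !inE; do ?[case/orP]; move=> /eqP ->; eexists; apply: mem_head.
have [E0 E0e E0F] := toE e0 e0f.
have all_in : forall E : edge M, inEF E F -> val E \in polygon spot f; last first.
  apply/fsetP => z; apply/idP/polygonP => [zF|[e ef ->]]; last exact: sub.
  have zE := faces_on_edges (let: And3 h _ _ := hX in h) (valP F) zF.
  by apply/polygonP; apply: (all_in [` zE]%fset).
apply: (face_connected hM (S := fun E : edge M => val E \in polygon spot f) E0F).
  by rewrite E0e; apply/polygonP; exists e0.
move=> u E E' uE uE' EF E'F /polygonP[e ef Ee].
have [i [ie ui]] : exists i, on_edge i e /\ val u = spot i.
  move: uE; rewrite /inVE /= Ee !inE => /orP[]/eqP ->; [exists e.1|exists e.2];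
  by rewrite /on_edge eqxx ?orbT.
have [e' e'f /andP[ie' ne]] := two_on_vertex fc ef ie.
have [E'' E''e E''F] := toE e' e'f.
have uE'' : inVE u E''.
  by rewrite /inVE /= E''e ui !inE; case/orP: ie' => /eqP <-; rewrite eqxx ?orbT.
have nE : E'' != E.
  apply: contra_neq ne => eE; apply: (segment_inj spot_inj (fs _ e'f) (fs _ ef) (fl _ e'f) (fl _ ef)).
  by rewrite -E''e eE Ee.
have [t [_ _ _ ht]] := corner hM uE EF.
have e1 : E'' = t by case: (ht _ uE'' E''F) => // e1; rewrite e1 eqxx in nE.
case: (ht _ uE' E'F) => ->; first by apply/polygonP; exists e.
by rewrite -e1; apply/polygonP; exists e'.
Qed.

(** The tabulated edges and faces occur in [X] because the symmetries of the frame generate them;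
    nothing else occurs because edges are admissible pairs and each edge has only two sides. *)
Lemma recognized : exists x, X = table_figure spot (dodeca_faces x).
Proof.
have v_in : dodeca0 \in dodeca by vm_compute.
have [w [w1 [f [e [e1 [a [b [c [d [x [y F]]]]]]]]]]] := flag_frame_exists hX hlen v.
have [q [q1 [[qL q1L ew ew1] [[ad ad1 cons fa fc] gens]]]] :=
  frame_consistent hX hlen k0 hA dodeca_uniq v_place config_L F.
have := allP frames_ok _ (mem_consistent_frames qL q1L ad ad1 cons).
case/and4P => /eqP exy f0x /allP hes /allP hfs; subst y.
set f0 := frame_face dodeca dodeca0 q q1 x x in f0x hfs.
have [aG bG cG dG] := ff_G F.
have [_ [ve ef] [ve1 e1f]] := ff_corner F.
have eE : val e = segment spot (pair_edge (index dodeca0 dodeca) (index q dodeca)).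
  by rewrite segment_pair (ff_e F) (spot_val v_place v_in) (spot_val ew qL).
have e1E : val e1 = segment spot (pair_edge (index dodeca0 dodeca) (index q1 dodeca)).
  by rewrite segment_pair (ff_e1 F) (spot_val v_place v_in) (spot_val ew1 q1L).
have idx p : p \in dodeca -> (index p dodeca < 20)%N by rewrite -dodeca_size index_mem.
have sp p p' : p \in dodeca -> p' \in dodeca -> small (pair_edge (index p dodeca) (index p' dodeca)).
  by move=> /idx h /idx h'; rewrite /pair_edge /small; case: ifP; rewrite /= h h'.
pose inF z := small z /\ segment spot z \in val f.
have inF_perm g s z : g \in Gsym X -> g.2 f = f -> follows dodeca k A g s -> inF z -> inF (edge_perm s z).
  move=> gG gf hs [zs zf]; have [t [[_ _ h3] ht]] := follows_map gG hs.
  have [zs' ee] := segment_perm ht zs; split=> //; rewrite -ee -gf h3.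
  by apply/imfsetP; exists (segment spot z).
have [af cf] := ff_f F.
have inFe : inF (pair_edge (index dodeca0 dodeca) (index q dodeca)).
  by split; [exact: sp|rewrite -eE].
have inFe1 : inF (pair_edge (index dodeca0 dodeca) (index q1 dodeca)).
  by split; [exact: sp|rewrite -e1E].
have inFa z : inF z -> inF (edge_perm (turn_perm dodeca x dodeca0 q) z) by apply: (inF_perm a).
have inFc z : inF z -> inF (edge_perm (turn_perm dodeca x dodeca0 q1) z) by apply: (inF_perm c).
(* [a] and [c] fix [f], so the six edges obtained from [e] and [e1] all lie on [f]. *)
have f0F z : z \in f0 -> inF z.
  rewrite mem_sort !inE => /or4P[/eqP->|/eqP->|/eqP->|/or3P[]/eqP ->];
    [exact: inFe|exact: inFe1|exact: inFa _ inFe1|exact: inFc _ inFe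
    |exact: inFa _ (inFc _ inFe)|exact: inFc _ (inFa _ inFe1)].
have f0E : val f = polygon spot f0 by apply: (face_spot f0x) => z /f0F[].
have allE z : z \in dodeca_edges -> good_edge z.
  move=> /hes; apply: closure_ind => [t|h].
    rewrite !inE => /orP[]/eqP ->; split; rewrite ?sp // -?eE -?e1E; exact: valP.
  move=> hin t; have [s hs <-] := In_map hin.
  have [g gG gs] := gens s hs; exact: (good_edge_perm gG gs).
have allF z : z \in dodeca_faces x -> good_face z.
  move=> /hfs; apply: closure_ind => [t|h].
    rewrite inE => /eqP ->; split; last by rewrite -f0E; apply: valP.
    by apply/allP => t' /f0F[].
  move=> hin t; have [s hs <-] := In_map hin.
  have [g gG gs] := gens s hs; exact: (good_face_perm gG gs).
have /and4P[_ _ _ /allP hcount] := all_tables_ok x.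
exists x; transitivity (Figure (verts X) (edges X) (faces X)); first by case: (X).
rewrite /table_figure; congr Figure; first exact: verts_spot.
  apply/fsetP => z; apply/idP/imfsetP => [zE|[t tE ->]].
    by have [t tE ht] := edges_sub [` zE]%fset; exists t.
  by have [] := allE t tE.
apply/fsetP => z; apply/idP/imfsetP => [zF|[t tF ->]]; last by have [] := allF t tF.
(* Any face contains some edge, and this edge already lies on two faces from the table, which are
   its only sides. *)
have F3 := face_size_ge3 (let: And3 h _ _ := hX in h) [` zF]%fset.
have /card_gt0P[E] : (0 < face_size (M := M) [` zF]%fset)%N by apply: leq_trans F3.
rewrite inE => EF; have [t tE Et] := edges_sub E.
have /and3P[t12 t2 /eqP two] := hcount t tE.
have [g1 g1F tg1] : exists2 g, g \in dodeca_faces x & t \in g.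
  by apply/hasP; rewrite has_count two.
have [g2 g2F /andP[tg2 ng]] : exists2 g, g \in dodeca_faces x & (t \in g) && (g != g1).
  apply/hasP; apply/negPn/negP => /hasPn hn.
  have : (count (fun f => t \in f) (dodeca_faces x) <= count (pred1 g1) (dodeca_faces x))%N.
    rewrite -[X in (X <= _)%N](@eq_in_count _ (fun g : seq (nat * nat) => (t \in g) && (g == g1))).
      by apply: sub_count => g /andP[].
    move=> g gF /=; have := hn g gF; case: (t \in g) => //=; by rewrite negbK => /eqP ->; rewrite eqxx.
  rewrite two count_uniq_mem ?dodeca_faces_uniq //; by case: (g1 \in _).
have [s1 P1] := allF g1 g1F; have [s2 P2] := allF g2 g2F.
have nP : polygon spot g2 != polygon spot g1.
  by apply: contra_neq ng => /(polygon_inj spot_inj g2F g1F).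
pose F1 : face M := [` P1]%fset; pose F2 : face M := [` P2]%fset.
have E1 : inEF E F1 by rewrite /inEF /= Et; apply/polygonP; exists t.
have E2 : inEF E F2 by rewrite /inEF /= Et; apply/polygonP; exists t.
have [F' [_ _ hF']] := other_side hM E1.
have e2 : F2 = F' by case: (hF' _ E2) => // e2; case/eqP: nP; move: (congr1 val e2).
case: (hF' _ EF) => e3; first by exists g1 => //; move: (congr1 val e3).
by rewrite -e2 in e3; exists g2 => //; move: (congr1 val e3).
Qed.

End Placed.

Lemma chamber_orbit_uniq c : uniq (chamber_orbit c).
Proof. by rewrite /chamber_orbit iterS undup_uniq. Qed.

Lemma recognition : exists k A t x, [/\ 0 < k, orthogonal_mx A &
  X = table_figure (fun i => simil k A t (evv R (point dodeca i))) (dodeca_faces x)].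
Proof.
have [v _] := vertex_exists hX.
have [c [k [A [cin [k0 hA ev hL]]]]] := reflection_configuration_framed (config_reflection hX hlen v).
case: (frames_excluded cin) => [ce|none]; last first.
  have [w [w1 [f [e [e1 [a [b [c' [d [x [y F]]]]]]]]]]] := flag_frame_exists hX hlen v.
  have [q [q1 [[qL q1L ew ew1] [[ad ad1 cons _ _] _]]]] :=
    frame_consistent hX hlen k0 hA (chamber_orbit_uniq c) ev hL F.
  by have := mem_consistent_frames qL q1L ad ad1 cons; rewrite none.
move: ev hL; rewrite ce dodecaE => ev hL.
have [x Xx] := recognized k0 hA ev hL.
by exists k, A, (center X), x.
Qed.

End Recognition.

Local Open Scope nat_scope.

(** * Maps presented by tables *)

Lemma label_card (T : finType) (U : eqType) (lab : T -> U) (s : seq U) (p : pred U) :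
  injective lab -> uniq s -> (forall x, lab x \in s) -> (forall y, y \in s -> exists x, lab x = y) ->
  #|[set x | p (lab x)]| = count p s.
Proof.
move=> inj us hin hsurj; rewrite cardsE cardE -(size_map lab) -size_filter.
apply: perm_size; apply: uniq_perm.
- by rewrite map_inj_uniq ?enum_uniq.
- exact: filter_uniq.
move=> y; rewrite mem_filter; apply/mapP/andP => [[x + ->]|[py ys]].
  by rewrite mem_enum => px; split.
by have [x ex] := hsurj y ys; exists x; rewrite // mem_enum -topredE /= ex.
Qed.

Notation edge_label := (nat * nat)%type (only parsing).
Notation face_label := (seq (nat * nat)) (only parsing).

(** Labels carry the incidences of the map into the tables, so that its combinatorics can be
    computed without coordinates. *)
Record presentation (M : cells) (LF : seq face_label) := Presentation {
  lv : vertex M -> nat;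
  le : edge M -> nat * nat;
  lf : face M -> seq (nat * nat);
  lv_inj : injective lv;
  le_inj : injective le;
  lf_inj : injective lf;
  lv_in : forall v, lv v \in iota 0 20;
  le_in : forall e, le e \in dodeca_edges;
  lf_in : forall f, lf f \in LF;
  lv_surj : forall i, i \in iota 0 20 -> exists v, lv v = i;
  le_surj : forall e, e \in dodeca_edges -> exists E, le E = e;
  lf_surj : forall f, f \in LF -> exists F, lf F = f;
  lVE : forall v e, inVE v e = on_edge (lv v) (le e);
  lEF : forall e f, inEF e f = (le e \in lf f) }.

Definition walk_label (x y : nat * edge_label) : bool :=
  [&& x.1 != y.1, on_edge x.1 x.2 & on_edge y.1 x.2].

Definition fan_label (x y : edge_label * face_label) : bool :=
  [&& x.1 != y.1, x.1 \in x.2 & y.1 \in x.2].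

Definition other_vertex (i : nat) (e : edge_label) : nat := if i == e.1 then e.2 else e.1.

Definition next_edge (i : nat) (e : edge_label) (f : face_label) : edge_label :=
  head (0, 0) [seq e' <- f | on_edge i e' && (e' != e)].

Definition other_face (LF : seq face_label) (e : edge_label) (f : face_label) : face_label :=
  head [::] [seq g : seq (nat * nat) <- LF | (e \in g) && (g != f)].

Definition walk_next (f : face_label) (x : nat * edge_label) : nat * edge_label :=
  let j := other_vertex x.1 x.2 in (j, next_edge j x.2 f).

Definition face_walk (f : face_label) : seq (nat * edge_label) :=
  let e := head (0, 0) f in traject (walk_next f) (e.1, e) 6.

Definition fan_next (LF : seq face_label) (i : nat) (x : edge_label * face_label) :=
  let e := next_edge i x.1 x.2 in (e, other_face LF e x.2).

Definition vertex_fan (LF : seq face_label) (i : nat) : seq (edge_label * face_label) :=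
  let e := head (0, 0) [seq e <- dodeca_edges | on_edge i e] in
  let f := head [::] [seq f : seq (nat * nat) <- LF | e \in f] in traject (fan_next LF i) (e, f) 6.

Definition walk_ok (f : face_label) : bool :=
  let s := face_walk f in
  [&& path.cycle walk_label s, uniq (unzip1 s), perm_eq (unzip2 s) f,
      all (fun i => i \in iota 0 20) (unzip1 s) & all (fun e => e \in dodeca_edges) f].

Definition fan_ok (LF : seq face_label) (i : nat) : bool :=
  let s := vertex_fan LF i in
  [&& path.cycle fan_label s, uniq (unzip2 s),
      perm_eq (unzip1 s) [seq e <- dodeca_edges | on_edge i e] &
      perm_eq (unzip2 s) [seq f <- LF | has (on_edge i) f]].

(** Connectedness is checked in the form that each vertex but 0 is joined by an edge to a vertex of
    smaller index. *)
Definition map_ok (LF : seq face_label) : bool :=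
  [&& uniq LF, all walk_ok LF, all (fan_ok LF) (iota 0 20),
      all (fun e => count (fun i => on_edge i e) (iota 0 20) == 2) dodeca_edges,
      all (fun e => count (fun f : seq (nat * nat) => e \in f) LF == 2) dodeca_edges,
      all (fun i => has (fun e => (e.2 == i) && (e.1 < i)) dodeca_edges) (iota 1 19),
      all (fun f => uniq f && (size f == 6)) LF,
      all (fun i => count (on_edge i) dodeca_edges == 6) (iota 0 20) &
      size LF == 20].

Lemma maps_ok x : map_ok (dodeca_faces x).
Proof. by case: x; vm_compute. Qed.

Lemma dodeca_edges_uniq : uniq dodeca_edges.
Proof. by vm_compute. Qed.

Lemma dodeca_edges_lt e : e \in dodeca_edges -> e.1 < e.2 < 20.
Proof.
have h : all (fun e => e.1 < e.2 < 20) dodeca_edges by vm_compute.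
exact: (allP h).
Qed.

Lemma other_vertexP i e : on_edge i e -> on_edge (other_vertex i e) e.
Proof. by rewrite /on_edge /other_vertex; case: eqP => _; rewrite eqxx ?orbT. Qed.

Section Presented.
Variables (M : cells) (x : bool).
Local Notation LF := (dodeca_faces x).
Variable p : presentation M LF.
Local Notation lv := (lv p).
Local Notation le := (le p).
Local Notation lf := (lf p).

Lemma unlabel : exists (uv : nat -> vertex M) (ue : edge_label -> edge M) (uf : face_label -> face M),
  [/\ forall i, i \in iota 0 20 -> lv (uv i) = i, forall e, e \in dodeca_edges -> le (ue e) = e
    & forall f, f \in LF -> lf (uf f) = f].
Proof.
have [v0 _] := lv_surj p (isT : 0 \in iota 0 20).
have [e0 _] := le_surj p (isT : (0, 1) \in dodeca_edges).
have [f0 _] : exists f : face M, True.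
  have : size LF = 20 by have /and5P[_ _ _ _ /and5P[_ _ _ _ /eqP]] := maps_ok x.
  case E : LF => [|f s] // _; have fin : f \in LF by rewrite E mem_head.
  by have [F _] := lf_surj p fin; exists F.
have [|uv huv] := @choice _ _ (fun i (v : vertex M) => i \in iota 0 20 -> lv v = i).
  move=> i; case: (pselect (i \in iota 0 20)) => [h|h]; last by exists v0.
  by have [F eF] := lv_surj p h; exists F.
have [|ue hue] := @choice _ _ (fun e E => e \in dodeca_edges -> le E = e).
  move=> e; case: (pselect (e \in dodeca_edges)) => [h|h]; last by exists e0.
  by have [F eF] := le_surj p h; exists F.
have [|uf huf] := @choice _ _ (fun f F => f \in LF -> lf F = f).
  move=> f; case: (pselect (f \in LF)) => [h|h]; last by exists f0.
  by have [F eF] := lf_surj p h; exists F.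
by exists uv, ue, uf.
Qed.

Lemma presented_card (q : pred face_label) : #|[set f : face M | q (lf f)]| = count q LF.
Proof.
apply: label_card; [exact: lf_inj| |exact: lf_in|exact: lf_surj].
by have /and5P[h _ _ _ _] := maps_ok x.
Qed.

Lemma presented_face_size (f : face M) : face_size f = 6.
Proof.
rewrite /face_size; have /and5P[_ h _ _ /and5P[_ _ h6 _ _]] := maps_ok x.
have /andP[uf /eqP <-] := allP h6 _ (lf_in p f).
have -> : [set e | inEF e f] = [set e | (fun t => t \in lf f) (le e)].
  by apply/finset.setP => e; rewrite !inE (lEF p).
rewrite (label_card _ (@le_inj _ _ p) dodeca_edges_uniq (le_in p) (@le_surj _ _ p)).
rewrite -size_filter; apply: perm_size; apply: uniq_perm; rewrite ?filter_uniq ?dodeca_edges_uniq //.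
have /and5P[_ _ _ _ /allP hf] := allP h _ (lf_in p f).
move=> e; rewrite mem_filter; apply/andP/idP => [[]//|ef].
by split=> //; apply: hf.
Qed.

Lemma presented_degree (v : vertex M) : degree v = 6.
Proof.
rewrite /degree; have /and5P[_ _ _ _ /and5P[_ _ _ h6 _]] := maps_ok x.
rewrite -[RHS](eqP (allP h6 _ (lv_in p v))).
have -> : [set e | inVE v e] = [set e | (on_edge (lv v)) (le e)].
  by apply/finset.setP => e; rewrite !inE (lVE p).
by apply: label_card; [exact: le_inj|exact: dodeca_edges_uniq|exact: le_in|exact: le_surj].
Qed.

Lemma presented_euler : euler_char M = (-20)%R.
Proof.
rewrite /euler_char.
have -> : #|vertex M| = 20.
  rewrite -cardsT -[RHS]/(count predT (iota 0 20)).
  rewrite -(label_card predT (@lv_inj _ _ p) (iota_uniq 0 20) (lv_in p) (@lv_surj _ _ p)).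
  by apply: eq_card => v; rewrite !inE.
have -> : #|edge M| = 60.
  rewrite -cardsT -[RHS]/(count predT dodeca_edges).
  rewrite -(label_card predT (@le_inj _ _ p) dodeca_edges_uniq (le_in p) (@le_surj _ _ p)).
  by apply: eq_card => v; rewrite !inE.
have -> : #|face M| = 20.
  have /and5P[_ _ _ _ /and5P[_ _ _ _ /eqP <-]] := maps_ok x.
  rewrite -cardsT -[RHS]count_predT -presented_card.
  by apply: eq_card => v; rewrite !inE.
by [].
Qed.

Lemma presented_adjacent (v w : vertex M) (e : edge M) : inVE v e -> inVE w e -> adjacent v w.
Proof. by move=> h1 h2; apply/existsP; exists e; rewrite h1 h2. Qed.

Lemma presented_map : is_map M.
Proof.
have [uv [ue [uf [huv hue huf]]]] := unlabel.
have /and5P[uLF hwalk hfan hends /and5P[hsides hconn hsize _ _]] := maps_ok x.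
have conn0 i : i < 20 -> connect (@adjacent M) (uv 0) (uv i).
  elim/ltn_ind: i => i IH hi; case: (posnP i) => [->|i0]; first exact: connect0.
  have hin : i \in iota 1 19 by rewrite mem_iota i0.
  have /hasP[e eE /andP[/eqP e2 e1]] := allP hconn _ hin.
  apply: connect_trans (IH e.1 e1 (ltn_trans e1 hi)) (connect1 _).
  apply: (@presented_adjacent _ _ (ue e)); rewrite (lVE p) huv ?hue // /on_edge ?eqxx //.
  - by rewrite mem_iota (ltn_trans e1 hi).
  - by rewrite e2 eqxx orbT.
  - by rewrite mem_iota hi.
have uvK v : uv (lv v) = v by apply: (lv_inj (p := p)); rewrite huv ?lv_in.
have ueK e : ue (le e) = e by apply: (le_inj (p := p)); rewrite hue ?le_in.
have ufK f : uf (lf f) = f by apply: (lf_inj (p := p)); rewrite huf ?lf_in.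
split.
- by apply/card_gt0P; exists (uv 0).
- move=> v w; have sym : symmetric (@adjacent M).
    by move=> u u'; apply: eq_existsb => e; rewrite andbC.
  have c0 u : connect (@adjacent M) (uv 0) u.
    by rewrite -(uvK u); apply: conn0; have := lv_in p u; rewrite mem_iota.
  by apply: connect_trans (c0 w); rewrite (sym_connect_sym sym).
- move=> e; rewrite -(eqP (allP hends _ (le_in p e))).
  have -> : [set v | inVE v e] = [set v | (fun i => on_edge i (le e)) (lv v)].
    by apply/finset.setP => v; rewrite !inE (lVE p).
  by apply: label_card; [exact: lv_inj|exact: iota_uniq|exact: lv_in|exact: lv_surj].
- move=> e; rewrite -(eqP (allP hsides _ (le_in p e))).
  have -> : [set f | inEF e f] = [set f | (fun l => le e \in l) (lf f)].
    by apply/finset.setP => v; rewrite !inE (lEF p).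
  exact: presented_card.
- move=> f; have /and5P[hc u1 hp /allP hv /allP he] := allP hwalk _ (lf_in p f).
  set s := face_walk (lf f) in hc u1 hp hv.
  have hs z : z \in s -> z.1 \in iota 0 20 /\ z.2 \in dodeca_edges.
    move=> zs; split; first by apply: hv; apply: map_f.
    by apply: he; rewrite -(perm_mem hp); apply: map_f.
  exists [seq (uv z.1, ue z.2) | z <- s].
  have i1 : unzip1 [seq (uv z.1, ue z.2) | z <- s] = map uv (unzip1 s) by rewrite /unzip1 -!map_comp.
  have i2 : unzip2 [seq (uv z.1, ue z.2) | z <- s] = map ue (unzip2 s) by rewrite /unzip2 -!map_comp.
  split.
  + rewrite cycle_map; apply: (sub_in_cycle (P := mem s)) hc; last by apply/allP.
    move=> y z ys zs /and3P[h1 h2 h3].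
    have [[y1 y2] [z1 z2]] := (hs _ ys, hs _ zs).
    rewrite /= /walk_step /= !(lVE p) !huv // !hue // h2 h3 !andbT.
    by apply: contra_neq h1 => e; rewrite -(huv _ y1) -(huv _ z1) e.
  + rewrite i1 map_inj_in_uniq // => y z /hv hy /hv hz e.
    by rewrite -(huv _ hy) -(huv _ hz) e.
  + rewrite i2 map_inj_in_uniq ?(perm_uniq hp); last first.
      move=> y z; rewrite !(perm_mem hp) => /he hy /he hz e.
      by rewrite -(hue _ hy) -(hue _ hz) e.
    by have /andP[] := allP hsize _ (lf_in p f).
  + move=> e; rewrite i2 (lEF p) -(perm_mem hp); apply/mapP/idP => [[z zs ->]|h].
      by rewrite hue // he // -(perm_mem hp).
    by exists (le e); rewrite ?ueK.
move=> v; have /and4P[hc u2 hp1 hp2] := allP hfan _ (lv_in p v).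
set s := vertex_fan LF (lv v) in hc u2 hp1 hp2.
have he y : y \in unzip1 s -> y \in dodeca_edges /\ on_edge (lv v) y.
  by rewrite (perm_mem hp1) mem_filter => /andP[].
have hf y : y \in unzip2 s -> y \in LF.
  by rewrite (perm_mem hp2) mem_filter => /andP[].
exists [seq (ue z.1, uf z.2) | z <- s].
have i1 : unzip1 [seq (ue z.1, uf z.2) | z <- s] = map ue (unzip1 s) by rewrite /unzip1 -!map_comp.
have i2 : unzip2 [seq (ue z.1, uf z.2) | z <- s] = map uf (unzip2 s) by rewrite /unzip2 -!map_comp.
split.
- rewrite cycle_map; apply: (sub_in_cycle (P := mem s)) hc; last by apply/allP.
  move=> y z ys zs /and3P[h1 h2 h3].
  have [y1 _] := he _ (map_f _ ys); have [z1 _] := he _ (map_f _ zs).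
  have y2 := hf _ (map_f _ ys).
  rewrite /= /fan_step /= !(lEF p) !hue // !huf // h2 h3 !andbT.
  by apply: contra_neq h1 => e; rewrite -(hue _ y1) -(hue _ z1) e.
- rewrite i1 map_inj_in_uniq ?(perm_uniq hp1) ?filter_uniq ?dodeca_edges_uniq //.
  move=> y z /he[hy _] /he[hz _] e; by rewrite -(hue _ hy) -(hue _ hz) e.
- rewrite i2 map_inj_in_uniq // => y z /hf hy /hf hz e.
  by rewrite -(huf _ hy) -(huf _ hz) e.
- move=> e; rewrite i1 (lVE p); apply/mapP/idP => [[z /he[h1 h2] ->]|h]; first by rewrite hue.
  by exists (le e); rewrite ?ueK // (perm_mem hp1) mem_filter h le_in.
move=> f; rewrite i2; apply/mapP/existsP => [[z zs ->]|[e /andP[h1 h2]]].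
  move: (zs); rewrite (perm_mem hp2) mem_filter => /andP[/hasP[e ez ie] zF].
  have /and5P[_ _ _ _ /allP hee] := allP hwalk _ zF.
  by exists (ue e); rewrite (lVE p) (lEF p) huf // hue ?ie // hee.
exists (lf f); rewrite ?ufK // (perm_mem hp2) mem_filter lf_in andbT.
by apply/hasP; exists (le e); rewrite -?(lVE p) -?(lEF p).
Qed.

End Presented.

(** * Rigidity of map automorphisms *)

Section Rigidity.
Variable M : cells.
Hypothesis hM : is_map M.
Hypothesis hF : forall f : face M, exists e, inEF e f.
Implicit Types g h : cell_perm M.

Lemma Gamma_inVE g v e : g \in Gamma M -> inVE (g.1.1 v) (g.1.2 e) = inVE v e.
Proof. by rewrite inE => /andP[/'forall_forallP h _]; apply/eqP. Qed.

Lemma Gamma_inEF g e f : g \in Gamma M -> inEF (g.1.2 e) (g.2 f) = inEF e f.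
Proof. by rewrite inE => /andP[_ /'forall_forallP h]; apply/eqP. Qed.

Definition move_flag g (z : vertex M * edge M * face M) := (g.1.1 z.1.1, g.1.2 z.1.2, g.2 z.2).

Lemma move_flagM g h z : move_flag (g * h)%g z = move_flag h (move_flag g z).
Proof. by rewrite /move_flag /= !permM. Qed.

Lemma move_flag1 z : move_flag 1%g z = z.
Proof. by case: z => -[v e] f; rewrite /move_flag /= !perm1. Qed.

(** An automorphism that fixes an edge with its ends and its sides also fixes the second edge of
    every corner on it, and this spreads over the connected map. *)
Lemma rigid1 g z : g \in Gamma M -> is_flag z -> move_flag g z = z -> g = 1%g.
Proof.
case: z => -[v0 e0] f0 gG /andP[/= ve0 ef0] [gv0 ge0 gf0].
pose S e := [/\ g.1.2 e = e, forall v, inVE v e -> g.1.1 v = v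
  & forall f, inEF e f -> g.2 f = f].
have Send v e : inVE v e -> g.1.2 e = e -> g.1.1 v = v -> forall w, inVE w e -> g.1.1 w = w.
  move=> ve ge gv w we; have [x [xv xe hx]] := other_end hM ve.
  case: (hx _ we) => -> //.
  have : inVE (g.1.1 x) e by rewrite -ge (Gamma_inVE _ _ gG).
  by case/hx => // e1; case/eqP: xv; apply: (@perm_inj _ g.1.1); rewrite e1 gv.
have Sside f e : inEF e f -> g.1.2 e = e -> g.2 f = f -> forall f', inEF e f' -> g.2 f' = f'.
  move=> ve ge gv w we; have [x [xv xe hx]] := other_side hM ve.
  case: (hx _ we) => -> //.
  have : inEF e (g.2 x) by rewrite -ge (Gamma_inEF _ _ gG).
  by case/hx => // e1; case/eqP: xv; apply: (@perm_inj _ g.2); rewrite e1 gv.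
have allS : forall e, S e.
  apply: (edge_connected hM (S := S) (e0 := e0)).
    by split=> //; [apply: Send ve0 _ _|apply: Sside ef0 _ _].
  move=> v f e e' ve ve' ef e'f [he hv hf].
  have [x [xe vx xf hx]] := corner hM ve ef.
  have gv := hv _ ve; have gf := hf _ ef.
  have gx : g.1.2 x = x.
    have h1 : inVE v (g.1.2 x) by rewrite -[v]gv (Gamma_inVE _ _ gG).
    have h2 : inEF (g.1.2 x) f by rewrite -[f]gf (Gamma_inEF _ _ gG).
    case: (hx _ h1 h2) => // e1; case/eqP: xe; apply: (@perm_inj _ g.1.2).
    by rewrite e1 he.
  case: (hx _ ve' e'f) => ->; first by split.
  by split; [|apply: (Send v)|apply: (Sside f)].
have p1 : g.1.1 = 1%g.
  apply/permP => v; rewrite perm1; have [s [_ _ _ ms hs]] := vertex_star hM v.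
  have /card_gt0P[e] : 0 < #|[set e | inVE v e]|.
    rewrite lt0n; apply/eqP => h0; have hn e : inVE v e = false.
      by have := card0_eq h0 e; rewrite inE.
    have [v0v|v0v] := eqVneq v v0; first by subst v; rewrite hn in ve0.
    have /connectP[p] := map_connected hM v v0.
    case: p => [_ e1|w p /= /andP[/existsP[e]]]; first by rewrite e1 eqxx in v0v.
    by rewrite hn.
  by rewrite inE => ve; have [_ h _] := allS e; apply: h.
have p2 : g.1.2 = 1%g by apply/permP => e; rewrite perm1; have [] := allS e.
have p3 : g.2 = 1%g.
  by apply/permP => f; rewrite perm1; have [e ef] := hF f; have [_ _ h] := allS e; apply: h.
by case: g p1 p2 p3 {gG gv0 ge0 gf0 Send Sside allS S} => -[a b] c /= -> -> ->.
Qed.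

Lemma rigid g h z : g \in Gamma M -> h \in Gamma M -> is_flag z ->
  move_flag g z = move_flag h z -> g = h.
Proof.
move=> gG hG fz e; apply/eqP; rewrite eq_mulgV1; apply/eqP.
apply: (rigid1 _ fz); first by rewrite groupM ?groupV.
by rewrite move_flagM e -move_flagM mulgV move_flag1.
Qed.

Lemma move_is_flag g z : g \in Gamma M -> is_flag (move_flag g z) = is_flag z.
Proof. by move=> gG; rewrite /is_flag /= Gamma_inVE ?Gamma_inEF. Qed.

End Rigidity.

(** * Automorphisms and flag orbits of the tables *)

Notation flag_label := (nat * edge_label * face_label)%type (only parsing).

Definition flag_perm (q : seq nat) (l : flag_label) : flag_label :=
  (nth 0 q l.1.1, edge_perm q l.1.2, face_perm q l.2).

Definition auto_ok (LF : seq face_label) (q : seq nat) : bool :=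
  [&& all (fun i => i \in iota 0 20) q, uniq q, size q == 20,
      all (fun e => e \in dodeca_edges) (map (edge_perm q) dodeca_edges),
      uniq (map (edge_perm q) dodeca_edges),
      all (fun f => f \in LF) (map (face_perm q) LF), uniq (map (face_perm q) LF),
      all (fun e => all (fun i => on_edge (nth 0 q i) (edge_perm q e) == on_edge i e) (iota 0 20))
        dodeca_edges &
      all (fun f : seq (nat * nat) =>
        all (fun e => (edge_perm q e \in face_perm q f) == (e \in f)) dodeca_edges) LF].

(* The combinatorial automorphism which fixes vertex 18 and a face there and
   reflects the face: it exchanges a long edge and a short one. *)
Definition exchange : seq nat :=
  [:: 0; 15; 16; 8; 10; 5; 19; 13; 3; 9; 4; 17; 12; 7; 14; 1; 2; 11; 18; 6].

Definition dodeca_roots : seq zvec := [:: dodecahedron.2.1.1; dodecahedron.2.1.2; dodecahedron.2.2].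

Definition base_flag (x : bool) : flag_label :=
  (18, (1, 18), head [::] [seq f : seq (nat * nat) <- dodeca_faces x | (1, 18) \in f]).

Definition flag_orbit (l : flag_label) : seq flag_label :=
  closure 15 (map flag_perm (map (refl_perm dodeca) dodeca_roots)) [:: l].

(** The 240 flags are covered by two orbits of the group generated by the roots, linked by
    [exchange]; this yields regularity and index at most 2. The second clause yields the single
    orbit of vertices. *)
Definition flags_ok (x : bool) : bool :=
  let O0 := flag_orbit (base_flag x) in let O1 := flag_orbit (flag_perm exchange (base_flag x)) in
  all (fun f => all (fun e => all (fun i => ((i, e, f) \in O0) || ((i, e, f) \in O1)) [:: e.1; e.2]) f)
    (dodeca_faces x) && all (fun i => has (fun z => z.1.1 == i) O0) (iota 0 20).

Lemma all_flags_ok x : flags_ok x.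
Proof. by case: x; vm_cast_no_check (erefl true). Qed.

Lemma exchange_ok x : auto_ok (dodeca_faces x) exchange.
Proof. by case: x; vm_compute. Qed.

Lemma roots_ok x : {in dodeca_roots, forall r, auto_ok (dodeca_faces x) (refl_perm dodeca r)}.
Proof. by apply/allP; case: x; vm_compute. Qed.

Lemma base_flagP x : [&& (base_flag x).2 \in dodeca_faces x, (base_flag x).1.2 \in (base_flag x).2 &
  (base_flag x).1.2 \in dodeca_edges].
Proof. by case: x; vm_compute. Qed.

Section Symmetries.
Variables (M : cells) (x : bool).
Local Notation LF := (dodeca_faces x).
Variable p : presentation M LF.
Local Notation lv := (lv p).
Local Notation le := (le p).
Local Notation lf := (lf p).

Definition induces_perm (g : cell_perm M) (q : seq nat) : Prop :=
  [/\ forall v, lv (g.1.1 v) = nth 0 q (lv v), forall e, le (g.1.2 e) = edge_perm q (le e)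
    & forall f, lf (g.2 f) = face_perm q (lf f)].

Definition flag_label_of (z : vertex M * edge M * face M) : flag_label :=
  (lv z.1.1, le z.1.2, lf z.2).

Lemma flag_label_inj : injective flag_label_of.
Proof. by move=> [[v e] f] [[v' e'] f'] [/(lv_inj (p := p)) -> /(le_inj (p := p)) -> /(lf_inj (p := p)) ->]. Qed.

Lemma induces_perm_flag g q z : induces_perm g q ->
  flag_label_of (move_flag g z) = flag_perm q (flag_label_of z).
Proof. by case: z => -[v e] f [h1 h2 h3]; rewrite /flag_label_of /flag_perm /= h1 h2 h3. Qed.

Lemma induced_exists q : auto_ok LF q -> exists2 g, g \in Gamma M & induces_perm g q.
Proof.
case/and5P => /allP qin qu /eqP qs /allP qE /and5P[qEu /allP qF qFu /allP qVE /allP qEF].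
have [uv [ue [uf [huv hue huf]]]] := unlabel p.
have vin v : nth 0 q (lv v) \in iota 0 20.
  by apply: qin; apply: mem_nth; rewrite qs; have := lv_in p v; rewrite mem_iota.
have ein e : edge_perm q (le e) \in dodeca_edges by apply: qE; apply: map_f; apply: le_in.
have fin f : face_perm q (lf f) \in LF by apply: qF; apply: map_f; apply: lf_in.
have i1 : injective (fun v => uv (nth 0 q (lv v))).
  move=> v w /(congr1 lv); rewrite !huv // => /eqP.
  have lt u : lv u < size q by rewrite qs; have := lv_in p u; rewrite mem_iota.
  by rewrite nth_uniq // => /eqP/(lv_inj (p := p)).
have i2 : injective (fun e => ue (edge_perm q (le e))).
  move=> v w /(congr1 le); rewrite !hue // => e.
  exact: (le_inj (p := p)) (uniq_map_inj qEu (le_in p v) (le_in p w) e).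
have i3 : injective (fun f => uf (face_perm q (lf f))).
  move=> v w /(congr1 lf); rewrite !huf // => e.
  exact: (lf_inj (p := p)) (uniq_map_inj qFu (lf_in p v) (lf_in p w) e).
exists (perm i1, perm i2, perm i3); last first.
  by split=> c /=; rewrite permE ?huv ?hue ?huf.
rewrite inE; apply/andP; split; apply/'forall_forallP => c d /=; rewrite !permE.
  by rewrite !(lVE p) huv // hue //; apply: (allP (qVE _ (le_in p d)) _ (lv_in p c)).
by rewrite !(lEF p) huf // hue //; apply: (allP (qEF _ (lf_in p d)) _ (le_in p c)).
Qed.

Variable H : {group cell_perm M}.
Hypothesis HG : H \subset Gamma M.
Hypothesis root_H : forall r, r \in dodeca_roots ->
  exists2 g, g \in H & induces_perm g (refl_perm dodeca r).

Let hM : is_map M. Proof. exact: presented_map p. Qed.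
Let hF (f : face M) : exists e, inEF e f.
Proof.
have /card_gt0P[e] : 0 < face_size f by rewrite (presented_face_size p).
by rewrite inE; exists e.
Qed.

Lemma is_flag_label z : is_flag z = on_edge (lv z.1.1) (le z.1.2) && (le z.1.2 \in lf z.2).
Proof. by rewrite /is_flag (lVE p) (lEF p). Qed.

Lemma flag_orbitP z l : l \in flag_orbit (flag_label_of z) ->
  exists2 g, g \in H & flag_label_of (move_flag g z) = l.
Proof.
move: l; apply: (@closure_ind _ _ _ _ (fun l => exists2 g, g \in H & flag_label_of (move_flag g z) = l))
  => [l'|h hin l' [g gH <-]].
  by rewrite inE => /eqP ->; exists 1%g; rewrite ?group1 ?move_flag1.
have [q qin <-] := In_map hin; have /mapP[r rin er] := qin.
have [g' g'H ig] := root_H rin; exists (g * g')%g; first exact: groupM.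
by rewrite er move_flagM (induces_perm_flag _ ig).
Qed.

Local Opaque flag_orbit.

Lemma base_flag_exists : exists2 z, is_flag z & flag_label_of z = base_flag x.
Proof.
have /and3P[h1 h2 h3] := base_flagP x.
have [v ev] : exists v, lv v = 18 by apply: lv_surj; rewrite mem_iota.
have [e ee] := le_surj p h3; have [f ef] := lf_surj p h1.
exists (v, e, f); last by rewrite /flag_label_of /= ev ee ef.
by rewrite is_flag_label /= ev ee ef h2.
Qed.

Lemma exchange_exists : exists2 g, g \in Gamma M & induces_perm g exchange.
Proof. by exact: induced_exists (exchange_ok x). Qed.

Lemma flags_reached rho z0 : induces_perm rho exchange -> is_flag z0 -> flag_label_of z0 = base_flag x ->
  forall z, is_flag z -> exists2 g, g \in H & z = move_flag g z0 \/ z = move_flag (rho * g)%g z0.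
Proof.
move=> ir fz0 e0 z; rewrite is_flag_label => /andP[ve ef].
have /andP[/allP/(_ _ (lf_in p z.2))/allP/(_ _ ef)/allP h _] := all_flags_ok x.
have {h} : flag_label_of z \in flag_orbit (base_flag x) \/
    flag_label_of z \in flag_orbit (flag_perm exchange (base_flag x)).
  have hin : lv z.1.1 \in [:: (le z.1.2).1; (le z.1.2).2] by rewrite !inE.
  exact: (orP (h _ hin)).
rewrite -e0 -(induces_perm_flag _ ir) => -[] /flag_orbitP[g gH /flag_label_inj e].
  by exists g; [|left].
by exists g; [|right; rewrite move_flagM].
Qed.

Lemma presented_regular : regular M.
Proof.
move=> y z fy fz; have [rho rG ir] := exchange_exists; have [z0 f0 e0] := base_flag_exists.
have reach u : is_flag u -> exists2 g, g \in Gamma M & u = move_flag g z0.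
  move=> /(flags_reached ir f0 e0)[g /(fintype.subsetP HG) gG [->|->]]; first by exists g.
  by exists (rho * g)%g; rewrite ?groupM.
have [g gG ->] := reach y fy; have [h hG ->] := reach z fz.
exists (g^-1 * h)%g; first by rewrite groupM ?groupV.
by rewrite -/(move_flag _ _) -move_flagM mulKVg.
Qed.

(** An automorphism is determined by the image of one flag, so the two flag orbits make [Gamma M]
    the union of [H] and [rho *: H]; these are disjoint since [rho] is not in [H]. *)
Lemma presented_index2 : (forall g, induces_perm g exchange -> g \notin H) -> #|Gamma M : H|%g = 2.
Proof.
move=> notH; have [rho rG ir] := exchange_exists; have [z0 f0 e0] := base_flag_exists.
have GE : Gamma M = (H :|: rho *: H)%g.
  apply/finset.setP => g; rewrite finset.in_setU; apply/idP/orP => [gG|[/(fintype.subsetP HG)//|]]; last first.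
    by case/lcosetP => h /(fintype.subsetP HG) hG ->; rewrite groupM.
  have fz : is_flag (move_flag g z0) by rewrite move_is_flag.
  have [h hH [] e] := flags_reached ir f0 e0 fz; have hG := fintype.subsetP HG _ hH.
    by left; rewrite (rigid hM hF gG hG f0 e).
  right; rewrite (rigid hM hF gG _ f0 e) ?groupM //.
  by apply/lcosetP; exists h.
have := Lagrange HG.
have -> : #|Gamma M| = 2 * #|H|.
  rewrite GE cardsU card_lcoset mul2n addnn.
  suff -> : (H :&: rho *: H)%g = finset.set0 by rewrite cards0 subn0.
  apply/finset.setP => h; rewrite !inE; apply/negP => /andP[hH /lcosetP[k kH e]].
  by have := notH _ ir; rewrite -(mulgK k rho) -e groupM ?groupV.
by rewrite mulnC => /eqP; rewrite eqn_pmul2r ?cardG_gt0 // => /eqP.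
Qed.

Lemma presented_one_orbit u v : exists2 g, g \in H & g.1.1 u = v.
Proof.
have [z0 f0 e0] := base_flag_exists.
have reach w : exists2 g, g \in H & g.1.1 z0.1.1 = w.
  have /andP[_ /allP h] := all_flags_ok x.
  have /hasP[l] := h _ (lv_in p w); rewrite -e0 => /flag_orbitP[g gH <-] /eqP.
  by move=> /(lv_inj (p := p)) e; exists g.
have [g gH <-] := reach u; have [h hH <-] := reach v.
by exists (g^-1 * h)%g; rewrite ?groupM ?groupV //= permM permK.
Qed.

End Symmetries.

Local Open Scope ring_scope.

(** * Figures that place the tables injectively in space *)

Section Table.
Variables (R : realType) (x : bool) (P : nat -> 'rV[R]_3).
Hypothesis P_inj : forall i j, (i < 20)%N -> (j < 20)%N -> P i = P j -> i = j.
Local Notation LF := (dodeca_faces x).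
Local Notation X := (table_figure P LF).
Local Notation M := (map_of X).

Lemma dodeca_edges_small e : e \in dodeca_edges -> small e /\ (e.1 < e.2)%N.
Proof. by move=> /dodeca_edges_lt/andP[h1 h2]; rewrite /small h2 (ltn_trans h1 h2). Qed.

Lemma table_presentation : exists p : presentation M LF,
  [/\ forall v, val v = P (lv p v), forall e, val e = segment P (le p e)
    & forall f, val f = polygon P (lf p f)].
Proof.
have [|tv htv] := @choice (vertex M) nat (fun v i => i \in iota 0 20 /\ val v = P i).
  by move=> v; have /imfsetP[i /= hi e] := valP v; exists i.
have [|te hte] := @choice (edge M) _ (fun v i => i \in dodeca_edges /\ val v = segment P i).
  by move=> v; have /imfsetP[i /= hi e] := valP v; exists i.
have [|tf htf] := @choice (face M) _ (fun v i => i \in LF /\ val v = polygon P i).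
  by move=> v; have /imfsetP[i /= hi e] := valP v; exists i.
have vin v : (tv v < 20)%N by have [] := htv v; rewrite mem_iota.
have inj1 i : i \in iota 0 20 -> P i \in verts X by move=> hi; apply/imfsetP; exists i.
have inj2 i : i \in dodeca_edges -> segment P i \in edges X by move=> hi; apply/imfsetP; exists i.
have inj3 i : i \in LF -> polygon P i \in faces X by move=> hi; apply/imfsetP; exists i.
have hVE (v : vertex M) (e : edge M) : inVE v e = on_edge (tv v) (te e).
  have [hv ev] := htv v; have [he ee] := hte e; have [/andP[s1 s2] _] := dodeca_edges_small he.
  rewrite /inVE /= ev ee /segment !inE /on_edge; congr orb; apply/eqP/eqP => [/P_inj->//|->//].
have hEF (e : edge M) (f : face M) : inEF e f = (te e \in tf f).
  have [he ee] := hte e; have [hf ef] := htf f; have [s1 s2] := dodeca_edges_small he.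
  by rewrite /inEF /= ee ef (mem_polygon P_inj hf).
unshelve eexists.
  apply: (@Presentation M LF tv te tf) => //.
  - by move=> v w e; apply: val_inj; rewrite (proj2 (htv v)) (proj2 (htv w)) e.
  - by move=> v w e; apply: val_inj; rewrite (proj2 (hte v)) (proj2 (hte w)) e.
  - by move=> v w e; apply: val_inj; rewrite (proj2 (htf v)) (proj2 (htf w)) e.
  - by move=> v; have [] := htv v.
  - by move=> v; have [] := hte v.
  - by move=> v; have [] := htf v.
  - move=> i hi; exists [` inj1 i hi]%fset; have [_ /= h] := htv [` inj1 i hi]%fset.
    by have i20 := hi; rewrite mem_iota in i20; apply/esym/P_inj.
  - move=> i hi; exists [` inj2 i hi]%fset; have [h1 /= h] := hte [` inj2 i hi]%fset.
    have [s1 l1] := dodeca_edges_small hi; have [s2 l2] := dodeca_edges_small h1.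
    by apply/esym/(segment_inj P_inj).
  - move=> i hi; exists [` inj3 i hi]%fset; have [h1 /= h] := htf [` inj3 i hi]%fset.
    by apply/esym/(polygon_inj P_inj hi h1).
by split=> [v|e|f] /=; [have [] := htv v|have [] := hte e|have [] := htf f].
Qed.

Lemma table_is_polyhedron : is_polyhedron X.
Proof.
have [p _] := table_presentation; split.
- move=> e /imfsetP[l /= hl ->] z; have [/andP[s1 s2] _] := dodeca_edges_small hl.
  have hin i : (i < 20)%N -> P i \in verts X.
    move=> hi; apply/imfsetP; exists i => //.
    by suff : i \in iota 0 20 by []; rewrite mem_iota.
  by rewrite /segment !inE => /orP[]/eqP ->; apply: hin.
- move=> f /imfsetP[l /= hl ->] z /polygonP[e el ->].
  apply/imfsetP; exists e => //=; have /and5P[_ /allP/(_ _ hl)/and5P[_ _ _ _ /allP h] _ _ _] := maps_ok x.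
  exact: h.
- exact: presented_map p.
- by move=> f; rewrite (presented_face_size p).
- by move=> v; rewrite (presented_degree p).
Qed.

Lemma table_has_type : has_type M 6 6.
Proof.
have [p _] := table_presentation.
by split=> [f|v]; [rewrite (presented_face_size p)|rewrite (presented_degree p)].
Qed.

Lemma induced_by_isometry (p : presentation M LF) (g : cell_perm M) (s : 'rV[R]_3 -> 'rV[R]_3) q :
  (forall v, val v = P (lv p v)) -> (forall e, val e = segment P (le p e)) ->
  (forall f, val f = polygon P (lf p f)) -> induces_perm p g q -> Defs.isometry s ->
  (forall i, (i < 20)%N -> s (P i) = P (nth 0%N q i)) -> g \in Gsym X.
Proof.
move=> hv he hf [q1 q2 q3] si hs.
have segE e : small e -> image_edge s (segment P e) = segment P (edge_perm q e).
  move=> /andP[h1 h2]; rewrite image_segment /edge_perm segment_pair.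
  by rewrite /segment /= !hs.
have polE f : f \in LF -> image_face s (polygon P f) = polygon P (face_perm q f).
  move=> /dodeca_faces_facts[_ /allP sf _].
  rewrite image_polygon; apply/fsetP => z; apply/polygonP/polygonP => -[e ef ->].
    exists (edge_perm q e); first by rewrite mem_sort map_f.
    by rewrite -segE ?sf // image_segment.
  move: ef; rewrite mem_sort => /mapP[e' e'f ->]; exists e' => //.
  by rewrite -segE ?sf // image_segment.
have vlt v : (lv p v < 20)%N by have := lv_in p v; rewrite mem_iota.
have iv v : val (g.1.1 v) = s (val v) by rewrite !hv q1 hs.
have ie e : val (g.1.2 e) = image_edge s (val e).
  by rewrite !he q2 segE //; have [] := dodeca_edges_small (le_in p e).
have if_ f : val (g.2 f) = image_face s (val f) by rewrite !hf q3 polE ?lf_in.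
rewrite inE; apply/asboolP; exists s; last by split.
split=> //; transitivity (Figure (verts X) (edges X) (faces X)) => //.
(* That [s] maps each set of cells onto itself comes from [g], which permutes the cells. *)
have onto (K : choiceType) (A : {fset K}) (h : {perm A}) (t : K -> K) :
    (forall a, val (h a) = t (val a)) -> [fset t a | a in A]%fset = A.
  move=> ht; apply/fsetP => z; apply/imfsetP/idP => [[a /= aA ->]|zA].
    by rewrite -(ht [` aA]%fset) (valP (h _)).
  exists (val ((h^-1)%g [` zA]%fset)); first exact: valP.
  by rewrite -ht permKV.
rewrite /image_figure; congr Figure.
- exact: (onto _ _ g.1.1).
- exact: (onto _ _ g.1.2).
- exact: (onto _ _ g.2).
Qed.

Hypothesis P_root : forall r, r \in dodeca_roots -> exists2 s, Defs.isometry s &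
  forall i, (i < 20)%N -> s (P i) = P (nth 0%N (refl_perm dodeca r) i).
Hypothesis P_lengths : edist (P 1) (P 18) <> edist (P 15) (P 18).

Lemma table_regular : regular_index2 X /\ one_vertex_orbit X.
Proof.
have [p [hv he hf]] := table_presentation.
have root_H r : r \in dodeca_roots -> exists2 g, g \in Gsym X & induces_perm p g (refl_perm dodeca r).
  move=> rin; have [s si hs] := P_root rin.
  have [g _ ig] := induced_exists p (roots_ok x rin).
  by exists g => //; apply: induced_by_isometry ig si hs.
have sub := Gsym_sub_Gamma X.
(* [exchange] carries the pair 1, 18 to the pair 15, 18, whose distance is different. *)
have not_sym g : induces_perm p g exchange -> g \notin Gsym X.
  move=> [q1 _ _]; apply/negP; rewrite inE => /asboolP[s [si _] [iv _ _]].
  have vtx i : (i < 20)%N -> s (P i) = P (nth 0%N exchange i).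
    move=> hi; have [v ev] : exists v, lv p v = i by apply: lv_surj; rewrite mem_iota.
    by rewrite -ev -q1 -!hv iv.
  by apply: P_lengths; rewrite -(si (P 1)) !vtx.
split; last by move=> u v; apply: (presented_one_orbit root_H).
split; first exact: table_is_polyhedron.
  exact: (presented_regular sub root_H).
exact: (presented_index2 sub root_H).
Qed.
End Table.

Local Open Scope nat_scope.

Notation arc := (nat * (nat * nat))%type (only parsing).

(** * Petrie polygons *)

Definition share (LF : seq face_label) (es : seq edge_label) : bool :=
  has (fun f : seq (nat * nat) => all (fun e => e \in f) es) LF.

Definition arcs_at (i : nat) : seq arc := [seq (i, e) | e <- [seq e <- dodeca_edges | on_edge i e]].

Definition arcs : seq arc := flatten [seq arcs_at i | i <- iota 0 20].

Lemma mem_arcs_at i c : (c \in arcs_at i) = [&& c.1 == i, c.2 \in dodeca_edges & on_edge i c.2].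
Proof.
case: c => j e; rewrite /arcs_at; move: dodeca_edges => E.
apply/mapP/and3P => [[e']|[/eqP h1 h2 h3]].
  by rewrite mem_filter => /andP[ie hE] [-> ->]; split.
by exists e; rewrite ?mem_filter ?h3 //= -h1.
Qed.

Lemma mem_arcs c : (c \in arcs) = [&& c.1 \in iota 0 20, c.2 \in dodeca_edges & on_edge c.1 c.2].
Proof.
case: c => i0 e0; rewrite /arcs /arcs_at; move: (iota 0 20) dodeca_edges => I E.
apply/flattenP/and3P => [[l /mapP[i hi ->] /mapP[e]]|[h1 h2 h3]].
  by rewrite mem_filter => /andP[ie hE] [-> ->]; split.
exists [seq (i0, e) | e <- E & on_edge i0 e]; first by apply/mapP; exists i0.
by apply/mapP; exists e0; rewrite ?mem_filter ?h3.
Qed.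

Definition arc_cands (LF : seq face_label) (b : arc) : seq arc :=
  [seq c <- arcs_at (other_vertex b.1 b.2) | share LF [:: b.2; c.2]].

Lemma mem_arc_cands LF b c : (c \in arc_cands LF b) =
  share LF [:: b.2; c.2] && (c \in arcs_at (other_vertex b.1 b.2)).
Proof. by rewrite /arc_cands; move: (arcs_at _) => A; rewrite mem_filter. Qed.

Definition petrie_cands (LF : seq face_label) (s : arc * arc) : seq arc :=
  [seq c <- arc_cands LF s.2 | ~~ share LF [:: s.1.2; s.2.2; c.2]].

Lemma mem_petrie_cands LF s c : (c \in petrie_cands LF s) =
  ~~ share LF [:: s.1.2; s.2.2; c.2] && (c \in arc_cands LF s.2).
Proof. by rewrite /petrie_cands; move: (arc_cands _ _) => A; rewrite mem_filter. Qed.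

(** Two consecutive arcs determine a Petrie polygon; [petrie_state_ok] shows that the list of
    candidates is a singleton, so the default of [head] is never taken. *)
Definition petrie_next (LF : seq face_label) (s : arc * arc) : arc * arc :=
  (s.2, head (0, (0, 0)) (petrie_cands LF s)).

Definition petrie_states (LF : seq face_label) : seq (arc * arc) :=
  flatten [seq [seq (a, b) | b <- [seq b <- arc_cands LF a | b.2 != a.2]] | a <- arcs].

Lemma mem_petrie_states LF s : (s \in petrie_states LF) =
  [&& s.1 \in arcs, s.2 \in arc_cands LF s.1 & s.2.2 != s.1.2].
Proof.
case: s => a0 b0 /=; rewrite /petrie_states; move: arcs => A.
apply/flattenP/and3P => [[l /mapP[a ha ->] /mapP[b]]|[h1 h2 h3]].
  by rewrite mem_filter => /andP[ie hE] [-> ->]; split.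
exists [seq (a0, b) | b <- arc_cands LF a0 & b.2 != a0.2]; first by apply/mapP; exists a0.
by apply/mapP; exists b0 => //; rewrite mem_filter; apply/andP; split.
Qed.

(** Sorted, so that the edge set can be compared with the face tables as a list. *)
Definition petrie_face (LF : seq face_label) (s : arc * arc) : face_label :=
  sort edge_le [seq t.1.2 | t <- traject (petrie_next LF) s 6].

(** The continuation is unique and again a state, it returns after 6 steps, and the first arc does
    not recur sooner: together, length exactly 6. *)
Definition petrie_state_ok (LF : seq face_label) (S : seq (arc * arc)) (s : arc * arc) : bool :=
  let c := traject (petrie_next LF) s 7 in
  [&& petrie_cands LF s == [:: (nth s c 1).2], nth s c 1 \in S, nth s c 6 == s &
      all (fun i => (nth s c i).1 != s.1) (iota 1 5)].

Lemma petrie_state_okP LF S s : petrie_state_ok LF S s ->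
  [/\ petrie_cands LF s = [:: (petrie_next LF s).2], petrie_next LF s \in S,
      iter 6 (petrie_next LF) s = s &
      forall i, 0 < i < 6 -> (iter i (petrie_next LF) s).1 != s.1].
Proof.
case/and4P => /eqP h1 h2 /eqP; rewrite nth_traject // => h3 /allP h4; split=> //.
move=> i /andP[i0 i6]; have := h4 i; rewrite mem_iota i0 => /(_ i6).
by rewrite nth_traject // (ltn_trans i6).
Qed.

(** A walk may step back along its last edge. The condition on three consecutive edges then concerns
    only two distinct ones, which must share a face, so such a walk has no continuation. *)
Lemma petrie_no_return_table x :
  all (fun a => nilp (petrie_cands (dodeca_faces x) (a, (other_vertex a.1 a.2, a.2)))) arcs.
Proof. by case: x; vm_cast_no_check (erefl true). Qed.

Lemma petrie_states_table x : all (petrie_state_ok (dodeca_faces x) (petrie_states (dodeca_faces x)))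
  (petrie_states (dodeca_faces x)).
Proof. by case: x; vm_cast_no_check (erefl true). Qed.

Lemma petrie_faces_table x :
  perm_eq (undup (map (petrie_face (dodeca_faces x)) (petrie_states (dodeca_faces x))))
    (dodeca_faces (~~ x)).
Proof. by case: x; vm_cast_no_check (erefl true). Qed.

Lemma petrie_no_return x a : a \in arcs ->
  petrie_cands (dodeca_faces x) (a, (other_vertex a.1 a.2, a.2)) = [::].
Proof. by move=> h; apply/nilP; exact: (allP (petrie_no_return_table x) _ h). Qed.

Lemma petrie_stateP x s : s \in petrie_states (dodeca_faces x) ->
  petrie_state_ok (dodeca_faces x) (petrie_states (dodeca_faces x)) s.
Proof. exact: (allP (petrie_states_table x)). Qed.

Lemma petrie_faceP x f :
  reflect (exists2 s, s \in petrie_states (dodeca_faces x) & f = petrie_face (dodeca_faces x) s)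
    (f \in dodeca_faces (~~ x)).
Proof. by rewrite -(perm_mem (petrie_faces_table x)) mem_undup; apply: mapP. Qed.

Local Opaque arcs_at arcs arc_cands petrie_states petrie_cands.

Section PresentedPetrie.
Variables (M : cells) (x : bool).
Local Notation LF := (dodeca_faces x).
Variable p : presentation M LF.
Local Notation lv := (lv p).
Local Notation le := (le p).
Local Notation lf := (lf p).
Implicit Types (a b c : vertex M * edge M) (w : nat -> vertex M * edge M).

Let hM : is_map M. Proof. exact: presented_map p. Qed.

Definition arc_label a : arc := (lv a.1, le a.2).

Lemma arc_label_inj : injective arc_label.
Proof. by move=> [v e] [v' e'] [/(lv_inj (p := p)) -> /(le_inj (p := p)) ->]. Qed.

Lemma share_map (es : seq (edge M)) : reflect (exists f, all (fun e => inEF e f) es) (share LF (map le es)).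
Proof.
have E f : all (fun e => e \in lf f) (map le es) = all (fun e => inEF e f) es.
  by rewrite all_map; apply: eq_all => e; rewrite /= (lEF p).
apply: (iffP hasP) => [[l /(lf_surj p)[f <-]]|[f hf]]; first by rewrite E; exists f.
by exists (lf f); rewrite ?lf_in ?E.
Qed.

Lemma arc_in a : inVE a.1 a.2 -> arc_label a \in arcs_at (lv a.1).
Proof. by move=> h; rewrite mem_arcs_at /= eqxx le_in -(lVE p). Qed.

Lemma arc_in_arcs a : inVE a.1 a.2 -> arc_label a \in arcs.
Proof. by move=> h; rewrite mem_arcs /= lv_in le_in -(lVE p). Qed.

Lemma walk_other a b : walk_step a b -> lv b.1 = other_vertex (lv a.1) (le a.2).
Proof.
case/and3P => n; rewrite !(lVE p) /on_edge /other_vertex.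
have : lv a.1 != lv b.1 by apply: contra_neq n => /(lv_inj (p := p)).
by move: (lv a.1) (lv b.1) (le a.2) => i j [e1 e2] /=; case: ifP; lia.
Qed.

Lemma other_walk a b : inVE a.1 a.2 -> lv b.1 = other_vertex (lv a.1) (le a.2) -> walk_step a b.
Proof.
rewrite (lVE p) => h1 h2; rewrite /walk_step !(lVE p) h1 h2 other_vertexP // !andbT.
have /andP[lt _] := dodeca_edges_lt (le_in p a.2).
apply/eqP => e; move: h1 h2; rewrite e /on_edge /other_vertex.
case: eqP => [-> _ h|_ /= /eqP h1 h2]; first by rewrite h ltnn in lt.
by rewrite -h2 h1 ltnn in lt.
Qed.

Lemma arc_candsP a b : walk_step a b -> inVE b.1 b.2 ->
  (exists f, inEF a.2 f && inEF b.2 f) -> arc_label b \in arc_cands LF (arc_label a).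
Proof.
move=> w vb [f hf]; rewrite mem_arc_cands /= -(walk_other w) (arc_in vb) andbT.
by apply: (introT (share_map [:: a.2; b.2])); exists f; rewrite /= andbT.
Qed.

Lemma petrie_in w n : petrie_polygon w -> inVE (w n).1 (w n).2.
Proof. by move=> /(_ n)[/and3P[]]. Qed.

Definition state_of (w : nat -> vertex M * edge M) n := (arc_label (w n), arc_label (w n.+1)).

Lemma petrie_cands_in w n : petrie_polygon w -> arc_label (w n.+2) \in petrie_cands LF (state_of w n).
Proof.
move=> hw; have [w1 _ hn] := hw n; have [w2 f2 _] := hw n.+1.
rewrite mem_petrie_cands (arc_candsP w2 (petrie_in _ hw) f2) andbT.
apply/negP => /(share_map [:: (w n).2; (w n.+1).2; (w n.+2).2])[f hf].
by apply: hn; exists f; move: hf; rewrite /= andbT.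
Qed.

Lemma petrie_state_in w n : petrie_polygon w -> state_of w n \in petrie_states LF.
Proof.
move=> hw; have [w1 f1 _] := hw n.
rewrite mem_petrie_states /= arc_in_arcs ?petrie_in // (arc_candsP w1 (petrie_in _ hw) f1) /=.
apply/eqP => e2; have := petrie_cands_in n hw.
have -> : state_of w n = (arc_label (w n), (other_vertex (arc_label (w n)).1 (arc_label (w n)).2, (arc_label (w n)).2)).
  by rewrite /state_of /arc_label /= (walk_other w1); congr (_, (_, _)); exact: e2.
by rewrite petrie_no_return ?arc_in_arcs ?petrie_in.
Qed.

Lemma petrie_stateE s : s \in petrie_states LF ->
  [/\ petrie_cands LF s = [:: (petrie_next LF s).2], petrie_next LF s \in petrie_states LF,
      iter 6 (petrie_next LF) s = s &
      forall i, 0 < i < 6 -> (iter i (petrie_next LF) s).1 != s.1].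
Proof. by move=> /petrie_stateP/petrie_state_okP. Qed.

Lemma petrie_state_next w n : petrie_polygon w -> state_of w n.+1 = petrie_next LF (state_of w n).
Proof.
move=> hw; have [h _ _ _] := petrie_stateE (petrie_state_in n hw).
by have := petrie_cands_in n hw; rewrite h inE => /eqP e; congr pair.
Qed.

Lemma petrie_state_iter w n k : petrie_polygon w ->
  state_of w (n + k) = iter k (petrie_next LF) (state_of w n).
Proof. by move=> hw; elim: k => [|k IH]; rewrite ?addn0 // addnS petrie_state_next // IH. Qed.

Lemma presented_petrie_length w : petrie_polygon w -> petrie_length w 6.
Proof.
move=> hw; have per n : w (n + 6) = w n.
  apply: arc_label_inj; have := petrie_state_iter n 6 hw.
  by have [_ _ -> _] := petrie_stateE (petrie_state_in n hw); move/(congr1 fst).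
split; first by split.
move=> r [r0 hr]; rewrite leqNgt; apply/negP => r6.
have [_ _ _ /(_ r)] := petrie_stateE (petrie_state_in 0 hw).
by rewrite r0 -petrie_state_iter // add0n /state_of /= -[r]add0n hr eqxx => /(_ r6).
Qed.

Lemma presented_petrie_faces w e : petrie_polygon w ->
  reflect (exists i, e = (w i).2) (le e \in petrie_face LF (state_of w 0)).
Proof.
move=> hw; rewrite mem_sort; apply: (iffP mapP) => [[s /trajectP[i i6 ->]]|[i ->]].
  by rewrite -petrie_state_iter // add0n => /(le_inj (p := p)) ->; exists i.
have per k : w (k * 6 + i %% 6) = w (i %% 6).
  have [[_ h] _] := presented_petrie_length hw.
  by elim: k => // k IH; rewrite mulSn -addnA addnC h IH.
exists (state_of w (i %% 6)); last by rewrite {1}(divn_eq i 6) per.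
apply/trajectP; exists (i %% 6); first by rewrite ltn_mod.
by rewrite -petrie_state_iter.
Qed.

Lemma in_arcs (c : arc) : c \in arcs -> exists a, inVE a.1 a.2 /\ arc_label a = c.
Proof.
rewrite mem_arcs => /and3P[/(lv_surj p)[v ev] /(le_surj p)[e ee] h].
by exists (v, e); rewrite (lVE p) /arc_label /= ev ee; case: (c) h.
Qed.

(** Every state starts a Petrie polygon: iterating [petrie_next] gives its labels, which are lifted
    to arcs of [M] one by one. *)
Lemma presented_petrie_exists s : s \in petrie_states LF ->
  exists2 w, petrie_polygon w & forall n, state_of w n = iter n (petrie_next LF) s.
Proof.
move=> sS; pose st n := iter n (petrie_next LF) s.
have stS n : st n \in petrie_states LF.
  by elim: n => // n; rewrite /st iterS => /petrie_stateE[].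
have [|w hw] := @choice nat (vertex M * edge M) (fun n a => inVE a.1 a.2 /\ arc_label a = (st n).1).
  move=> n; have := stS n; rewrite mem_petrie_states => /and3P[/in_arcs[a h] _ _].
  by exists a.
have st2 n : (st n).2 = (st n.+1).1 by [].
exists w; last by move=> n; rewrite /state_of (proj2 (hw n)) (proj2 (hw n.+1)) -st2 -surjective_pairing.
move=> n; have [[v0 l0] [v1 l1] [v2 l2]] := And3 (hw n) (hw n.+1) (hw n.+2).
have := stS n; rewrite mem_petrie_states st2 -l0 -l1 mem_arc_cands mem_arcs_at => /and3P[_ /and4P[sh /eqP ee _ _] _].
have := petrie_stateE (stS n) => -[hc _ _ _].
have : arc_label (w n.+2) \in petrie_cands LF (arc_label (w n), arc_label (w n.+1)).
  by rewrite l0 l1 -st2 -surjective_pairing hc l2 inE.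
rewrite mem_petrie_cands => /andP[nsh _]; split.
- by apply: other_walk => //; exact: ee.
- by move: sh => /(share_map [:: (w n).2; (w n.+1).2])[f /and3P[h1 h2 _]]; exists f; rewrite h1 h2.
case=> f hf; case/negP: nsh.
by apply: (introT (share_map [:: (w n).2; (w n.+1).2; (w n.+2).2])); exists f; rewrite /= andbT.
Qed.

End PresentedPetrie.

(** * Orientability *)

(* The faces along which [face_walk] runs in the wrong direction. *)
Definition face_flips : seq bool :=
  [:: false; false; false; false; false; true; true; true; true; true;
      true; true; true; false; false; true; false; true; false; true].

(** The vertex from which the walk around [f] enters [e], or the other end if the face is
    flipped. *)
Definition tail_label (f : face_label) (e : edge_label) : nat :=
  let c := nth (0, e) (face_walk f) (index e (unzip2 (face_walk f))) in
  if nth false face_flips (index f (dodeca_faces false)) then other_vertex c.1 e else c.1.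

Definition coherent (LF : seq face_label) (tl : face_label -> edge_label -> nat) : bool :=
  all (fun f : seq (nat * nat) =>
    all (fun e => on_edge (tl f e) e && all (fun e' => (tl f e == tl f e') ==> (e == e')) f) f) LF &&
  all (fun f : seq (nat * nat) => all (fun f' : seq (nat * nat) => (f == f') ||
    all (fun e => (e \in f') ==> (tl f e != tl f' e)) f) LF) LF.

Lemma coherentP LF tl : coherent LF tl ->
  [/\ forall f e, f \in LF -> e \in f -> on_edge (tl f e) e,
      forall f e e', f \in LF -> e \in f -> e' \in f -> tl f e = tl f e' -> e = e'
    & forall e f f', f \in LF -> f' \in LF -> e \in f -> e \in f' -> f != f' -> tl f e != tl f' e].
Proof.
move=> /andP[/allP h1 /allP h2]; split.
- by move=> f e fF ef; have /andP[] := allP (h1 f fF) e ef.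
- move=> f e e' fF ef ef' e_; have /andP[_ /allP/(_ _ ef')/implyP h] := allP (h1 f fF) e ef.
  by apply/eqP/h; rewrite e_.
move=> e f f' fF fF' ef ef' n; have := allP (h2 f fF) f' fF'.
by rewrite (negPf n) => /allP/(_ _ ef)/implyP; apply.
Qed.

Lemma tails_coherent : coherent (dodeca_faces false) tail_label.
Proof. by vm_compute. Qed.

(** How a coherent orientation propagates within a face: the other edge of the face at the tail of
    the given edge cannot start there, so it starts at its far end. *)
Definition turn_tail (t : face_label * edge_label * nat) : face_label * edge_label * nat :=
  let e := next_edge t.2 t.1.2 t.1.1 in (t.1.1, e, other_vertex t.2 e).

(** Propagation across an edge: the second face at the edge runs along it in the opposite
    direction. *)
Definition cross_tail (LF : seq face_label) (t : face_label * edge_label * nat) :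
    face_label * edge_label * nat :=
  (other_face LF t.1.2 t.1.1, t.1.2, other_vertex t.2 t.1.2).

Definition base_face : face_label := Eval vm_compute in
  head [::] [seq f : seq (nat * nat) <- dodeca_faces true | (1, 18) \in f].

Definition tail_closure (i : nat) : seq (face_label * edge_label * nat) :=
  closure 12 [:: turn_tail; cross_tail (dodeca_faces true)] [:: (base_face, (1, 18), i)].

(* Whichever end the edge starts at, coherence forces it to start at the other. *)
Lemma tail_closure_table :
  all (fun i => (base_face, (1, 18), other_vertex i (1, 18)) \in tail_closure i) [:: 1; 18].
Proof. vm_cast_no_check (erefl true). Qed.

Lemma coherent_orientable (M : cells) x (p : presentation M (dodeca_faces x)) tl :
  coherent (dodeca_faces x) tl -> orientable M.
Proof.
case/coherentP => h1 h2 h3; have [uv [ue [uf [huv hue huf]]]] := unlabel p.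
have ok f e : inEF e f -> on_edge (tl (lf p f) (le p e)) (le p e).
  by rewrite (lEF p); exact: h1 (lf_in p f).
have vin f e : inEF e f -> tl (lf p f) (le p e) \in iota 0 20.
  move=> /ok h; have /andP[l1 l2] := dodeca_edges_lt (le_in p e); rewrite mem_iota add0n.
  by case/orP: h => /eqP ->; rewrite ?(ltn_trans l1).
exists (fun f e => uv (tl (lf p f) (le p e))); split.
- by move=> f e ef; rewrite (lVE p) huv ?vin ?ok.
- move=> f e e' ef e'f /(congr1 (lv p)); rewrite !huv ?vin //; move: ef e'f; rewrite !(lEF p) => ef e'f.
  by move=> /(h2 _ _ _ (lf_in p f) ef e'f); apply: le_inj.
move=> e f f' ef ef' nf; apply/eqP => /(congr1 (lv p)); rewrite !huv ?vin //; apply/eqP.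
move: ef ef'; rewrite !(lEF p) => ef ef'; apply: h3; rewrite ?lf_in //.
by apply: contra_neq nf; apply: lf_inj.
Qed.

Lemma presented_orientable (M : cells) : presentation M (dodeca_faces false) -> orientable M.
Proof. by move=> p; apply: coherent_orientable p _ tails_coherent. Qed.

Lemma next_edgeP i e (f : face_label) e' : e' \in f -> on_edge i e' -> e' != e ->
  [/\ next_edge i e f \in f, on_edge i (next_edge i e f) & next_edge i e f != e].
Proof.
move=> ef ie n; rewrite /next_edge.
have : e' \in [seq e' <- f | on_edge i e' && (e' != e)] by rewrite mem_filter ie n ef.
case E : [seq _ <- _ | _] => [|e1 s] //= _.
have : e1 \in [seq e' <- f | on_edge i e' && (e' != e)] by rewrite E mem_head.
by rewrite mem_filter => /andP[/andP[]].
Qed.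

Lemma other_faceP (LF : seq face_label) e (f f' : face_label) : f' \in LF -> e \in f' -> f' != f ->
  [/\ other_face LF e f \in LF, e \in other_face LF e f & other_face LF e f != f].
Proof.
move=> ef ie n; rewrite /other_face.
have : f' \in [seq g : seq (nat * nat) <- LF | (e \in g) && (g != f)] by rewrite mem_filter ie n ef.
case E : [seq _ <- _ | _] => [|e1 s] //= _.
have : e1 \in [seq g : seq (nat * nat) <- LF | (e \in g) && (g != f)] by rewrite E mem_head.
by rewrite mem_filter => /andP[/andP[]].
Qed.

Section Tails.
Variables (M : cells) (x : bool).
Local Notation LF := (dodeca_faces x).
Variable p : presentation M LF.
Variable tail : face M -> edge M -> vertex M.
Hypothesis tail_end : forall f e, inEF e f -> inVE (tail f e) e.
Hypothesis tail_inj : forall f e e', inEF e f -> inEF e' f -> tail f e = tail f e' -> e = e'.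
Hypothesis tail_opp : forall e f f', inEF e f -> inEF e f' -> f != f' -> tail f e != tail f' e.

Definition is_tail (t : face_label * edge_label * nat) : Prop :=
  exists f e, [/\ inEF e f, t.1.1 = lf p f, t.1.2 = le p e & t.2 = lv p (tail f e)].

Let hM : is_map M. Proof. exact: presented_map p. Qed.

Lemma turn_is_tail t : is_tail t -> is_tail (turn_tail t).
Proof.
case: t => [[lf0 le0] i] [f [e [ef /= -> -> ->]]]; set v := tail f e; have ve : inVE v e := tail_end ef.
have [e1 [n1 ve1 e1f he1]] := corner hM ve ef.
have [|||g1 g2 g3] := @next_edgeP (lv p v) (le p e) (lf p f) (le p e1).
- by rewrite -(lEF p).
- by rewrite -(lVE p).
- by apply: contra_neq n1; apply: le_inj.
have [e2 ee2] : exists e2, le p e2 = next_edge (lv p v) (le p e) (lf p f).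
  have /and5P[_ /allP/(_ _ (lf_in p f))/and5P[_ _ _ _ /allP h] _ _ _] := maps_ok x.
  by apply: le_surj; apply: h.
move: g1 g2 g3; rewrite /turn_tail /= -ee2 -(lEF p) -(lVE p) => g1 g2 g3.
exists f, e2; split=> //=.
have n2 : v != tail f e2.
  by apply: contra_neq g3 => e3; congr le; apply/esym/(tail_inj ef g1).
by rewrite (@walk_other _ _ p (v, e2) (tail f e2, e2)) // /walk_step /= g2 n2 tail_end.
Qed.

Lemma cross_is_tail t : is_tail t -> is_tail (cross_tail LF t).
Proof.
case: t => [[lf0 le0] i] [f [e [ef /= -> -> ->]]]; set v := tail f e; have ve : inVE v e := tail_end ef.
have [f1 [n1 ef1 _]] := other_side hM ef.
have [||g1 g2 g3] := other_faceP (e := le p e) (f := lf p f) (lf_in p f1).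
- by rewrite -(lEF p).
- by apply: contra_neq n1; apply: lf_inj.
have [f2 ef2] := lf_surj p g1; move: g2 g3; rewrite /cross_tail /= -ef2 -(lEF p) => g2 g3.
exists f2, e; split=> //=.
have n2 : f != f2 by apply: contra_neq g3 => ->.
by rewrite (@walk_other _ _ p (v, e) (tail f2 e, e)) // /walk_step /= ve tail_end ?tail_opp.
Qed.

End Tails.

Lemma presented_nonorientable (M : cells) : presentation M (dodeca_faces true) -> ~ orientable M.
Proof.
move=> p [tail [t1 t2 t3]].
have bf : (base_face \in dodeca_faces true) && ((1, 18) \in base_face) by vm_compute.
have [f ef] := lf_surj p (proj1 (andP bf)).
have [|e ee] := @le_surj _ _ p (1, 18); first by vm_compute.
have ief : inEF e f by rewrite (lEF p) ee ef; case/andP: bf.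
set i := lv p (tail f e).
have ie : i \in [:: 1; 18].
  by have := t1 _ _ ief; rewrite (lVE p) -/i ee !inE.
have := allP tail_closure_table _ ie.
have reach t : t \in tail_closure i -> is_tail p tail t.
  move: t; apply: (@closure_ind _ _ _ _ (is_tail p tail)) => [t|g].
    by rewrite inE => /eqP ->; exists f, e; rewrite /= ef ee.
  by move=> /= [<-|[<-|//]] t; [apply: turn_is_tail|apply: cross_is_tail].
move/reach => [f' [e' [h1 /= h2 h3 h4]]].
have e1 : f = f' := lf_inj (etrans ef h2); have e2 : e = e' := le_inj (etrans ee h3).
move: h4; rewrite -e1 -e2 -/i /other_vertex; move: ie; rewrite !inE.
by case/orP => /eqP ->.
Qed.

Section TablePetrie.
Variables (R : realType) (P : nat -> 'rV[R]_3).
Hypothesis P_inj : forall i j, i < 20 -> j < 20 -> P i = P j -> i = j.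
Local Notation X x := (table_figure P (dodeca_faces x)).

Lemma table_petrie_type x : has_petrie_type (map_of (X x)) 6 6 6.
Proof.
split; first exact: table_has_type.
by have [p _] := table_presentation x P_inj; apply: presented_petrie_length p.
Qed.

Lemma table_petrie_dual x : petrie_dual (X x) (X (~~ x)).
Proof.
have [p [hv he hf]] := table_presentation x P_inj.
have walk_face w : petrie_polygon w ->
    forall e, e \in polygon P (petrie_face (dodeca_faces x) (state_of p w 0)) <->
      exists i, e = val (w i).2.
  move=> hw e; split.
    case/polygonP => l lF ->.
    have gF : petrie_face (dodeca_faces x) (state_of p w 0) \in dodeca_faces (~~ x).
      by apply/petrie_faceP; exists (state_of p w 0); first exact: (petrie_state_in p).
    have /allP hE : all (fun e => e \in dodeca_edges) (petrie_face (dodeca_faces x) (state_of p w 0)).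
      by have /and5P[_ /allP/(_ _ gF)/and5P[_ _ _ _ h] _ _ _] := maps_ok (~~ x).
    have [E eE] := le_surj p (hE l lF).
    have /(presented_petrie_faces p E hw)[i ei] : le p E \in petrie_face (dodeca_faces x) (state_of p w 0).
      by rewrite eE.
    by exists i; rewrite -ei he eE.
  case=> i ->; apply/polygonP; exists (le p (w i).2); last exact: he.
  by apply/(presented_petrie_faces p _ hw); exists i.
split=> // f; split.
  case/imfsetP => g /= /petrie_faceP[s sS ->] ->.
  have [w hw ws] := presented_petrie_exists p sS; exists w => //.
  by have := walk_face w hw; rewrite ws.
case=> w hw hfe; apply/imfsetP; exists (petrie_face (dodeca_faces x) (state_of p w 0)) => /=.
  by apply/petrie_faceP; exists (state_of p w 0); first exact: (petrie_state_in p).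
by apply/fsetP => e; apply/idP/idP => [/hfe/(walk_face w hw)|/(walk_face w hw)/hfe].
Qed.

Lemma table_orientable_of_genus : orientable_of_genus (map_of (X false)) 11.
Proof.
have [p _] := table_presentation false P_inj.
by split; [apply: presented_orientable p|rewrite (presented_euler p)].
Qed.

Lemma table_nonorientable_of_genus : nonorientable_of_genus (map_of (X true)) 22.
Proof.
have [p _] := table_presentation true P_inj.
by split; [apply: presented_nonorientable p|rewrite (presented_euler p)].
Qed.

End TablePetrie.

Local Open Scope ring_scope.

(** * The dodecahedron in space *)

(** A sufficient test for positivity, from the bounds 8/5 < phi < 13/8 by consecutive Fibonacci
    quotients. *)
Definition zpos (z : zphi) : bool :=
  if (0 <= z.2)%R then 0 < 5 * z.1 + 8 * z.2 else 0 < 8 * z.1 + 13 * z.2.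

(* The inner product with u + w is largest exactly on the edge [u, w]. *)
Definition short_pair (e : nat * nat) : bool :=
  let u := point dodeca e.1 in let w := point dodeca e.2 in
  let h v := padd (vdot u v) (vdot w v) in
  [&& (e.1 < 20)%N, (e.2 < 20)%N, e.1 != e.2, h u == h w &
    all (fun i => (i == e.1) || (i == e.2) || zpos (padd (h u) (popp (h (point dodeca i)))))
      (iota 0 20)].

(** The first pair is a short edge of the figures; the whole path joins the ends 18 and 1 of a long
    one. *)
Definition short_path : seq (nat * nat) := [:: (18, 15); (15, 7); (7, 3); (3, 1)]%N.

Lemma short_path_ok : all short_pair short_path.
Proof. by vm_compute. Qed.

Section DodecahedronInSpace.
Variable R : realType.
Local Notation E3 := 'rV[R]_3.

Lemma zposP z : zpos z -> 0 < ev R z.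
Proof.
rewrite /zpos /ev; have g := golden_gt R; have l := golden_lt R.
case: z => a b /=; case: ifP => hb h.
  have b0 : 0 <= b%:~R :> R by rewrite ler0z.
  have : 0 < (5 * a + 8 * b)%:~R :> R by rewrite ltr0z.
  by rewrite intrD !intrM => h'; nra.
have b0 : b%:~R <= 0 :> R by rewrite lerz0; lia.
have : 0 < (8 * a + 13 * b)%:~R :> R by rewrite ltr0z.
by rewrite intrD !intrM => h'; nra.
Qed.

Definition corner_point (i : nat) : E3 := evv R (point dodeca i).

Definition dodeca_verts : {fset E3} := [fset corner_point i | i in iota 0 20]%fset.

Lemma corner_point_in i : (i < 20)%N -> corner_point i \in dodeca_verts.
Proof.
move=> hi; apply/imfsetP; exists i => //.
by suff : i \in iota 0 20 by []; rewrite mem_iota.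
Qed.

Lemma dodeca_vertsP z : z \in dodeca_verts -> exists2 i, (i < 20)%N & z = corner_point i.
Proof. by move=> /imfsetP[i /= hi ->]; exists i => //; have : i \in iota 0 20 := hi; rewrite mem_iota. Qed.

Lemma corner_point_inj i j : (i < 20)%N -> (j < 20)%N -> corner_point i = corner_point j -> i = j.
Proof.
by move=> hi hj /evv_inj/eqP; rewrite nth_uniq ?dodeca_uniq // => /eqP.
Qed.

Lemma short_pair_hull_edge e : short_pair e ->
  hull_edge dodeca_verts (corner_point e.1) (corner_point e.2).
Proof.
case/and5P => h1 h2 n /eqP e12 /allP h.
pose a : E3 := corner_point e.1 + corner_point e.2.
have aE i : dot a (corner_point i) =
    ev R (padd (vdot (point dodeca e.1) (point dodeca i)) (vdot (point dodeca e.2) (point dodeca i))).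
  by rewrite dotDl !dot_evv ev_add.
apply: (@hull_edge_vertices _ _ a (dot a (corner_point e.1))); rewrite ?corner_point_in //.
- by move=> /(corner_point_inj h1 h2)/eqP; rewrite (negPf n).
- move=> v /dodeca_vertsP[i hi ->] n1 n2; rewrite !aE -subr_gt0 -ev_opp -ev_add.
  have hin : i \in iota 0 20 by rewrite mem_iota.
  apply: zposP; case/orP: (h i hin) => // /orP[]/eqP ei; first by rewrite ei eqxx in n1.
  by rewrite ei eqxx in n2.
- by rewrite !aE e12.
Qed.

(* Two vertices have the sum phi (u + w), so a supporting plane through u and w
   passes through the origin and touches the antipodes of u and w as well. *)
Lemma long_pair_no_hull_edge : ~ hull_edge dodeca_verts (corner_point 18) (corner_point 1).
Proof.
move=> [_ [a [b [le eq]]]].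
set u := corner_point 18 in eq *; set w := corner_point 1 in eq *.
have inc v : v \in [fset u; w]%fset -> dot a v = b.
  by move=> /conv_hull_sub; rewrite -eq => -[].
have au : dot a u = b by apply: inc; rewrite !inE eqxx.
have aw : dot a w = b by apply: inc; rewrite !inE eqxx orbT.
have lev i : (i < 20)%N -> dot a (corner_point i) <= b.
  by move=> hi; apply/le/conv_hull_sub/corner_point_in.
have anti : corner_point 0 = - u.
  by rewrite /u /corner_point -[RHS]sub0r; apply: row3P; rewrite !mxE /ev /=; ring.
have sumE : corner_point 4 + corner_point 15 = golden R *: (u + w).
  have e0 : vsub (point dodeca 4) (vscale phi_ (point dodeca 18)) =
     vsub (vscale phi_ (point dodeca 1)) (point dodeca 15) by vm_compute.
  have phiE i : evv R (vscale phi_ (point dodeca i)) = golden R *: corner_point i.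
    by rewrite evv_scale; congr (_ *: _); rewrite /ev /= mul1r add0r.
  have e : corner_point 4 - golden R *: u = golden R *: w - corner_point 15.
    by rewrite -!phiE; apply: etrans (esym (evv_sub R _ _)) (etrans _ (evv_sub R _ _)); rewrite e0.
  by rewrite -[corner_point 4](subrK (golden R *: u)) e addrAC subrK addrC scalerDr.
have g := golden_gt R.
have b_le : b <= 0.
  have := lerD (lev 4 isT) (lev 15 isT).
  by rewrite -dotDr sumE dotZr dotDr au aw => h; nra.
have b0 : b = 0 by have := lev 0 isT; rewrite anti dotNr au => h; lra.
have : conv_hull [fset u; w]%fset (- u).
  rewrite -eq; split; first by rewrite -anti; apply/conv_hull_sub/corner_point_in.
  by rewrite dotNr au b0 oppr0.
have pos v : v \in [fset u; w]%fset -> dot (- (u + w)) v <= 0.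
  have h i : i \in [:: 18; 1]%N -> zpos (padd (vdot (point dodeca 18) (point dodeca i)) (vdot (point dodeca 1) (point dodeca i))).
    by move: i; apply/allP; vm_compute.
  by rewrite !inE dotNl oppr_le0 dotDl => /orP[]/eqP ->; rewrite !dot_evv -ev_add ltW // zposP // h.
move=> /(conv_hull_le pos); rewrite dotNl dotNr opprK dotDl !dot_evv -ev_add.
by rewrite leNgt zposP.
Qed.

Lemma hull_distance_exists V (u w : E3) n : hull_path V u w n -> exists m, hull_distance V u w m.
Proof.
move=> h; have ex : exists n, `[< hull_path V u w n >] by exists n; apply/asboolP.
have [m /asboolP hm min] := ex_minnP ex.
by exists m; split=> // k hk; apply: min; apply/asboolP.
Qed.

Lemma hull_path0E V (u w : E3) : hull_path V u w 0 -> u = w.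
Proof. by move=> h; inversion h. Qed.

Lemma hull_path1E V (u w : E3) : hull_path V u w 1 -> hull_edge V u w.
Proof. by move=> h; inversion h as [|u' v w' m h1 h2]; rewrite -(hull_path0E h2). Qed.

(** The distance of the long pair is not computed: a path exists and no hull edge joins the ends, so
    it is defined and differs from 1. *)
Lemma different_hull_distances : exists n n', [/\ hull_distance dodeca_verts (corner_point 18) (corner_point 15) n,
  hull_distance dodeca_verts (corner_point 18) (corner_point 1) n' & n <> n'].
Proof.
have /and5P[/short_pair_hull_edge h1 /short_pair_hull_edge h2 /short_pair_hull_edge h3 /short_pair_hull_edge h4 _] := short_path_ok.
have [n hn] : exists n, hull_distance dodeca_verts (corner_point 18) (corner_point 1) n.
  apply: hull_distance_exists.
  exact: hull_pathS h1 (hull_pathS h2 (hull_pathS h3 (hull_pathS h4 (hull_path0 _ _)))).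
exists 1%N, n; split=> //.
  split; first exact: hull_pathS h1 (hull_path0 _ _).
  by case=> // /hull_path0E/(corner_point_inj (isT : 18 < 20)%N (isT : 15 < 20)%N).
by move=> n1; case: hn => + _; rewrite -n1 => /hull_path1E/long_pair_no_hull_edge.
Qed.

End DodecahedronInSpace.

(** * Planarity of the faces and the standard coordinates *)

Definition hexagon_normal (f : seq (nat * nat)) : zvec :=
  let w := unzip1 (face_walk f) in let p i := point dodeca (nth 0%N w i) in
  vcross (vsub (p 1%N) (p 0%N)) (vsub (p 2%N) (p 0%N)).

Lemma planar_faces_table : all (fun f => (hexagon_normal f != vzero) &&
  all (fun e => all (fun i => vdot (hexagon_normal f) (point dodeca i) ==
      vdot (hexagon_normal f) (point dodeca (head (0, 0) f).1)%N) [:: e.1; e.2]) f)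
    (dodeca_faces false).
Proof. by vm_compute. Qed.

(** The fourth vertex of each face lies off the plane of the first three. *)
Lemma skew_faces_table : all (fun f => let w := unzip1 (face_walk f) in
  let d i := vsub (point dodeca (nth 0%N w i)) (point dodeca (nth 0%N w 0)) in
  (vdot (hexagon_normal f) (d 3%N) != (0, 0)) &&
  all (fun i => has (on_edge (nth 0%N w i)) f) (iota 0 4)) (dodeca_faces true).
Proof. by vm_compute. Qed.

Definition pm (z : zphi) : seq zphi := [:: z; popp z].

Definition std_points : seq zvec :=
  [seq (u, c) | u <- [seq (a, b) | a <- pm (1, 0), b <- pm (1, 0)], c <- pm (1, 0)] ++
  [seq ((0, 0), b, c) | b <- pm phi_inv, c <- pm phi_] ++
  [seq (c, (0, 0), b) | b <- pm phi_inv, c <- pm phi_] ++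
  [seq (b, c, (0, 0)) | b <- pm phi_inv, c <- pm phi_].

Lemma mem_std_points p : (p \in std_points) =
  [|| p \in [seq (u, c) | u <- [seq (a, b) | a <- pm (1, 0), b <- pm (1, 0)], c <- pm (1, 0)],
      p \in [seq ((0, 0), b, c) | b <- pm phi_inv, c <- pm phi_],
      p \in [seq (c, (0, 0), b) | b <- pm phi_inv, c <- pm phi_] |
      p \in [seq (b, c, (0, 0)) | b <- pm phi_inv, c <- pm phi_]].
Proof.
rewrite /std_points; move: [seq _ | _ <- _, _ <- _] [seq (_, b, c) | b <- _, c <- _].
by move=> A B; rewrite mem_cat; congr orb; rewrite mem_cat; congr orb; rewrite mem_cat.
Qed.

Lemma std_points_dodeca : perm_eq std_points dodeca.
Proof. by vm_compute. Qed.

Lemma roots_act : all (fun r => (r != vzero) && all (fun i =>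
  is_refl r (point dodeca i) (point dodeca (nth 0%N (refl_perm dodeca r) i))) (iota 0 20)) dodeca_roots.
Proof. by vm_compute. Qed.

Lemma unequal_edges : vdot (vsub (point dodeca 1) (point dodeca 18)) (vsub (point dodeca 1) (point dodeca 18)) !=
  vdot (vsub (point dodeca 15) (point dodeca 18)) (vsub (point dodeca 15) (point dodeca 18)).
Proof. by vm_compute. Qed.

Section Placed.
Variable R : realType.
Local Notation E3 := 'rV[R]_3.
Local Notation corner_point := (corner_point R).

Lemma golden_inv : (golden R)^-1 = ev R phi_inv.
Proof.
have g := golden_gt R; have g0 : golden R != 0 by rewrite gt_eqF //; lra.
apply: (mulfI g0); rewrite mulfV // /ev /= mul1r; have := golden_sqr R; rewrite expr2 => h.
by rewrite mulrDr h; ring.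
Qed.

Lemma ev_phi : ev R phi_ = golden R.
Proof. by rewrite /ev /= mul1r add0r. Qed.

Lemma ev1 : ev R (1, 0) = 1.
Proof. by rewrite /ev /= mul0r addr0. Qed.

Lemma pmP z (c : R) : 0 <= ev R z -> `|c| = ev R z <-> exists2 z', z' \in pm z & c = ev R z'.
Proof.
move=> z0; split=> [h|[z']].
  case: (lerP 0 c) => c0; first by exists z; rewrite ?inE ?eqxx // -h ger0_norm.
  by exists (popp z); rewrite ?inE ?eqxx ?orbT // ev_opp -h ltr0_norm // opprK.
by rewrite !inE => /orP[]/eqP -> ->; rewrite ?ev_opp ?normrN ger0_norm.
Qed.

Lemma std_dodecahedronP (z : E3) : std_dodecahedron z <-> exists2 p, p \in std_points & z = evv R p.
Proof.
have g := golden_gt R.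
have p1 (c : R) : `|c| = 1 <-> exists2 z', z' \in pm (1, 0) & c = ev R z'.
  by have := @pmP (1, 0) c; rewrite ev1; apply; rewrite ler01.
have pp (c : R) : `|c| = golden R <-> exists2 z', z' \in pm phi_ & c = ev R z'.
  by have := @pmP phi_ c; rewrite ev_phi; apply; lra.
have pi (c : R) : `|c| = (golden R)^-1 <-> exists2 z', z' \in pm phi_inv & c = ev R z'.
  by rewrite golden_inv; apply: pmP; rewrite -golden_inv invr_ge0; lra.
have ev0 : ev R (0, 0) = 0 by rewrite /ev /= mul0r addr0.
have i3 (i : 'I_3) : [\/ i = 0, i = 1 | i = 2%:R].
  by case: i => -[|[|[|//]]] hi; [constructor 1|constructor 2|constructor 3]; apply: val_inj.
have s01 : 0 + 1 = 1 :> 'I_3 by apply: val_inj.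
have s02 : 0 + 2 = 2 :> 'I_3 by apply: val_inj.
have s11 : 1 + 1 = 2 :> 'I_3 by apply: val_inj.
have s12 : 1 + 2 = 0 :> 'I_3 by apply: val_inj.
have s21 : 2 + 1 = 0 :> 'I_3 by apply: val_inj.
have s22 : 2 + 2 = 1 :> 'I_3 by apply: val_inj.
split.
  case=> [h|[i]].
    have [[a ha ea] [b hb eb] [c hc ec]] := And3 (iffLR (p1 _) (h 0)) (iffLR (p1 _) (h 1)) (iffLR (p1 _) (h 2%:R)).
    exists (a, b, c); last by apply: row3P; rewrite !vec3E.
    rewrite mem_std_points; apply/orP; left; apply/allpairsPdep; exists (a, b), c; split=> //.
    by apply/allpairsPdep; exists a, b.
  case: (i3 i) => -> []; rewrite ?(s01, s02, s11, s12, s21, s22) => h0 /pi[b hb eb] /pp[c hc ec].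
  - exists ((0, 0), b, c); last by apply: row3P; rewrite !vec3E ?ev0.
    by rewrite mem_std_points; apply/or4P; constructor 2; apply/allpairsPdep; exists b, c.
  - exists (c, (0, 0), b); last by apply: row3P; rewrite !vec3E ?ev0.
    by rewrite mem_std_points; apply/or4P; constructor 3; apply/allpairsPdep; exists b, c.
  exists (b, c, (0, 0)); last by apply: row3P; rewrite !vec3E ?ev0.
  by rewrite mem_std_points; apply/or4P; constructor 4; apply/allpairsPdep; exists b, c.
case=> p; rewrite mem_std_points => /or4P[] /allpairsPdep[u [c [hu hc ->]]] ->.
- have /allpairsPdep[a [b [ha hb ->]]] := hu; left => i.
  by case: (i3 i) => ->; rewrite vec3E /=; apply/p1; [exists a|exists b|exists c].
- right; exists 0; rewrite s01 s02 !vec3E /=; split; [exact: ev0|apply/pi|apply/pp]; by [exists u|exists c].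
- right; exists 1; rewrite s11 s12 !vec3E /=; split; [exact: ev0|apply/pi|apply/pp]; by [exists u|exists c].
right; exists 2%:R; rewrite s21 s22 !vec3E /=; split; [exact: ev0|apply/pi|apply/pp]; by [exists u|exists c].
Qed.

Lemma dodecahedral_table F : dodecahedral_vertices (table_figure corner_point F).
Proof.
exists id; first by exists 1 => // x y; rewrite mul1r.
rewrite image_id; apply/seteqP; split=> z /=.
  move=> /dodeca_vertsP[i hi ->]; apply/std_dodecahedronP; exists (point dodeca i) => //.
  by rewrite (perm_mem std_points_dodeca) mem_nth ?dodeca_size.
case/std_dodecahedronP => p; rewrite (perm_mem std_points_dodeca) => pD ->.
rewrite -(nth_index vzero pD); apply: corner_point_in.
by rewrite -dodeca_size index_mem.
Qed.

Lemma planar_polygon f : f \in dodeca_faces false -> planar_face (polygon corner_point f).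
Proof.
move=> fF; have /andP[n0 /allP h] := allP planar_faces_table f fF.
exists (evv R (hexagon_normal f)), (ev R (vdot (hexagon_normal f) (point dodeca (head (0, 0)%N f).1))).
split; first by apply/eqP; apply: evv_neq0.
have hh e i : e \in f -> i \in [:: e.1; e.2] -> dot (evv R (hexagon_normal f)) (corner_point i) =
    ev R (vdot (hexagon_normal f) (point dodeca (head (0, 0)%N f).1)).
  by move=> ef ie; rewrite dot_evv; congr ev; apply/eqP; apply: (allP (h e ef)).
move=> e x /polygonP[l lf ->]; rewrite !inE => /orP[]/eqP ->; apply: (hh l _ lf); by rewrite !inE eqxx ?orbT.
Qed.

Lemma skew_polygon f : f \in dodeca_faces true -> ~ planar_face (polygon corner_point f).
Proof.
move=> fF [a [b [a0 h]]]; have /andP[n0 /allP hw] := allP skew_faces_table f fF.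
set w := unzip1 (face_walk f) in n0 hw.
have hb i : i \in iota 0 4 -> dot a (corner_point (nth 0%N w i)) = b.
  move=> /hw/hasP[e ef ie]; apply: (h (segment corner_point e)); first by apply/polygonP; exists e.
  by case/orP: ie => /eqP ->; rewrite !inE eqxx ?orbT.
pose d i := vsub (point dodeca (nth 0%N w i)) (point dodeca (nth 0%N w 0)).
have hd i : i \in iota 0 4 -> dot a (evv R (d i)) = 0.
  by move=> hi; rewrite evv_sub dotDr dotNr !hb ?subrr.
have nE : evv R (hexagon_normal f) = cross (evv R (d 1%N)) (evv R (d 2%N)) by rewrite cross_evv.
have n1 : dot (evv R (hexagon_normal f)) (evv R (d 3%N)) != 0.
  by rewrite dot_evv; apply: contra_neq n0; apply: ev_eq0.
have c0 : cross (evv R (d 1%N)) (evv R (d 2%N)) != 0.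
  by apply: contra_neq n1 => c0; rewrite nE c0 dot0l.
have [l al] := perp_cross c0 (hd 1%N isT) (hd 2%N isT).
have := hd 3%N isT; rewrite al -nE dotZl => /eqP; rewrite mulf_eq0 (negPf n1) orbF => /eqP l0.
by apply: a0; rewrite al l0 scale0r.
Qed.

End Placed.

(** * The two figures up to similarity *)

Section Similar.
Variable R : realType.
Local Notation E3 := 'rV[R]_3.
Local Notation corner_point := (corner_point R).
Local Notation dodeca_figure x := (table_figure corner_point (dodeca_faces x)).

Lemma similarityE (s : E3 -> E3) : similarity s ->
  exists k A t, [/\ 0 < k, orthogonal_mx A & s =1 simil k A t].
Proof. by move=> [k k0 hs]; have [A hA sA] := similarity_affine k0 hs; exists k, A, (s 0). Qed.

Lemma planar_simil k A t (f : {fset {fset E3}}) : 0 < k -> orthogonal_mx A ->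
  planar_face f -> planar_face (image_face (simil k A t) f).
Proof.
move=> k0 hA [a [b [a0 h]]]; exists (a *m A), (k * b + dot (a *m A) t); split.
  by move=> a1; apply: a0; apply: dot_eq0; rewrite -(dot_orth _ _ hA) a1 dot0l.
move=> e x /imfsetP[e' /= ef ->] /imfsetP[y /= ye ->].
by rewrite dot_simil // (h e' y).
Qed.

(** Similarities keep planar faces planar; the first figure has planar faces, the second has
    none. *)
Lemma dodeca_figures_dissimilar : ~ similar_figures (dodeca_figure false) (dodeca_figure true).
Proof.
move=> [s /similarityE[k [A [t [k0 hA sE]]]] e].
have [f fF] : exists f, f \in dodeca_faces false by eexists; apply: mem_head.
have hf : image_face s (polygon corner_point f) \in faces (dodeca_figure true).
  by rewrite -e; apply/imfsetP; exists (polygon corner_point f) => //; apply/imfsetP; exists f.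
have /imfsetP[g /= gF eg] := hf.
apply: (@skew_polygon R g gF); rewrite -eg.
have -> : image_face s (polygon corner_point f) = image_face (simil k A t) (polygon corner_point f).
  by congr image_face; apply/funext.
exact/planar_simil/planar_polygon.
Qed.

Section Image.
Variables (k : R) (A : 'M[R]_3) (t : E3) (x : bool).
Hypotheses (k0 : 0 < k) (hA : orthogonal_mx A).

Definition placed_point (i : nat) : E3 := simil k A t (corner_point i).
Local Notation X := (table_figure placed_point (dodeca_faces x)).

Lemma simil_edist y z : edist (simil k A t y) (simil k A t z) = k * edist y z.
Proof. by rewrite affine_edist // ltW. Qed.

Lemma placed_point_inj i j : (i < 20)%N -> (j < 20)%N -> placed_point i = placed_point j -> i = j.
Proof. by move=> hi hj /(simil_inj k0 hA)/corner_point_inj; apply. Qed.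

Lemma placed_root r : r \in dodeca_roots -> exists2 s, Defs.isometry s &
  forall i, (i < 20)%N -> s (placed_point i) = placed_point (nth 0%N (refl_perm dodeca r) i).
Proof.
move=> rD; have /andP[r0 /allP h] := allP roots_act r rD.
exists (simil k A t \o refl (evv R r) \o simil_inv k A t); last first.
  move=> i hi; rewrite /= similK //; congr simil; apply/(is_reflP R _ _ r0).
  by apply: h; rewrite mem_iota.
move=> y z /=; rewrite -[in RHS](simil_invK t k0 hA y) -[in RHS](simil_invK t k0 hA z) !simil_edist.
by congr (_ * _); rewrite /edist -linearB dot_refl.
Qed.

Lemma placed_lengths : edist (placed_point 1) (placed_point 18) <> edist (placed_point 15) (placed_point 18).
Proof.
rewrite !simil_edist => /(mulfI (lt0r_neq0 k0))/(congr1 (fun c => c ^+ 2)).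
rewrite !sqr_edist -!evv_sub !dot_evv => /ev_inj e.
by have := unequal_edges; rewrite e eqxx.
Qed.

Lemma placed_edge_lengths : edges_of_different_lengths X.
Proof.
have [n [n' [h1 h2 n12]]] := different_hull_distances R.
exists (placed_point 18), (placed_point 15), (placed_point 18), (placed_point 1), n, n'.
have vE : verts X = [fset simil k A t v | v in dodeca_verts R]%fset by rewrite /dodeca_verts imfset_seqE.
have eE i j : (i, j) \in dodeca_edges -> [fset placed_point j; placed_point i]%fset \in edges X.
  by move=> ij; apply/imfsetP; exists (i, j); rewrite //= fsetUC.
split=> //; [exact: eE|exact: eE| |]; by rewrite vE; apply: hull_distance_simil.
Qed.

Lemma placed_figure : [/\ regular_index2 X, one_vertex_orbit X & edges_of_different_lengths X].
Proof.
have [h1 h2] := table_regular x placed_point_inj placed_root placed_lengths.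
by split=> //; apply: placed_edge_lengths.
Qed.

End Image.

Lemma similar_dodeca (x : bool) (X : figure R) : similar_figures (dodeca_figure x) X ->
  [/\ regular_index2 X, one_vertex_orbit X & edges_of_different_lengths X].
Proof.
move=> [s /similarityE[k [A [t [k0 hA sE]]]] <-]; rewrite image_table.
have -> : s \o corner_point = placed_point k A t by apply/funext => i; apply: sE.
exact: placed_figure.
Qed.

Lemma dodeca_similar (X : figure R) : regular_index2 X -> edges_of_different_lengths X ->
  exists x, similar_figures (dodeca_figure x) X.
Proof.
move=> hX hlen; have [k [A [t [x [k0 hA ->]]]]] := recognition hX hlen.
exists x, (simil k A t); first exact: simil_similarity.
by rewrite image_table.
Qed.

End Similar.

Theorem theorem5p2 (R : realType) :
  exists P Q : figure R,
    (forall X : figure R,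
       [/\ regular_index2 X, one_vertex_orbit X & edges_of_different_lengths X]
       <-> similar_figures P X \/ similar_figures Q X) /\
    ~ similar_figures P Q /\
    (petrie_dual P Q /\ petrie_dual Q P) /\
    (has_petrie_type (map_of P) 6 6 6 /\ has_petrie_type (map_of Q) 6 6 6) /\
    (dodecahedral_vertices P /\ dodecahedral_vertices Q) /\
    (orientable_of_genus (map_of P) 11 /\
     forall f, f \in faces P -> planar_face f) /\
    (nonorientable_of_genus (map_of Q) 22 /\
     forall f, f \in faces Q -> ~ planar_face f).
Proof.
pose fig x := table_figure (corner_point R) (dodeca_faces x).
have inj := @corner_point_inj R.
exists (fig false), (fig true); split.
  move=> X; split=> [[hX _ hlen]|[] /similar_dodeca //].
  by have [[] h] := dodeca_similar hX hlen; [right|left].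
split; first exact: dodeca_figures_dissimilar.
split; first by split; [apply: (table_petrie_dual inj false)|apply: (table_petrie_dual inj true)].
split; first by split; apply: table_petrie_type.
split; first by split; apply: dodecahedral_table.
split; split.
- exact: table_orientable_of_genus.
- by move=> f /imfsetP[g /= gF ->]; apply: planar_polygon.
- exact: table_nonorientable_of_genus.
by move=> f /imfsetP[g /= gF ->]; apply: skew_polygon.
Qed.
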